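(* Let $(\Gamma,X)$ be a finite-state faithful self-similar group. Then the Bernoulli measure $\mu$ on $X^{\mathbb N}$ is essentially free with respect to $K(\Gamma,X)$, and $\mathrm C^*(K(\Gamma,X))$ admits a unique tracial state.
   Context: Self-similar groups. $X$ is a finite set with $|X|\ge2$ and $X^*$ is the set of finite words on $X$ (including the empty word), viewed as a rooted tree in which $w$ and $wx$ are joined by an edge for $w\in X^*$, $x\in X$. For an automorphism $\varphi$ of the rooted tree $X^*$ and $w\in X^*$, $\varphi|_w$ is the automorphism with $\varphi(wv)=\varphi(w)\varphi|_w(v)$ for all $v\in X^*$; $\varphi$ is finite-state if $\{\varphi|_w\mid w\in X^*\}$ is finite. $\varphi$ induces a homeomorphism of $X^{\mathbb N}$ (the space of infinite words, with the product topology), again denoted $\varphi$, with $\varphi(w)_{[1,n]}=\varphi(w_{[1,n]})$ for all $n$. A faithful self-similar group $(\Gamma,X)$ is a faithful action of a group $\Gamma$ by automorphisms on $X^*$ such that $g|_v\in\Gamma$ for all $g\in\Gamma$, $v\in X^*$; it is finite-state if each $g\in\Gamma$ is finite-state. The Bernoulli measure $\mu$ is the (uniform) Borel probability measure on $X^{\mathbb N}$ with $\mu(wX^{\mathbb N})=|X|^{-|w|}$ for $w\in X^*$. The groupoid $K(\Gamma,X)$. For $u,v\in X^*$ with $|u|=|v|$ and $g\in\Gamma$ let $g_{u,v}\colon vX^{\mathbb N}\to uX^{\mathbb N}$, $g_{u,v}(vw)=ug(w)$. $K(\Gamma,X)$ is the groupoid of germs of the pseudogroup $S=\{g_{u,v}\mid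 g\in\Gamma,\ u,v\in X^*,\ |u|=|v|\}$ on $X^{\mathbb N}$ (the empty map may be added; it contributes no germs). Here the groupoid of germs of a pseudogroup $(S,Y)$ ($S$ a set of homeomorphisms between open subsets of a locally compact Hausdorff space $Y$, closed under composition and inversion, whose domains cover $Y$) is the set of classes $[s,x]$ with $s\in S$, $x\in\operatorname{dom}s$, where $[s,x]=[t,y]$ iff $x=y$ and $s,t$ agree on a neighbourhood of $x$ contained in $\operatorname{dom}s\cap\operatorname{dom}t$; product $[t,sx][s,x]=[ts,x]$, inverse $[s,x]^{-1}=[s^{-1},sx]$; the topology has basis $\Theta(s,U)=\{[s,x]\mid x\in U\}$, $s\in S$, $U\subset\operatorname{dom}s$ open. It is étale with unit space identified with $Y$. Essential freeness. For an étale groupoid $G$ with unit space $G^0$ and range and source maps $\mathbf r,\mathbf s$, a bisection is an open set $U\subset G$ such that $\mathbf r|_U,\mathbf s|_U$ are homeomorphisms onto their images, and $\mathrm{Iso}(G)=\{g\mid\mathbf r(g)=\mathbf s(g)\}$. For a Radon measure $\mu$ on $G^0$, the semifinite part is $\mu_{\mathrm{sf}}(A)=\sup\{\mu(B)\mid B\subset A\text{ Borel},\ \mu(B)<\infty\}$ (equal to $\mu$ when $\mu$ is finite). $\mu$ is essentially free with respect to $G$ if $\mu_{\mathrm{sf}}(\mathbf s(U\cap\mathrm{Iso}(G)\setminus G^0))=0$ for every bisection $U\subset G$. Algebra. For an étale groupoid $G$ (not necessarily Hausdorff), $\mathcal C_c(G)$ is the linear span of the functions on $G$ that are continuous with compact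 support on some open Hausdorff subset $U\subset G$ and zero outside $U$, with $(ab)(g)=\sum_{g_1g_2=g}a(g_1)b(g_2)$ and $a^*(g)=\overline{a(g^{-1})}$. $\mathrm C^*(G)$ is the completion of $\mathcal C_c(G)$ in the supremum of all $\mathrm C^*$-seminorms. A tracial state is a state $\tau$ with $\tau(ab)=\tau(ba)$ for all $a,b$. *)

(* Defs.v *)
From HB Require Import structures.
From mathcomp Require Import all_boot all_order all_algebra complex.
From mathcomp Require Import all_classical all_reals all_analysis.

Set Implicit Arguments.
Unset Strict Implicit.
Unset Printing Implicit Defensive.

Import Order.TTheory GRing.Theory Num.Theory.
Import numFieldNormedType.Exports.

Local Open Scope classical_set_scope.
Local Open Scope ring_scope.
Local Open Scope quotient_scope.

Definition homeo_onto_image (S T : topologicalType) (U : set S) (f : S -> T) :=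
  {within U, continuous f} /\
  exists2 g : T -> S, {within f @` U, continuous g} &
    forall x, U x -> g (f x) = x.

(* Products are a total function [gmul] constrained only on composable pairs,
   and the unit space [G^0] is the image of the embedding [gunit] of [gbase].
   The base is pointed, hence nonempty, because measurable types are. *)
Record etale_groupoid := EtaleGroupoid {
  gbase : ptopologicalType;
  garr : topologicalType;
  gsrc : garr -> gbase;
  grng : garr -> gbase;
  gunit : gbase -> garr;
  ginv : garr -> garr;
  gmul : garr -> garr -> garr;
  gsrc_unit : forall x, gsrc (gunit x) = x;
  grng_unit : forall x, grng (gunit x) = x;
  gsrc_inv : forall g, gsrc (ginv g) = grng g;
  grng_inv : forall g, grng (ginv g) = gsrc g;
  gsrc_mul : forall g h, gsrc g = grng h -> gsrc (gmul g h) = gsrc h;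
  grng_mul : forall g h, gsrc g = grng h -> grng (gmul g h) = grng g;
  gmulA : forall g h k, gsrc g = grng h -> gsrc h = grng k ->
    gmul g (gmul h k) = gmul (gmul g h) k;
  gmul1g : forall g, gmul (gunit (grng g)) g = g;
  gmulg1 : forall g, gmul g (gunit (gsrc g)) = g;
  gmulVg : forall g, gmul (ginv g) g = gunit (gsrc g);
  gmulgV : forall g, gmul g (ginv g) = gunit (grng g);
  gbase_hausdorff : hausdorff_space gbase;
  gbase_locally_compact : locally_compact [set: gbase];
  gunit_continuous : continuous gunit;
  ginv_continuous : continuous ginv;
  gmul_continuous : {within [set p : garr * garr | gsrc p.1 = grng p.2],
    continuous (fun p => gmul p.1 p.2)};
  gsrc_etale : forall g, exists U : set garr,
    [/\ open U, U g, open (gsrc @` U) & homeo_onto_image U gsrc]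
}.

Definition borel (T : ptopologicalType) := g_sigma_algebraType (@open T).

Section essentially_free.
Variable G : etale_groupoid.

Definition bisection (U : set (garr G)) :=
  [/\ open U, homeo_onto_image U (@grng G) & homeo_onto_image U (@gsrc G)].

Definition isotropy : set (garr G) := [set g | grng g = gsrc g].

Definition units : set (garr G) := range (@gunit G).

Variable R : realType.
Variable mu : {measure set borel (gbase G) -> \bar R}.

Definition semifinite_part (A : set (borel (gbase G))) : \bar R :=
  ereal_sup [set mu B | B in
    [set B | [/\ measurable B, B `<=` A & (mu B < +oo)%E]]].

Definition essentially_free := forall U : set (garr G), bisection U ->
  semifinite_part (@gsrc G @` ((U `&` isotropy) `\` units)) = 0%E.

End essentially_free.

Section convolution_algebra.
Variables (R : realType) (G : etale_groupoid).
Local Notation C := R[i].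

(* As [U] is open, [subspace U] is Hausdorff exactly when [U] is; the third
   condition says that the support of [f] relative to [U] is compact. *)
Definition compactly_supported_on (U : set (garr G)) (f : garr G -> C) :=
  [/\ {within U, continuous (f : garr G -> C^o)},
      forall g, ~ U g -> f g = 0 &
      compact (U `&` closure [set g | f g != 0])].

Definition cc_generator (f : garr G -> C) := exists U : set (garr G),
  [/\ open U, hausdorff_space (subspace U) & compactly_supported_on U f].

Definition cc : set (garr G -> C) := [set f |
  exists n (c : 'I_n -> C) (h : 'I_n -> garr G -> C),
    (forall i, cc_generator (h i)) /\
    f = (fun g => \sum_(i < n) c i * h i g)].

(* For [a] and [b] in [cc] only finitely many terms are nonzero, which is what
   the finitely supported sum over a set requires. *)
Definition conv (a b : garr G -> C) (g : garr G) : C :=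
  \sum_(p \in [set p : garr G * garr G |
                 gsrc p.1 = grng p.2 /\ gmul p.1 p.2 = g]) (a p.1 * b p.2).

Definition cc_star (a : garr G -> C) (g : garr G) : C := conjc (a (ginv g)).

(* Only the values of [p] on [cc] are relevant. *)
Record cstar_seminorm (p : (garr G -> C) -> R) : Prop := {
  seminorm_ge0 : forall a, cc a -> 0 <= p a;
  seminormZ : forall z a, cc a ->
    p (fun g => z * a g) = complex.Re `|z| * p a;
  seminormD : forall a b, cc a -> cc b ->
    p (fun g => a g + b g) <= p a + p b;
  seminormM : forall a b, cc a -> cc b -> p (conv a b) <= p a * p b;
  seminormVM : forall a, cc a -> p (conv (cc_star a) a) = p a ^+ 2
}.

Definition full_norm (a : garr G -> C) : \bar R :=
  ereal_sup [set (p a)%:E | p in cstar_seminorm].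

End convolution_algebra.

(* The norm takes values in [R[i]], as for every normed module over [R[i]].
   No unit is required. *)
Record cstar_algebra (R : realType) := CstarAlgebra {
  cstar_sort :> completeNormedModType R[i];
  cmul : cstar_sort -> cstar_sort -> cstar_sort;
  cstar : cstar_sort -> cstar_sort;
  cmulA : associative cmul;
  cmul_linearl : forall b, linear (cmul^~ b);
  cmul_linearr : forall a, linear (cmul a);
  cstarK : involutive cstar;
  cstar_linear : forall z a b,
    cstar (z *: a + b) = conjc z *: cstar a + cstar b;
  cstarM : forall a b, cstar (cmul a b) = cmul (cstar b) (cstar a);
  cnormM : forall a b, `|cmul a b| <= `|a| * `|b|;
  cnormVM : forall a, `|cmul (cstar a) a| = `|a| ^+ 2
}.

Definition tracial_state (R : realType) (A : cstar_algebra R)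
    (tau : A -> R[i]) :=
  [/\ forall z a b, tau (z *: a + b) = z * tau a + tau b,
      forall a, 0 <= tau (cmul (cstar a) a),
      ereal_sup [set (complex.Re `|tau a|)%:E | a in [set a | `|a| <= 1]]
        = 1%E &
      forall a b, tau (cmul a b) = tau (cmul b a)].

(* [(A, iota)] is the completion of [cc G] in the norm [full_norm]: such a pair
   is unique up to a unique isomorphism, and is [C^*(G)] together with its
   canonical map. Only the values of [iota] on [cc G] are relevant. *)
Record is_full_cstar_algebra (R : realType) (G : etale_groupoid)
    (A : cstar_algebra R) (iota : (garr G -> R[i]) -> A) : Prop := {
  full_linear : forall z a b, cc a -> cc b ->
    iota (fun g => z * a g + b g) = z *: iota a + iota b;
  full_mul : forall a b, cc a -> cc b ->
    iota (conv a b) = cmul (iota a) (iota b);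
  full_star : forall a, cc a -> iota (cc_star a) = cstar (iota a);
  full_isometry : forall a, cc a ->
    (complex.Re `|iota a|)%:E = full_norm a;
  full_dense : dense (iota @` @cc R G)
}.

(* Partial maps of [Y] are functions [Y -> option Y], so that composition and
   equality of partial maps are those of functions. *)
Section partial_maps.
Variable Y : topologicalType.
Implicit Types s t : Y -> option Y.

Definition pcomp t s : Y -> option Y := fun x => obind t (s x).

Definition pinv s : Y -> option Y := fun y =>
  if pselect (exists x, s x = Some y) is left h then Some (projT1 (cid h))
  else None.

Definition pcontinuous s :=
  forall V : set Y, open V -> open [set x | exists2 y, s x = Some y & V y].

(* [V = setT] shows that the domains of [s] and [pinv s] are open. *)
Definition partial_homeo s :=
  [/\ forall x y z, s x = Some z -> s y = Some z -> x = y,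
      pcontinuous s & pcontinuous (pinv s)].

Lemma pinvP s : (forall x y z, s x = Some z -> s y = Some z -> x = y) ->
  forall x y, pinv s y = Some x <-> s x = Some y.
Proof.
move=> sI x y; rewrite /pinv; case: pselect => [h|h]; last first.
  by split=> // sxy; exfalso; apply: h; exists x.
case: (cid h) => z /= szy; split=> [[<-]//|sxy].
by congr Some; exact: sI szy sxy.
Qed.

Lemma pinv_eq s t : (forall x y, s x = Some y <-> t y = Some x) -> pinv s = t.
Proof.
move=> st; have sI x y z : s x = Some z -> s y = Some z -> x = y.
  by move=> /st tz /st; rewrite tz => -[].
apply/funext => y; case E : (pinv s y) => [x|].
  by move/(pinvP sI)/st: E => ->.
by case F : (t y) => [x|//]; move/st/(pinvP sI): F; rewrite E.
Qed.

End partial_maps.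

Record pseudogroup (Y : topologicalType) := Pseudogroup {
  psg_set :> (Y -> option Y) -> Prop;
  psg_homeo : forall s, psg_set s -> partial_homeo s;
  psg_comp : forall s t, psg_set s -> psg_set t -> psg_set (pcomp t s);
  psg_inv : forall s, psg_set s -> psg_set (pinv s);
  psg_cover : forall x, exists2 s, psg_set s & s x
}.

Section germs.
Variables (Y : ptopologicalType) (S : pseudogroup Y).

Record pregerm := Pregerm {
  pg_map : Y -> option Y;
  pg_point : Y;
  pg_mapP : S pg_map;
  pg_pointP : pg_map pg_point
}.

HB.instance Definition _ := gen_eqMixin pregerm.
HB.instance Definition _ := gen_choiceMixin pregerm.

Definition same_germ (p q : pregerm) : bool :=
  `[< pg_point p = pg_point q /\
      \forall z \near pg_point p, pg_map p z /\ pg_map p z = pg_map q z >].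

Lemma psg_open_dom s : S s -> open [set x | s x].
Proof.
move=> /psg_homeo[_ sC _]; have := sC setT openT.
congr open; apply/seteqP; split=> x /=; first by case=> y ->.
by case: (s x) => // y _; exists y.
Qed.

Lemma psg_near_dom s x : S s -> s x -> \forall z \near x, s z.
Proof. by move=> Ss sx; exact: open_nbhs_nbhs (conj (psg_open_dom Ss) sx). Qed.

Lemma same_germ_sym p q : same_germ p q -> same_germ q p.
Proof.
move=> /asboolP[pq pq']; apply/asboolP; rewrite -pq; split=> //.
by apply: filterS pq' => z [pz <-].
Qed.

Lemma same_germ_equiv : equiv_class_of same_germ.
Proof.
split=> [p|p q|q p r].
- apply/asboolP; split=> //.
  by apply: filterS (psg_near_dom (pg_mapP p) (pg_pointP p)).
- by apply/idP/idP; exact: same_germ_sym.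
- move=> /asboolP[pq pq'] /asboolP[qr qr']; apply/asboolP.
  split; first by rewrite pq.
  by rewrite -pq in qr'; apply: filterS2 pq' qr' => z [_ ->] [qz qrz]; split.
Qed.

Canonical same_germ_equiv_rel := EquivRelPack same_germ_equiv.

Definition germ : Type := {eq_quot same_germ_equiv_rel}.

HB.instance Definition _ := Choice.on germ.

Definition germ_of s x (Ss : S s) (sx : s x) : germ :=
  \pi_({eq_quot same_germ_equiv_rel}) (Pregerm Ss sx).

Lemma germ_of_eq s t x y (Ss : S s) (St : S t) (sx : s x) (ty : t y) :
  germ_of Ss sx = germ_of St ty <->
  (x = y /\ \forall z \near x, s z = t z).
Proof.
split=> [/eqmodP/asboolP[/= -> st]|[xy st]].
  by split=> //; apply: filterS st => z [].
apply/eqmodP/asboolP; split=> //=.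
by apply: filterS2 (psg_near_dom Ss sx) st.
Qed.

Lemma germP (g : germ) :
  exists s x (Ss : S s) (sx : s x), g = germ_of Ss sx.
Proof.
rewrite -[g]reprK; case: (repr g) => s x Ss sx.
by exists s, x, Ss, sx.
Qed.

Definition germ_src (g : germ) : Y := pg_point (repr g).

Definition germ_rng (g : germ) : Y :=
  let p := repr g in odflt (pg_point p) (pg_map p (pg_point p)).

Lemma repr_germ_of s x (Ss : S s) (sx : s x) :
  let p := repr (germ_of Ss sx) in
  pg_point p = x /\ \forall z \near x, pg_map p z = s z.
Proof.
move=> p; have : germ_of (pg_mapP p) (pg_pointP p) = germ_of Ss sx.
  rewrite -[RHS]reprK /germ_of -/p; by case: (p).
by move=> /germ_of_eq[px]; rewrite px.
Qed.

Lemma germ_src_of s x (Ss : S s) (sx : s x) : germ_src (germ_of Ss sx) = x.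
Proof. by case: (repr_germ_of Ss sx). Qed.

Lemma germ_rng_of s x y (Ss : S s) (sx : s x) :
  s x = Some y -> germ_rng (germ_of Ss sx) = y.
Proof.
move=> sxy; rewrite /germ_rng; case: (repr_germ_of Ss sx) => -> /nbhs_singleton.
by move=> ->; rewrite sxy.
Qed.

Lemma pinv_dom s x y : S s -> s x = Some y -> pinv s y.
Proof.
move=> /psg_homeo[sI _ _] sxy.
by have /(pinvP sI) -> : s x = Some y by [].
Qed.

Lemma pregerm_some (p : pregerm) :
  {y | pg_map p (pg_point p) = Some y}.
Proof. by move: (pg_pointP p); case: (pg_map p _) => // y _; exists y. Qed.

Definition germ_inv (g : germ) : germ :=
  let p := repr g in
  germ_of (psg_inv (pg_mapP p))
          (pinv_dom (pg_mapP p) (projT2 (pregerm_some p))).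

Lemma pcomp_dom (s t : Y -> option Y) x y : s x = Some y -> t y -> pcomp t s x.
Proof. by rewrite /pcomp => ->. Qed.

Lemma composable_dom (g h : germ) : germ_src g = germ_rng h ->
  pcomp (pg_map (repr g)) (pg_map (repr h)) (pg_point (repr h)).
Proof.
rewrite /germ_src /germ_rng; have [y hy] := pregerm_some (repr h).
by rewrite hy /= => gy; apply: (pcomp_dom hy); rewrite -gy; exact: pg_pointP.
Qed.

(* The value [g] on non-composable pairs is irrelevant. *)
Definition germ_mul (g h : germ) : germ :=
  if pselect (germ_src g = germ_rng h) is left gh then
    germ_of (psg_comp (pg_mapP (repr h)) (pg_mapP (repr g))) (composable_dom gh)
  else g.

Lemma punit_dom x : exists2 s, S s & pcomp (pinv s) s x.
Proof.
have [s Ss sx] := psg_cover S x; exists s => //.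
move: sx; case E : (s x) => [y|//] _.
by apply: (pcomp_dom E); exact: (pinv_dom Ss E).
Qed.

Definition germ_unit (x : Y) : germ :=
  let s := cid2 (punit_dom x) in
  germ_of (psg_comp (s2valP s) (psg_inv (s2valP s))) (s2valP' s).

Definition germ_base (s : Y -> option Y) (U : set Y) : set germ :=
  [set g | exists x (Ss : S s) (sx : s x), U x /\ g = germ_of Ss sx].

Lemma near_openP (x : Y) (P : set Y) : (\forall z \near x, P z) <->
  exists V : set Y, [/\ open V, V x & V `<=` P].
Proof.
rewrite -[X in X <-> _]/(nbhs x P) nbhsE; split=> [[V [? ?] ?]|[V [? ? ?]]].
  by exists V.
by exists V.
Qed.

Lemma near_img s x y (P : set Y) : S s -> s x = Some y ->
  (\forall w \near y, P w) ->
  \forall z \near x, exists2 w, s z = Some w & P w.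
Proof.
move=> /psg_homeo[_ sC _] sxy /near_openP[V [Vo Vy VP]].
apply/near_openP; exists [set z | exists2 w, s z = Some w & V w].
split; [exact: sC|by exists y|].
by move=> z [w sz /VP Pw]; exists w.
Qed.

Lemma pinv_near s t x y : S s -> S t -> s x = Some y ->
  (\forall z \near x, s z = t z) -> \forall z \near y, pinv s z = pinv t z.
Proof.
move=> Ss St sxy st.
have [sI _ _] := psg_homeo Ss; have [tI _ _] := psg_homeo St.
have : pinv s y = Some x by apply/pinvP.
move=> /(near_img (psg_inv Ss))/(_ st); apply: filterS => z [w szw stw].
by rewrite szw; apply/esym/(pinvP tI); rewrite -stw; exact/(pinvP sI).
Qed.

Lemma pcomp_near s s' t t' x y : S s -> s x = Some y ->
  (\forall z \near x, s z = s' z) -> (\forall z \near y, t z = t' z) ->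
  \forall z \near x, pcomp t s z = pcomp t' s' z.
Proof.
move=> Ss sxy ss' /(near_img Ss sxy); apply: filterS2 ss' => z.
by rewrite /pcomp => <- [w -> /=].
Qed.

Lemma germ_inv_of s x y (Ss : S s) (sx : s x) (sy : pinv s y) :
  s x = Some y -> germ_inv (germ_of Ss sx) = germ_of (psg_inv Ss) sy.
Proof.
move=> sxy; have [/= px ps] := repr_germ_of Ss sx.
apply/germ_of_eq; case: (pregerm_some _) => y' /=; rewrite px => py'.
have yy' : y' = y.
  by have := nbhs_singleton ps; rewrite /= py' sxy => -[].
split=> //; apply: pinv_near py' ps => //; exact: pg_mapP.
Qed.

Lemma germ_mul_of t s x y (St : S t) (ty : t y) (Ss : S s) (sx : s x)
    (tsx : pcomp t s x) : s x = Some y ->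
  germ_mul (germ_of St ty) (germ_of Ss sx) = germ_of (psg_comp Ss St) tsx.
Proof.
move=> sxy; rewrite /germ_mul; case: pselect => [h|]; last first.
  by rewrite germ_src_of (germ_rng_of Ss sx sxy).
have [/= px ps] := repr_germ_of Ss sx; have [/= qy qt] := repr_germ_of St ty.
apply/germ_of_eq; split=> //; rewrite px.
apply: pcomp_near qt => //; first exact: pg_mapP.
by rewrite (nbhs_singleton ps).
Qed.

Lemma germ_unit_of q x (Sq : S q) (qx : q x) :
  germ_unit x = germ_of Sq qx <-> \forall z \near x, q z = Some z.
Proof.
rewrite /germ_unit; case: (cid2 _) => s Ss ssx /=.
have ss : \forall z \near x, pcomp (pinv s) s z = Some z.
  have sx : s x by move: ssx; rewrite /pcomp; case: (s x).
  apply: filterS (psg_near_dom Ss sx) => z; rewrite /pcomp.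
  by case E : (s z) => [w|//] _ /=; apply/pinvP => //; case: (psg_homeo Ss).
rewrite germ_of_eq; split=> [[_]|].
  by apply: filterS2 ss => z ->.
by move=> qz; split=> //; apply: filterS2 ss qz => z -> ->.
Qed.

Lemma germ_unitP x : exists q (Sq : S q) (qx : q x),
  germ_unit x = germ_of Sq qx.
Proof.
rewrite /germ_unit; case: (cid2 _) => s Ss ssx /=.
exists (pcomp (pinv s) s), (psg_comp Ss (psg_inv Ss)), ssx.
by apply/germ_of_eq; split=> //; near=> z.
Unshelve. all: by end_near.
Qed.

Definition germ_basis : set (set germ) := [set A | exists s (U : set Y),
  [/\ S s, open U, U `<=` [set x | s x] & A = germ_base s U]].

Lemma germ_base_of s U x (Ss : S s) (sx : s x) :
  germ_base s U (germ_of Ss sx) <-> U x.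
Proof.
split=> [[y [Ss' [sy [Uy /germ_of_eq[-> _]]]]]//|Ux].
by exists x, Ss, sx.
Qed.

Lemma germ_base_near s U t x (St : S t) (tx : t x) : open U ->
  germ_base s U (germ_of St tx) ->
  exists W : set Y, [/\ open W, W x, W `<=` U &
    forall z, W z -> t z /\ s z = t z].
Proof.
move=> Uo [y [Ss [sy [Uy /germ_of_eq[xy ts]]]]]; subst y.
have : \forall z \near x, (t z /\ s z = t z) /\ U z.
  apply: filterS3 ts (psg_near_dom St tx) (open_nbhs_nbhs (conj Uo Uy)).
  by move=> z tsz tz Uz.
move=> /near_openP[W [Wo Wx H]]; exists W; split=> // z /H[] //.
Qed.

Lemma germ_basis_cover : \bigcup_(A in germ_basis) id A = setT.
Proof.
apply/seteqP; split=> // g _; have [s [x [Ss [sx ->]]]] := germP g.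
exists (germ_base s [set x | s x]); last exact/germ_base_of.
by exists s, [set x | s x]; split=> //; exact: psg_open_dom.
Qed.

Lemma germ_basis_join A B g : germ_basis A -> germ_basis B -> id A g ->
  id B g -> exists C, [/\ germ_basis C, id C g & id C `<=` id A `&` id B].
Proof.
move=> [s [U [Ss Uo Us ->]]] [t [V [St Vo Vt ->]]].
have [r [x [Sr [rx ->]]]] := germP g => /= /(germ_base_near Uo)[W [Wo Wx WU Ws]].
move=> /(germ_base_near Vo)[W' [Wo' Wx' WV Wt]].
exists (germ_base r (W `&` W')); split.
- exists r, (W `&` W'); split=> //; first exact: openI.
  by move=> z [/Ws[]].
- exact/germ_base_of.
- move=> _ [z [Sr' [rz [[Wz Wz'] ->]]]]; split.
    have [_ sz] := Ws _ Wz; have sz' : s z by rewrite sz.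
    exists z, Ss, sz'; split; first exact: WU.
    apply/germ_of_eq; split=> //.
    by apply: filterS (open_nbhs_nbhs (conj Wo Wz)) => w /Ws[].
  have [_ sz] := Wt _ Wz'; have sz' : t z by rewrite sz.
  exists z, St, sz'; split; first exact: WV.
  apply/germ_of_eq; split=> //.
  by apply: filterS (open_nbhs_nbhs (conj Wo' Wz')) => w /Wt[].
Qed.

HB.instance Definition _ :=
  isBaseTopological.Build germ germ_basis_cover germ_basis_join.

Lemma germ_base_open s U : S s -> open U -> U `<=` [set z | s z] ->
  open (germ_base s U).
Proof.
move=> Ss Uo Us; exists [set germ_base s U]; last by rewrite bigcup_set1.
by move=> _ ->; exists s, U.
Qed.

Lemma nbhs_germ s x (Ss : S s) (sx : s x) (A : set germ) :
  nbhs (germ_of Ss sx) A <-> exists W : set Y,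
    [/\ open W, W x, W `<=` [set z | s z] & germ_base s W `<=` A].
Proof.
split=> [|[W [Wo Wx Ws WA]]]; last first.
  apply: filterS WA _; apply: open_nbhs_nbhs; split; last exact/germ_base_of.
  exact: germ_base_open.
rewrite nbhsE => -[B [[D DB <-] [C DC Cx]] BA].
have [t [U [St Uo Ut CE]]] := DB _ DC; move: Cx; rewrite CE.
move=> /(germ_base_near Uo)[W [Wo Wx WU Wst]].
exists W; split=> // [z /Wst[]//|_ [z [Ss' [sz [Wz ->]]]]].
apply: BA; exists C => //; rewrite CE.
have [_ tz] := Wst _ Wz; have tz' : t z by rewrite tz.
exists z, St, tz'; split; first exact: WU.
apply/germ_of_eq; split=> //.
by apply: filterS (open_nbhs_nbhs (conj Wo Wz)) => w /Wst[].
Qed.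

Lemma germ_src_continuous : continuous germ_src.
Proof.
move=> g; have [s [x [Ss [sx ->]]]] := germP g.
rewrite /continuous_at germ_src_of.
move=> A /near_openP[V [Vo Vx VA]]; apply/nbhs_germ.
exists (V `&` [set z | s z]); split=> //.
- by apply: openI => //; exact: psg_open_dom.
- by move=> _ [z [Ss' [sz [[Vz _] ->]]]] /=; rewrite germ_src_of; exact: VA.
Qed.

Lemma germ_rngP g : exists s x y (Ss : S s) (sx : s x) (sy : pinv s y),
  [/\ g = germ_of Ss sx, s x = Some y, germ_src g = x, germ_rng g = y &
      germ_inv g = germ_of (psg_inv Ss) sy].
Proof.
have [s [x [Ss [sx ->]]]] := germP g.
have [y sxy] : exists y, s x = Some y by case: (s x) sx => // y _; exists y.
have sy := pinv_dom Ss sxy; exists s, x, y, Ss, sx, sy; split=> //.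
- exact: germ_src_of.
- exact: germ_rng_of.
- exact: germ_inv_of.
Qed.

Lemma germ_inv_continuous : continuous germ_inv.
Proof.
move=> g; have [s [x [y [Ss [sx [sy [-> sxy _ _ gi]]]]]]] := germ_rngP g.
rewrite /continuous_at (germ_inv_of Ss sx sy sxy) => A /nbhs_germ[W [Wo Wy Ws WA]].
apply/nbhs_germ; exists [set z | exists2 w, s z = Some w & W w]; split.
- by have [_ sC _] := psg_homeo Ss; exact: sC.
- by exists y.
- by move=> z [w /= ->].
- move=> _ [z [Ss' [sz [[w szw Ww] ->]]]] /=; apply: WA.
  rewrite (germ_inv_of Ss' sz (pinv_dom Ss' szw)) //.
  by exists w, (psg_inv Ss'), (pinv_dom Ss' szw).
Qed.

Lemma germ_unit_continuous : continuous germ_unit.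
Proof.
move=> x; have [q [Sq [qx ux]]] := germ_unitP x; rewrite /continuous_at ux.
have /germ_unit_of/near_openP[V [Vo Vx Vq]] := ux.
move=> A /nbhs_germ[W [Wo Wx Wq WA]]; apply/near_openP; exists (V `&` W).
split=> // [|z [Vz Wz]]; first exact: openI.
apply: WA; exists z, Sq, (Wq _ Wz); split=> //; apply/germ_unit_of.
by apply: filterS (open_nbhs_nbhs (conj Vo Vz)).
Qed.

Lemma germ_mul_continuous :
  {within [set p : germ * germ | germ_src p.1 = germ_rng p.2],
    continuous (fun p => germ_mul p.1 p.2)}.
Proof.
apply/subspace_continuousP => -[g h] /= gh.
have [t [y' [_ [St [ty [_ [gE _ gy _ _]]]]]]] := germ_rngP g.
have [s [x [y [Ss [sx [_ [hE sxy _ hy _]]]]]]] := germ_rngP h.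
have yy' : y' = y by rewrite -gy gh.
clear gh gy hy; subst y'; rewrite /from_subspace gE hE /=
  (germ_mul_of St ty Ss sx (pcomp_dom sxy ty) sxy).
move=> A /nbhs_germ[W [Wo Wx Wts WA]]; rewrite nbhs_simpl /=.
have : nbhs (germ_of St ty, germ_of Ss sx)
         (germ_base t [set z | t z] `*` germ_base s W).
  exists (germ_base t [set z | t z], germ_base s W) => //=; split.
    apply/nbhs_germ; exists [set z | t z]; split=> //; exact: psg_open_dom.
  apply/nbhs_germ; exists W; split=> // z /Wts /=.
  by rewrite /pcomp; case: (s z).
apply: filterS => -[_ _] [/= [w [St' [tw [_ ->]]]] [z [Ss' [sz [Wz ->]]]]].
move=> /=; rewrite germ_src_of.
have [v szv] : exists v, s z = Some v by case: (s z) sz => // v _; exists v.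
rewrite (germ_rng_of Ss' sz szv) => wv; subst w; apply: WA.
rewrite (germ_mul_of St' tw Ss' sz (pcomp_dom szv tw)) //.
by exists z, (psg_comp Ss' St'), (pcomp_dom szv tw).
Qed.

Lemma germ_src_etale g : exists U : set germ,
  [/\ open U, U g, open (germ_src @` U) & homeo_onto_image U germ_src].
Proof.
have [s [x [Ss [sx ->]]]] := germP g; have so := psg_open_dom Ss.
pose D := [set z | s z].
have UE : germ_src @` germ_base s D = D.
  apply/seteqP; split=> [_ [_ [z [Ss' [sz [Dz ->]]] <-]]|z sz].
    by rewrite germ_src_of.
  by exists (germ_of Ss sz); [exact/germ_base_of|rewrite germ_src_of].
exists (germ_base s D); rewrite UE; split=> //.
- by apply: germ_base_open => //; exact: psg_open_dom.
- exact/germ_base_of.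
split.
  by apply: continuous_subspaceT => z; exact: germ_src_continuous.
exists (fun z => if pselect (s z) is left sz then germ_of Ss sz
                 else germ_of Ss sx); rewrite ?UE.
  apply/subspace_continuousP => z sz A; rewrite /from_subspace.
  case: pselect => // sz' /nbhs_germ[W [Wo Wz Ws WA]]; rewrite nbhs_simpl /=.
  apply: filterS (open_nbhs_nbhs (conj Wo Wz)) => w Ww _ /=.
  case: pselect => [sw|[]]; last exact: Ws.
  by apply: WA; apply/germ_base_of.
move=> _ [z [Ss' [sz [Dz ->]]]]; rewrite germ_src_of.
by case: pselect => // sz'; apply/germ_of_eq; split=> //; near=> w.
Unshelve. all: by end_near. Qed.

Hypothesis Y_hausdorff : hausdorff_space Y.
Hypothesis Y_locally_compact : locally_compact [set: Y].

Let src_unit x : germ_src (germ_unit x) = x.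
Proof. by have [q [Sq [qx ->]]] := germ_unitP x; rewrite germ_src_of. Qed.

Let rng_unit x : germ_rng (germ_unit x) = x.
Proof.
have [q [Sq [qx ux]]] := germ_unitP x; rewrite ux; apply: germ_rng_of.
by move/germ_unit_of: ux => /nbhs_singleton.
Qed.

Let src_inv g : germ_src (germ_inv g) = germ_rng g.
Proof.
by have [s [x [y [Ss [sx [sy [_ _ _ -> ->]]]]]]] := germ_rngP g;
  rewrite germ_src_of.
Qed.

Let rng_inv g : germ_rng (germ_inv g) = germ_src g.
Proof.
have [s [x [y [Ss [sx [sy [_ sxy -> _ ->]]]]]]] := germ_rngP g.
by apply: germ_rng_of; apply/pinvP => //; case: (psg_homeo Ss).
Qed.

Lemma germ_mulP g h : germ_src g = germ_rng h ->
  exists s t x y z (Ss : S s) (St : S t) (sx : s x) (ty : t y)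
    (tsx : pcomp t s x),
  [/\ s x = Some y, t y = Some z, h = germ_of Ss sx, g = germ_of St ty &
      germ_mul g h = germ_of (psg_comp Ss St) tsx].
Proof.
move=> gh.
have [t [y' [z [St [ty [_ [gE tyz gy _ _]]]]]]] := germ_rngP g.
have [s [x [y [Ss [sx [_ [hE sxy _ hy _]]]]]]] := germ_rngP h.
have yy' : y' = y by rewrite -gy gh.
clear gh gy hy; subst y' g h; exists s, t, x, y, z, Ss, St, sx, ty, (pcomp_dom sxy ty).
by split=> //; exact: germ_mul_of.
Qed.

Let src_mul g h : germ_src g = germ_rng h -> germ_src (germ_mul g h) = germ_src h.
Proof.
by move=> /germ_mulP[s [t [x [y [z [Ss [St [sx [ty [tsx [_ _ -> _ ->]]]]]]]]]]];
  rewrite !germ_src_of.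
Qed.

Let rng_mul g h : germ_src g = germ_rng h -> germ_rng (germ_mul g h) = germ_rng g.
Proof.
move=> /germ_mulP[s [t [x [y [z [Ss [St [sx [ty [tsx]]]]]]]]]].
move=> [sxy tyz _ -> ->]; rewrite (germ_rng_of St ty tyz).
by apply: germ_rng_of; rewrite /pcomp sxy.
Qed.

Let mulA g h k : germ_src g = germ_rng h -> germ_src h = germ_rng k ->
  germ_mul g (germ_mul h k) = germ_mul (germ_mul g h) k.
Proof.
move=> gh hk.
have [t [y' [z [St [ty [_ [gE tyz gy _ _]]]]]]] := germ_rngP g.
move: gh => /[dup] gh; rewrite gy => hy'.
have [s [r [x [y [y'' [Ss [Sr [sx [ry [rsx]]]]]]]]]] := germ_mulP hk.
move=> [sxy ryy'' kE hE hkE].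
have yy : y'' = y' by rewrite hy' hE (germ_rng_of Sr ry ryy'').
clear gh gy hy' hk; subst y'' g h k; rewrite hkE.
have rsxy : pcomp r s x = Some y' by rewrite /pcomp sxy.
rewrite (germ_mul_of St ty (psg_comp Ss Sr) rsx (pcomp_dom rsxy ty)) //.
have tryd := pcomp_dom ryy'' ty.
rewrite (germ_mul_of St ty Sr ry tryd) //.
rewrite (germ_mul_of (psg_comp Sr St) tryd Ss sx (pcomp_dom sxy tryd)) //.
apply/germ_of_eq; split=> //; apply: nearW => w.
by rewrite /pcomp; case: (s w).
Qed.

Let mul1g g : germ_mul (germ_unit (germ_rng g)) g = g.
Proof.
have [s [x [y [Ss [sx [sy [gE sxy _ -> _]]]]]]] := germ_rngP g.
have [q [Sq [qy uy]]] := germ_unitP y; have /germ_unit_of qid := uy.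
rewrite uy {1}gE (germ_mul_of Sq qy Ss sx (pcomp_dom sxy qy)) // gE.
apply/germ_of_eq; split=> //.
by apply: filterS (near_img Ss sxy qid) => z [w szw qw]; rewrite /pcomp szw.
Qed.

Let mulg1 g : germ_mul g (germ_unit (germ_src g)) = g.
Proof.
have [s [x [y [Ss [sx [sy [gE sxy -> _ _]]]]]]] := germ_rngP g.
have [q [Sq [qx ux]]] := germ_unitP x; have /germ_unit_of qid := ux.
have qxx : q x = Some x := nbhs_singleton qid.
rewrite ux {1}gE (germ_mul_of Ss sx Sq qx (pcomp_dom qxx sx)) // gE.
apply/germ_of_eq; split=> //.
by apply: filterS qid => z qz; rewrite /pcomp qz.
Qed.

Let mulVg g : germ_mul (germ_inv g) g = germ_unit (germ_src g).
Proof.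
have [s [x [y [Ss [sx [sy [gE sxy -> _ ->]]]]]]] := germ_rngP g.
rewrite gE (germ_mul_of (psg_inv Ss) sy Ss sx (pcomp_dom sxy sy)) //.
apply/esym/germ_unit_of; apply: filterS (psg_near_dom Ss sx) => z.
rewrite /pcomp; case E : (s z) => [w|//] _ /=.
by apply/pinvP => //; case: (psg_homeo Ss).
Qed.

Let mulgV g : germ_mul g (germ_inv g) = germ_unit (germ_rng g).
Proof.
have [s [x [y [Ss [sx [sy [gE sxy _ -> ->]]]]]]] := germ_rngP g.
have [sI _ _] := psg_homeo Ss.
have syx : pinv s y = Some x by apply/pinvP.
rewrite gE (germ_mul_of Ss sx (psg_inv Ss) sy (pcomp_dom syx sx)) //.
apply/esym/germ_unit_of; apply: filterS (psg_near_dom (psg_inv Ss) sy) => z.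
rewrite /pcomp; case E : (pinv s z) => [w|//] _ /=.
exact/(pinvP sI).
Qed.

Definition germ_groupoid : etale_groupoid := EtaleGroupoid
  src_unit rng_unit src_inv rng_inv src_mul rng_mul mulA mul1g mulg1 mulVg mulgV
  Y_hausdorff Y_locally_compact germ_unit_continuous germ_inv_continuous
  germ_mul_continuous germ_src_etale.

End germs.

Record alphabet := Alphabet {
  letter :> finType;
  alphabet_gt1 : (1 < #|letter|)%N
}.

Section words.
Variable X : alphabet.

Definition tree_edge (u v : seq X) :=
  (exists x, v = rcons u x) \/ (exists x, u = rcons v x).

(* Automorphisms of the rooted tree of finite words. *)
Definition tree_aut (phi : seq X -> seq X) :=
  [/\ bijective phi, phi [::] = [::] &
      forall u v, tree_edge (phi u) (phi v) <-> tree_edge u v].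

(* The restriction written [phi|_w] on paper, see [section_cat] below. *)
Definition section (phi : seq X -> seq X) (w v : seq X) : seq X :=
  drop (size w) (phi (w ++ v)).

Definition finite_state_aut (phi : seq X -> seq X) :=
  finite_set (range (section phi)).

Lemma tree_aut_rcons phi w x : tree_aut phi ->
  exists y, phi (rcons w x) = rcons (phi w) y.
Proof.
move=> [phib phi0 phie]; elim/last_ind: w x => [|w x' IH] x.
  have [_ /(_ (or_introl (ex_intro _ x erefl)))] := phie [::] (rcons [::] x).
  by rewrite phi0 => -[//|[y /(congr1 size)]]; rewrite size_rcons.
have [_ /(_ (or_introl (ex_intro _ x erefl)))] :=
  phie (rcons w x') (rcons (rcons w x') x).
case=> // -[y]; have [y' ->] := IH x' => /rcons_inj[/(bij_inj phib)].
by move=> /(congr1 size); rewrite !size_rcons => /eqP; rewrite ltn_eqF // ltnW.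
Qed.

Lemma size_tree_aut phi w : tree_aut phi -> size (phi w) = size w.
Proof.
move=> phiA; elim/last_ind: w => [|w x IH]; first by case: phiA => _ ->.
by have [y ->] := tree_aut_rcons w x phiA; rewrite !size_rcons IH.
Qed.

Lemma section_cat phi w v : tree_aut phi ->
  phi (w ++ v) = phi w ++ section phi w v.
Proof.
move=> phiA; rewrite -{1}[phi (w ++ v)](cat_take_drop (size w)).
congr (_ ++ _); elim/last_ind: v => [|v x IH].
  by rewrite cats0 -(size_tree_aut w phiA) take_size.
rewrite -rcons_cat; have [y ->] := tree_aut_rcons (w ++ v) x phiA.
rewrite -cats1 takel_cat // size_tree_aut // size_cat; exact: leq_addr.
Qed.

End words.

Record self_similar_group (X : alphabet) := SelfSimilarGroup {
  ssg :> groupType;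
  ssg_act : ssg -> seq X -> seq X;
  ssg_aut : forall g, tree_aut (ssg_act g);
  ssg_act1 : forall w, ssg_act 1%g w = w;
  ssg_actM : forall g h w, ssg_act (g * h)%g w = ssg_act g (ssg_act h w);
  ssg_faithful : forall g, (forall w, ssg_act g w = w) -> g = 1%g;
  ssg_section : forall g v, exists h, ssg_act h = section (ssg_act g) v
}.

Definition finite_state (X : alphabet) (Gam : self_similar_group X) :=
  forall g : Gam, finite_state_aut (ssg_act g).

Definition iword (X : alphabet) : Type :=
  prod_topology (fun _ : nat => discrete_topology X).

HB.instance Definition _ (X : alphabet) := Choice.on (iword X).
HB.instance Definition _ (X : alphabet) := Nbhs.on (iword X).
HB.instance Definition _ (X : alphabet) := Topological.on (iword X).

HB.instance Definition _ (X : alphabet) := isPointed.Build (iword X)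
  (fun=> enum_val (Ordinal (ltnW (alphabet_gt1 X)))).

Section boundary.
Variable X : alphabet.
Implicit Types (x y z : iword X) (u v w : seq X) (phi : seq X -> seq X).

Definition prefix_of x n : seq X := mkseq x n.

Definition icat w x : iword X :=
  fun n => if (n < size w)%N then nth (x 0%N) w n else x (n - size w)%N.

Definition idrop n x : iword X := fun k => x (n + k)%N.

(* The homeomorphism of [X^N] induced by an automorphism of the tree, see
   [prefix_of_iaut] below. *)
Definition iaut phi x : iword X :=
  fun n => nth (x n) (phi (prefix_of x n.+1)) n.

Definition cylinder w : set (iword X) := range (icat w).

Lemma size_prefix_of x n : size (prefix_of x n) = n.
Proof. exact: size_mkseq. Qed.

Lemma prefix_of_add x m n :
  prefix_of x (m + n) = prefix_of x m ++ prefix_of (idrop m x) n.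
Proof.
rewrite /prefix_of /mkseq iotaD map_cat; congr (_ ++ _).
by rewrite -[in LHS]addnC iotaDl -map_comp.
Qed.

Lemma prefix_of_iaut phi x n : tree_aut phi ->
  prefix_of (iaut phi x) n = phi (prefix_of x n).
Proof.
move=> phiA; apply: (@eq_from_nth _ (x 0%N)).
  by rewrite size_prefix_of size_tree_aut // size_prefix_of.
move=> i; rewrite size_prefix_of => ilt; rewrite nth_mkseq // /iaut.
rewrite -(subnKC ilt) prefix_of_add section_cat // nth_cat.
have -> : (i < size (phi (prefix_of x i.+1)))%N.
  by rewrite size_tree_aut // size_prefix_of.
by apply: set_nth_default; rewrite size_tree_aut // size_prefix_of.
Qed.

Lemma iword_eq m x y : (forall n, prefix_of x (m + n) = prefix_of y (m + n)) ->
  x = y.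
Proof.
move=> xy; apply/funext => n.
have /(congr1 (fun s => nth (x 0%N) s n)) := xy n.+1.
by rewrite !nth_mkseq // ltn_addl.
Qed.

Lemma prefix_of_icat w x n : prefix_of (icat w x) (size w + n) = w ++ prefix_of x n.
Proof.
apply: (@eq_from_nth _ (x 0%N)) => [|i].
  by rewrite size_cat !size_prefix_of.
rewrite size_prefix_of => ilt; rewrite nth_mkseq // /icat nth_cat.
by case: ltnP => // wi; rewrite nth_mkseq // ltn_subLR.
Qed.

Lemma prefix_of_icat0 w x : prefix_of (icat w x) (size w) = w.
Proof. by rewrite -[X in prefix_of _ X]addn0 prefix_of_icat cats0. Qed.

Lemma icat_drop x n : icat (prefix_of x n) (idrop n x) = x.
Proof.
apply: (@iword_eq n) => k.
have := prefix_of_icat (prefix_of x n) (idrop n x) k.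
by rewrite size_prefix_of => ->; rewrite prefix_of_add.
Qed.

Lemma idrop_icat w x : idrop (size w) (icat w x) = x.
Proof.
by apply/funext => k; rewrite /idrop /icat ltnNge leq_addr /= addKn.
Qed.

Lemma icat_cat u v x : icat (u ++ v) x = icat u (icat v x).
Proof.
apply: (@iword_eq (size u + size v)) => n.
by rewrite -{1}size_cat prefix_of_icat -addnA !prefix_of_icat catA.
Qed.

Lemma iaut_icat phi w x : tree_aut phi -> tree_aut (section phi w) ->
  iaut phi (icat w x) = icat (phi w) (iaut (section phi w) x).
Proof.
move=> phiA secA; apply: (@iword_eq (size w)) => n.
rewrite prefix_of_iaut // prefix_of_icat section_cat //.
by rewrite -(prefix_of_iaut x n secA) -prefix_of_icat size_tree_aut.
Qed.

Lemma cylinderE w x : cylinder w x <-> prefix_of x (size w) = w.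
Proof.
split=> [[y _ <-]|xw]; first exact: prefix_of_icat0.
by exists (idrop (size w) x) => //; rewrite -{1}xw icat_drop.
Qed.

Lemma prefix_of_rcons x n : prefix_of x n.+1 = rcons (prefix_of x n) (x n).
Proof. by rewrite -addn1 prefix_of_add cats1 /prefix_of /mkseq /= /idrop addn0. Qed.

Lemma cylinder_open w : open (cylinder w).
Proof.
elim/last_ind: w => [|w a IH].
  rewrite (_ : cylinder _ = setT); first exact: openT.
  by apply/seteqP; split=> // x _; apply/cylinderE.
rewrite (_ : cylinder _ = cylinder w `&`
    (fun x : iword X => x (size w)) @^-1` [set a]).
  apply: openI => //; apply: open_comp; last exact: discrete_open.
  by move=> x _; exact: (@proj_continuous _ (fun=> discrete_topology X)).
apply/seteqP; split=> x.
  rewrite cylinderE size_rcons prefix_of_rcons => /rcons_inj[xw xa].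
  by split=> //; apply/cylinderE.
move=> [/cylinderE xw /= xa]; apply/cylinderE.
by rewrite size_rcons prefix_of_rcons xw xa.
Qed.

Lemma nbhs_iword x (A : set (iword X)) : nbhs x A ->
  exists n, cylinder (prefix_of x n) `<=` A.
Proof.
pose F := filter_from setT (fun n => cylinder (prefix_of x n)).
have FF : Filter F.
  apply: filter_from_filter; first by exists 0%N.
  move=> m n _ _; exists (m + n)%N => // y /cylinderE.
  rewrite size_prefix_of => yx; split; apply/cylinderE; rewrite size_prefix_of.
    move/(congr1 (take m)): yx; rewrite !prefix_of_add.
    by rewrite !take_size_cat ?size_prefix_of.
  move: yx; rewrite addnC => /(congr1 (take n)); rewrite !prefix_of_add.
  by rewrite !take_size_cat ?size_prefix_of.
suff Fx : F --> (x : iword X) by move=> /Fx[n _]; exists n.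
apply/cvg_sup => i B [_ [[V Vo <-] Vx VB]].
exists i.+1 => // y /cylinderE; rewrite size_prefix_of !prefix_of_rcons.
by move=> /rcons_inj[_ yx]; apply: VB; rewrite /= yx.
Qed.

Lemma iword_hausdorff : hausdorff_space (iword X).
Proof.
apply: (@hausdorff_product _ (fun=> discrete_topology X)) => n.
exact: discrete_hausdorff.
Qed.

Lemma iword_compact : compact [set: iword X].
Proof.
have fX : finite_set [set: discrete_topology X] by exact: (@finite_finset X).
have := @tychonoff _ (fun _ : nat => discrete_topology X) _
  (fun=> finite_compact fX).
set A := (X in compact X -> _).
suff -> : A = [set: iword X] by [].
by rewrite eqEsubset.
Qed.

Lemma iword_locally_compact : locally_compact [set: iword X].
Proof.
move=> x _; exists setT; first exact: filterT.
by split; [exact: iword_compact|exact: closedT].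
Qed.

End boundary.

Section germ_action.
Variables (X : alphabet) (Gam : self_similar_group X).
Implicit Types (g h : Gam) (u v w : seq X) (x y z : iword X).

(* The partial homeomorphism [v X^N -> u X^N], [v x |-> u g(x)]. *)
Definition ssg_map g u v : iword X -> option (iword X) := fun z =>
  if prefix_of z (size v) == v
  then Some (icat u (iaut (ssg_act g) (idrop (size v) z)))
  else None.

Definition ssg_pseudogroup_set (s : iword X -> option (iword X)) : Prop :=
  s = (fun=> None) \/ exists g u v, size u = size v /\ s = ssg_map g u v.

Lemma ssg_map_icat g u v x :
  ssg_map g u v (icat v x) = Some (icat u (iaut (ssg_act g) x)).
Proof. by rewrite /ssg_map prefix_of_icat0 eqxx idrop_icat. Qed.

Lemma ssg_mapP g u v z y : ssg_map g u v z = Some y <->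
  exists x, z = icat v x /\ y = icat u (iaut (ssg_act g) x).
Proof.
split=> [|[x [-> ->]]]; last exact: ssg_map_icat.
rewrite /ssg_map; case: eqP => // zv [<-].
by exists (idrop (size v) z); split=> //; rewrite -{1}zv icat_drop.
Qed.

Lemma ssg_map_None g u v z : ~ cylinder v z -> ssg_map g u v z = None.
Proof. by move=> vz; rewrite /ssg_map; case: eqP => // /cylinderE. Qed.

Lemma iautM g h x : iaut (ssg_act (g * h)%g) x =
  iaut (ssg_act g) (iaut (ssg_act h) x).
Proof.
apply: (@iword_eq _ 0) => n.
by rewrite !prefix_of_iaut ?ssg_actM //; exact: ssg_aut.
Qed.

Lemma iaut1 x : iaut (ssg_act (1%g : Gam)) x = x.
Proof.
apply: (@iword_eq _ 0) => n.
by rewrite prefix_of_iaut ?ssg_act1 //; exact: ssg_aut.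
Qed.

Lemma ssg_actV g w : ssg_act g (ssg_act g^-1%g w) = w.
Proof. by rewrite -ssg_actM mulgV ssg_act1. Qed.

Lemma iaut_section g w h x : ssg_act h = section (ssg_act g) w ->
  iaut (ssg_act g) (icat w x) = icat (ssg_act g w) (iaut (ssg_act h) x).
Proof.
move=> hw; rewrite iaut_icat ?hw //; first exact: ssg_aut.
by rewrite -hw; exact: ssg_aut.
Qed.

Lemma ssg_map_inv g u v : pinv (ssg_map g u v) = ssg_map g^-1%g v u.
Proof.
apply: pinv_eq => z y; rewrite !ssg_mapP; split=> -[x [-> ->]].
  by exists (iaut (ssg_act g) x); rewrite -iautM mulVg iaut1.
by exists (iaut (ssg_act g^-1%g) x); rewrite -iautM mulgV iaut1.
Qed.

Lemma ssg_map_comp g u v h u' v' : size u = size v -> size u' = size v' ->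
  ssg_pseudogroup_set (pcomp (ssg_map g u v) (ssg_map h u' v')).
Proof.
move=> uv uv'; case: (leqP (size v) (size u')) => le.
  pose a := take (size v) u'; pose w := drop (size v) u'.
  have u'E : u' = a ++ w by rewrite cat_take_drop.
  have sa : size a = size v by rewrite size_takel.
  case: (eqVneq a v) => [av|nav]; last first.
    left; apply/funext => z; rewrite /pcomp.
    case E : (ssg_map h u' v' z) => [y|//] /=; apply: ssg_map_None.
    move/ssg_mapP: E => [x [_ ->]] /cylinderE.
    by rewrite u'E icat_cat -sa prefix_of_icat0 => /eqP; rewrite (negPf nav).
  have [k kE] := ssg_section g w.
  right; exists (k * h)%g, (u ++ ssg_act g w), v'; split.
    rewrite size_cat (size_tree_aut _ (ssg_aut g)) uv -sa -size_cat -u'E //.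
  apply/funext => z; rewrite /pcomp; case: (pselect (cylinder v' z)) => [[x _ <-]|].
    rewrite !ssg_map_icat /= u'E av icat_cat ssg_map_icat.
    by rewrite (iaut_section _ kE) -icat_cat iautM.
  by move=> nz; rewrite !ssg_map_None.
pose a := take (size u') v; pose w := drop (size u') v.
have vE : v = a ++ w by rewrite cat_take_drop.
have sa : size a = size u' by rewrite size_takel // ltnW.
case: (eqVneq a u') => [au|nau]; last first.
  left; apply/funext => z; rewrite /pcomp.
  case E : (ssg_map h u' v' z) => [y|//] /=; apply: ssg_map_None.
  move/ssg_mapP: E => [x [_ ->]] [t _].
  rewrite vE icat_cat => /(congr1 (fun s => prefix_of s (size u'))).
  by rewrite prefix_of_icat0 -sa prefix_of_icat0 => /eqP; rewrite (negPf nau).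
pose w' := ssg_act h^-1%g w.
have hw' : ssg_act h w' = w by rewrite ssg_actV.
have sw' : size w' = size w by rewrite (size_tree_aut _ (ssg_aut _)).
have [k kE] := ssg_section h w'.
right; exists (g * k)%g, u, (v' ++ w'); split.
  by rewrite uv vE !size_cat sw' sa uv'.
apply/funext => z; rewrite /pcomp.
case: (pselect (cylinder v' z)) => [[x _ <-]|nz]; last first.
  rewrite !ssg_map_None //; apply: contra_not nz => -[t _ <-].
  by rewrite icat_cat; exists (icat w' t).
rewrite ssg_map_icat /=.
case: (pselect (cylinder w' x)) => [[x' _ <-]|nx].
  rewrite (iaut_section _ kE) hw' -!icat_cat -{1}au -vE !ssg_map_icat.
  by rewrite iautM.
rewrite !ssg_map_None // => -[t _].
  rewrite icat_cat => /(congr1 (idrop (size v'))); rewrite !idrop_icat => tx.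
  by apply: nx; exists t.
rewrite vE au icat_cat => /(congr1 (idrop (size u'))); rewrite !idrop_icat => tx.
apply: nx; apply/cylinderE; have := prefix_of_icat0 w t; rewrite tx => hx.
rewrite prefix_of_iaut in hx; last exact: ssg_aut.
by rewrite sw' /w' -{2}hx -ssg_actM mulVg ssg_act1.
Qed.

Lemma ssg_map_continuous g u v : pcontinuous (ssg_map g u v).
Proof.
move=> V Vo; rewrite openE => z [y zy Vy]; rewrite /interior.
have [n yV] : exists n, cylinder (prefix_of y n) `<=` V.
  by apply: nbhs_iword; exact: open_nbhs_nbhs.
have [x [zE yE]] := (ssg_mapP g u v z y).1 zy.
have : nbhs z (cylinder (v ++ prefix_of x n)).
  apply: open_nbhs_nbhs; split; first exact: cylinder_open.
  by exists (idrop n x) => //; rewrite icat_cat icat_drop.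
apply: filterS => _ [t _ <-]; rewrite icat_cat.
exists (icat u (iaut (ssg_act g) (icat (prefix_of x n) t))).
  by rewrite ssg_map_icat.
apply: yV; apply/cylinderE; rewrite size_prefix_of yE.
have key r : prefix_of (icat u (iaut (ssg_act g) r)) (n + size u) =
    u ++ ssg_act g (prefix_of r n).
  by rewrite addnC prefix_of_icat prefix_of_iaut //; exact: ssg_aut.
have := key (icat (prefix_of x n) t).
rewrite -[X in prefix_of (icat (prefix_of x n) t) X](size_prefix_of x n).
rewrite prefix_of_icat0 -key !prefix_of_add => /(congr1 (take n)).
by rewrite !take_size_cat ?size_prefix_of.
Qed.

Lemma ssg_map_homeo g u v : partial_homeo (ssg_map g u v).
Proof.
split; last 2 first.
- exact: ssg_map_continuous.
- by rewrite ssg_map_inv; exact: ssg_map_continuous.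
move=> z z' y /ssg_mapP[x [-> ->]] /ssg_mapP[x' [->]].
move=> /(congr1 (idrop (size u))); rewrite !idrop_icat.
move=> /(congr1 (iaut (ssg_act g^-1%g))).
by rewrite -!iautM mulVg !iaut1 => ->.
Qed.

Lemma pinv_empty : pinv (fun=> None : option (iword X)) = (fun=> None).
Proof. exact: pinv_eq. Qed.

Lemma ssg_homeo s : ssg_pseudogroup_set s -> partial_homeo s.
Proof.
case=> [->|[g [u [v [_ ->]]]]]; last exact: ssg_map_homeo.
split=> //; rewrite ?pinv_empty => V _; rewrite (_ : [set x | _] = set0);
  by [exact: open0|apply/seteqP; split=> x //= -[]].
Qed.

Lemma ssg_comp s t : ssg_pseudogroup_set s -> ssg_pseudogroup_set t ->
  ssg_pseudogroup_set (pcomp t s).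
Proof.
case=> [->|[h [u' [v' [uv' ->]]]]]; first by left.
case=> [->|[g [u [v [uv ->]]]]]; last exact: ssg_map_comp.
by left; apply/funext => z; rewrite /pcomp; case: (ssg_map _ _ _ _).
Qed.

Lemma ssg_inv s : ssg_pseudogroup_set s -> ssg_pseudogroup_set (pinv s).
Proof.
case=> [->|[g [u [v [uv ->]]]]]; first by rewrite pinv_empty; left.
by right; exists g^-1%g, v, u; rewrite ssg_map_inv.
Qed.

Lemma ssg_cover x : exists2 s, ssg_pseudogroup_set s & s x.
Proof.
exists (ssg_map 1%g [::] [::]); last by rewrite /ssg_map.
by right; exists 1%g, [::], [::].
Qed.

Definition ssg_pseudogroup : pseudogroup (iword X) :=
  Pseudogroup ssg_homeo ssg_comp ssg_inv ssg_cover.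

(* The groupoid [K(Gam, X)]. *)
Definition ssg_groupoid : etale_groupoid :=
  germ_groupoid ssg_pseudogroup (@iword_hausdorff X) (@iword_locally_compact X).

End germ_action.

Definition bernoulli (R : realType) (X : alphabet)
    (mu : probability (borel (iword X)) R) :=
  forall w : seq X, mu (cylinder w) = ((#|X|%:R ^- size w)%:E)%E.

(* Main.v *)
Require Import Defs.
From HB Require Import structures.
From mathcomp Require Import all_boot all_order all_algebra complex.
From mathcomp Require Import all_classical all_reals all_analysis.
From mathcomp Require Import ring lra.

(* If [g] is finite-state, there is a length [N] such that every word [w] with
   [g w = w] and [g|_w <> 1] has an extension of length [N] moved by [g]. Hence
   the proportion of such "bad" words of length [n] decays geometrically, which
   gives essential freeness.
   On [C^*(K)] the indicators of the germs of the maps [g_{u,v}] span a dense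
   subspace. A tracial state vanishes on them when [u <> v], depends only on [g]
   and on the length of [u] when [u = v], and is [|X|^{-n}] for [g = 1] and
   [|u| = n]; cutting [g_{u,u}] into pieces of level [n] determines the trace up
   to the proportion of bad words, so it is unique. For existence, average over
   the words [w] of length [n] the vector states at the points [w x0] in the
   representation on functions on [X^N]. Up to the proportion of bad words, the
   value at [s] is the proportion of the words [w] whose cylinder is fixed by [s],
   and this is a trace on the span. *)

Set Implicit Arguments.
Unset Strict Implicit.
Unset Printing Implicit Defensive.

Import Order.TTheory GRing.Theory Num.Theory.
Import numFieldNormedType.Exports.

Local Open Scope classical_set_scope.
Local Open Scope ring_scope.

Local Notation conv := Defs.conv.

Local Notation pinv := Defs.pinv.
(** * Bad words *)

(** The algebra is given only as a completion for the supremum of all C*-seminorms, so its norm is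
    never computed. Upper bounds come from the C*-identity alone: the images of the maps g_{u,v} are
    partial isometries, and multiplication by a continuous [c] is bounded by the bounds of |c|. The
    lower bound comes from one explicit seminorm, the operator norm on finitely supported functions
    on X^N; it makes the vector states bounded. As K need not be Hausdorff, elements of C_c need not
    be continuous. They are still finite sums of functions carried by the germs of single maps
    g_{u,v}, because inside a Hausdorff open set these sets of germs are clopen. For existence two
    counts are compared. Counting words [w] such that the point [w x0] is fixed gives positivity and
    boundedness, but no symmetry. Counting words whose whole cylinder is fixed gives a nondecreasing
    proportion, and the same number for [s t] and [t s] at every large level. Being finite-state is
    what makes the two limits agree. *)

Lemma card_prefix (T : finType) m n (P : pred (m.-tuple T)) :
  #|[set p : m.-tuple T * n.-tuple T | P p.1]%SET| = (#|P| * #|T| ^ n)%N.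
Proof.
rewrite -sum1_card (eq_bigl (fun p : m.-tuple T * n.-tuple T => P p.1 && true)).
  rewrite -(pair_big_dep P (fun _ _ => true) (fun _ _ => 1%N)) /=.
  rewrite (eq_bigr (fun=> #|T| ^ n)%N) => [|w _]; first by rewrite sum_nat_const.
  by rewrite sum_nat_const muln1 -card_tuple.
by move=> p; rewrite inE andbT.
Qed.

Section bad_words.
Variable X : alphabet.
Implicit Types (phi : seq X -> seq X) (u v w : seq X).

(** For a tree automorphism [phi] this says that [phi] fixes [w] and that its section at [w] is not
    the identity. *)
Definition bad_word phi w := phi w = w /\ exists v, phi (w ++ v) <> w ++ v.

Definition nbad phi n : nat := #|[pred w : n.-tuple X | `[< bad_word phi w >]]|.

Lemma fix_prefix phi w v : tree_aut phi -> phi (w ++ v) = w ++ v -> phi w = w.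
Proof.
move=> phiA; rewrite section_cat // => /eqP.
by rewrite eqseq_cat ?size_tree_aut // => /andP[/eqP].
Qed.

(** Bad words thus form a subtree, so all bad words of a given length are found among the extensions
    of shorter bad words. *)
Lemma bad_word_prefix phi w v : tree_aut phi ->
  bad_word phi (w ++ v) -> bad_word phi w.
Proof.
move=> phiA [wv [v' wvv']]; split; first exact: fix_prefix wv.
by exists (v ++ v'); rewrite catA.
Qed.

Lemma finite_set_bounded (T : choiceType) (A : set T) (f : T -> nat) :
  finite_set A -> exists N, forall x, A x -> (f x <= N)%N.
Proof.
move=> /finite_seqP[s ->]; exists (\max_(x <- s) f x)%N => x xs.
exact: (leq_bigmax_seq x).
Qed.

(* One length works for all words because there are finitely many sections. *)
Lemma bad_word_witness phi : tree_aut phi -> finite_state_aut phi ->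
  exists N, forall w, bad_word phi w ->
    exists2 v, size v = N & phi (w ++ v) <> w ++ v.
Proof.
move=> phiA phif.
pose f (s : seq X -> seq X) := if pselect (exists v, s v <> v) is left h
  then size (projT1 (cid h)) else 0%N.
have [N fN] := finite_set_bounded f phif.
exists N => w [ww [v0 wv0]].
have /fN : range (section phi) (section phi w) by exists w.
rewrite /f; case: pselect => [h|[]]; last first.
  by exists v0 => e; apply: wv0; rewrite section_cat // ww e.
case: (cid h) => v /= wv vN.
(* Padding gives all witnesses the common length [N]; a word with a moved prefix is moved, by
   [fix_prefix]. *)
exists (v ++ nseq (N - size v) (enum_val (Ordinal (ltnW (alphabet_gt1 X))))).
  by rewrite size_cat size_nseq subnKC.
rewrite catA => /(fix_prefix phiA); rewrite section_cat // ww.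
by move/eqP; rewrite eqseq_cat // eqxx => /eqP.
Qed.

(** Among the |X|^N extensions of a bad word at least one is moved, hence is not bad. *)
Lemma nbad_step phi : tree_aut phi -> finite_state_aut phi ->
  exists N, forall n, (nbad phi (n + N) <= nbad phi n * (#|X| ^ N).-1)%N.
Proof.
move=> phiA /(bad_word_witness phiA)[N HN]; exists N => n.
have /choice[W HW] : forall w : n.-tuple X, exists v : N.-tuple X,
    bad_word phi w -> phi (w ++ v) <> w ++ v.
  move=> w; have [/HN[v vN wv]|nb] := pselect (bad_word phi w).
    by exists (tcast vN (in_tuple v)) => _; rewrite val_tcast.
  by exists [tuple of nseq N (enum_val (Ordinal (ltnW (alphabet_gt1 X))))].
(* Pairs of a bad word and an extension other than the chosen moved one; every bad word of length
   [n + N] is the concatenation of such a pair. *)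
pose P := [set p : n.-tuple X * N.-tuple X |
  `[< bad_word phi p.1 >] && (p.2 != W p.1)]%SET.
have -> : (nbad phi n * (#|X| ^ N).-1 = #|P|)%N.
  rewrite -sum1_card (eq_bigl (fun p : n.-tuple X * N.-tuple X =>
    `[< bad_word phi p.1 >] && (p.2 != W p.1))); last by move=> p; rewrite inE.
  rewrite -(pair_big_dep (fun w : n.-tuple X => `[< bad_word phi w >])
     (fun a b => b != W a) (fun _ _ => 1%N)) /=.
  rewrite (eq_bigr (fun=> (#|X| ^ N).-1)).
    by rewrite sum_nat_const.
  by move=> w _; rewrite sum1_card -card_tuple -(cardC1 (W w)).
pose F (p : n.-tuple X * N.-tuple X) := [tuple of p.1 ++ p.2].
apply: leq_trans (leq_imset_card F P); apply: subset_leq_card.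
apply/fintype.subsetP => t; rewrite unfold_in => /asboolP bt.
have tE : val t = take n t ++ drop n t by rewrite cat_take_drop.
have st : size (take n t) == n by rewrite size_takel // size_tuple leq_addr.
have sd : size (drop n t) == N by rewrite size_drop size_tuple addKn.
apply/imsetP; exists (Tuple st, Tuple sd); last exact/val_inj.
rewrite inE /=; apply/andP; split.
  by apply/asboolP/(bad_word_prefix (v := drop n t)) => //=; rewrite -tE.
apply/eqP => dW; have /HW : bad_word phi (Tuple st).
  by apply: (bad_word_prefix (v := drop n t)) => //=; rewrite -tE.
by rewrite -dW /= -tE; case: bt.
Qed.

Lemma nbad_mono phi m n : tree_aut phi ->
  (nbad phi (m + n) <= nbad phi m * #|X| ^ n)%N.
Proof.
move=> phiA.
rewrite /nbad -card_prefix.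
pose F (p : m.-tuple X * n.-tuple X) := [tuple of p.1 ++ p.2].
apply: leq_trans (leq_imset_card F _); apply: subset_leq_card.
apply/fintype.subsetP => t; rewrite unfold_in => /asboolP bt.
have tE : val t = take m t ++ drop m t by rewrite cat_take_drop.
have st : size (take m t) == m by rewrite size_takel // size_tuple leq_addr.
have sd : size (drop m t) == n by rewrite size_drop size_tuple addKn.
apply/imsetP; exists (Tuple st, Tuple sd); last exact/val_inj.
rewrite inE /=; apply/asboolP.
by apply: (bad_word_prefix (v := drop m t)) => //=; rewrite -tE.
Qed.

(** Iterating [nbad_step] bounds the proportion of bad words at level k N by r^k, where r = (q^N -
    1) / q^N < 1. By [nbad_mono] the proportion does not increase afterwards, so levels that are not
    multiples of N cause no loss. *)
Lemma nbad_small (R : realType) phi (e : R) : tree_aut phi ->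
  finite_state_aut phi -> 0 < e ->
  exists n0, forall n, (n0 <= n)%N -> (nbad phi n)%:R <= e * #|X|%:R ^+ n.
Proof.
move=> phiA phif e0; have [N HN] := nbad_step phiA phif.
have q0 : (0 < #|X|)%N := ltnW (alphabet_gt1 X).
pose q : R := #|X|%:R; have qp : 0 < q by rewrite ltr0n.
have qN0 : 0 < q ^+ N by rewrite exprn_gt0.
pose r : R := ((#|X| ^ N).-1)%:R / q ^+ N.
have r0 : 0 <= r by rewrite divr_ge0 ?ler0n // ltW.
have r1 : r < 1.
  by rewrite ltr_pdivrMr // mul1r -natrX ltr_nat prednK // expn_gt0 q0.
have step k : (nbad phi (k * N))%:R <= r ^+ k * q ^+ (k * N).
  elim: k => [|k IH].
    rewrite mul0n !expr0 mulr1 -[X in _ <= X]/(1%:R) ler_nat.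
    by apply: leq_trans (max_card _) _; rewrite card_tuple expn0.
  rewrite mulSn addnC; apply: le_trans (_ : (nbad phi (k * N))%:R *
      ((#|X| ^ N).-1)%:R <= _); first by rewrite -natrM ler_nat.
  rewrite exprD exprSr mulrACA; apply: ler_pM => //.
  by rewrite /r divfK // gt_eqF.
have [k Hk] : exists k, r ^+ k <= e.
  have /cvgrPdist_lt /(_ e e0) [k _ Hk] : (fun k => r ^+ k) @ \oo --> (0 : R).
    by apply: cvg_expr; rewrite ger0_norm.
  exists k; apply/ltW; have := Hk k (leqnn k).
  by rewrite /= sub0r normrN ger0_norm // exprn_ge0.
exists (k * N)%N => n; move/subnKC => <-.
apply: le_trans (_ : (nbad phi (k * N))%:R * q ^+ (n - k * N) <= _).
  by rewrite /q -natrX -natrM ler_nat nbad_mono.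
rewrite exprD mulrA; apply: ler_wpM2r; first by rewrite exprn_ge0 // ltW.
apply: le_trans (step k) _; apply: ler_wpM2r Hk.
by rewrite exprn_ge0 // ltW.
Qed.

End bad_words.

Section restriction.
Variables (X : alphabet) (Gam : self_similar_group X).
Implicit Types (g h : Gam) (u v w : seq X) (x y z : iword X).

Lemma cylinder_cat v w : cylinder (v ++ w) `<=` cylinder v.
Proof. by move=> _ [x _ <-]; rewrite icat_cat; exists (icat w x). Qed.

(** This is g(w x) = g(w) g|_w(x): cutting the domain of g_{u,v} down to a smaller cylinder stays
    within the pseudogroup. *)
Lemma ssg_map_restrict g h u v w z : ssg_act h = section (ssg_act g) w ->
  cylinder (v ++ w) z ->
  ssg_map h (u ++ ssg_act g w) (v ++ w) z = ssg_map g u v z.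
Proof.
move=> hw [x _ <-]; rewrite ssg_map_icat !icat_cat ssg_map_icat.
by rewrite (iaut_section _ hw).
Qed.

Lemma ssg_map_dom g u v z : ssg_map g u v z <-> cylinder v z.
Proof.
split=> [|[x _ <-]]; last by rewrite ssg_map_icat.
by case E : (ssg_map g u v z) => [y|//] _; move/ssg_mapP: E => [x [-> _]]; exists x.
Qed.

Lemma ssg_map_psg g u v : size u = size v -> ssg_pseudogroup Gam (ssg_map g u v).
Proof. by right; exists g, u, v. Qed.

Lemma iaut_fix_cylinder g w x : (forall v, ssg_act g (w ++ v) = w ++ v) ->
  iaut (ssg_act g) (icat w x) = icat w x.
Proof.
move=> gw; apply: (@iword_eq _ (size w)) => n.
by rewrite prefix_of_iaut ?prefix_of_icat //; exact: ssg_aut.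
Qed.

Definition nontrivial_fix g : set (iword X) := [set y |
  iaut (ssg_act g) y = y /\ ~ \forall z \near y, iaut (ssg_act g) z = z].

(** A prefix of [y] is fixed; were it not bad, [g] would be the identity on its cylinder, which is a
    neighbourhood of [y]. *)
Lemma nontrivial_fix_bad g y n : nontrivial_fix g y ->
  bad_word (ssg_act g) (prefix_of y n).
Proof.
move=> [gy ngy]; split; first by rewrite -prefix_of_iaut ?gy //; exact: ssg_aut.
apply: contrapT => H; apply: ngy.
have : nbhs y (cylinder (prefix_of y n)).
  apply: open_nbhs_nbhs; split; first exact: cylinder_open.
  by apply/cylinderE; rewrite size_prefix_of.
apply: filterS => _ [z _ <-]; apply: iaut_fix_cylinder => v.
by apply: contrapT => gv; apply: H; exists v.
Qed.

End restriction.


(** * Convolution of germ indicators *)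

Section finitely_supported_sums.
Variables (V : nmodType) (T : choiceType).
Implicit Types (A : set T) (f g : T -> V).

Lemma fsum_single A f i0 : A i0 -> (forall i, A i -> i <> i0 -> f i = 0) ->
  \sum_(i \in A) f i = f i0.
Proof.
move=> Ai0 f0; rewrite -(fsbig_widen [set i0] A) ?fsbig_set1 // => [_ ->//|].
by move=> i [Ai ni] /=; exact: f0.
Qed.

(** A sum over a set is 0 by default when its support is infinite, hence the two finiteness
    hypotheses. All three sums are computed on the union of the two supports. *)
Lemma fsumD A f g : finite_set (A `&` [set i | f i != 0]) ->
  finite_set (A `&` [set i | g i != 0]) ->
  \sum_(i \in A) (f i + g i) = \sum_(i \in A) f i + \sum_(i \in A) g i.
Proof.
move=> ff fg; pose B := (A `&` [set i | f i != 0]) `|` (A `&` [set i | g i != 0]).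
have Bf : finite_set B by rewrite finite_setU.
have BA : B `<=` A by move=> i [[]|[]].
have f0 i : A i -> ~ B i -> f i = 0.
  by move=> Ai nB; apply: contrapT => /eqP fi; apply: nB; left.
have g0 i : A i -> ~ B i -> g i = 0.
  by move=> Ai nB; apply: contrapT => /eqP gi; apply: nB; right.
rewrite -!(fsbig_widen B A) ?fsbig_split // => i [Ai nB] /=.
- exact: g0.
- exact: f0.
- by rewrite f0 ?g0 ?addr0.
Qed.

End finitely_supported_sums.

Section convolution.
Variables (R : realType) (G : etale_groupoid).
Local Notation C := R[i].
Implicit Types (a b : garr G -> C) (g h p : garr G).

Lemma gmulKV p g : grng p = grng g -> gmul p (gmul (ginv p) g) = g.
Proof.
move=> pg; rewrite gmulA ?grng_inv ?gsrc_inv // gmulgV pg; exact: gmul1g.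
Qed.

Lemma gmulK g h : gsrc g = grng h -> gmul (ginv g) (gmul g h) = h.
Proof.
move=> gh; rewrite gmulA ?gsrc_inv // gmulVg gh; exact: gmul1g.
Qed.

(** A factorization g = p q is determined by [p], since q = p^-1 g. *)
Lemma convE a b g :
  conv a b g = \sum_(p \in [set p | grng p = grng g]) (a p * b (gmul (ginv p) g)).
Proof.
rewrite /conv (reindex_fsbig (fun p => (p, gmul (ginv p) g))
  [set p | grng p = grng g]) //; split.
- move=> p /= pg; rewrite gmulKV // grng_mul ?gsrc_inv // grng_inv.
  by split.
- by move=> p q _ _ [].
- move=> [p q] /= [pq <-]; exists p; first by rewrite /= grng_mul.
  by rewrite gmulK.
Qed.

(** By [convE] this condition on the left factor alone makes the sums in [conv] and [cc_act]
    finite. *)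
Definition range_finite a := forall y, finite_set [set g | grng g = y /\ a g != 0].

Lemma range_finiteD a b : range_finite a -> range_finite b ->
  range_finite (fun g => a g + b g).
Proof.
move=> fa fb y; apply: (@sub_finite_set _ _
  ([set g | grng g = y /\ a g != 0] `|` [set g | grng g = y /\ b g != 0])).
  move=> g /= [gy abg]; case: (eqVneq (a g) 0) => [ag|]; last by left.
  by right; rewrite ag add0r in abg.
by rewrite finite_setU.
Qed.

Lemma convDl a a' b : range_finite a -> range_finite a' ->
  conv (fun g => a g + a' g) b = (fun g => conv a b g + conv a' b g).
Proof.
move=> fa fa'; apply/funext => g; rewrite !convE.
under eq_fsbigr do rewrite mulrDl.
apply: fsumD; [move: fa|move: fa'] => /(_ (grng g)); apply: sub_finite_set;
  by move=> p /= [pg]; rewrite mulf_eq0 negb_or => /andP[].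
Qed.

Lemma convDr a b b' : range_finite a ->
  conv a (fun g => b g + b' g) = (fun g => conv a b g + conv a b' g).
Proof.
move=> fa; apply/funext => g; rewrite !convE.
under eq_fsbigr do rewrite mulrDr.
apply: fsumD; move: fa => /(_ (grng g)); apply: sub_finite_set;
  by move=> p /= [pg]; rewrite mulf_eq0 negb_or => /andP[].
Qed.

Lemma conv0l b : conv (fun=> 0) b = (fun=> 0).
Proof.
by apply/funext => g; rewrite convE fsbig1 // => p _; rewrite mul0r.
Qed.

Lemma conv0r a : conv a (fun=> 0) = (fun=> 0).
Proof.
by apply/funext => g; rewrite convE fsbig1 // => p _; rewrite mulr0.
Qed.

(* The representation of the convolution algebra on functions on the unit space,
   which is the direct sum of the quasi-regular representations on the orbits. *)
Definition cc_act a (xi : gbase G -> C) (y : gbase G) : C :=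
  \sum_(g \in [set g | grng g = y]) (a g * xi (gsrc g)).

Lemma cc_actD a b xi y : range_finite a -> range_finite b ->
  cc_act (fun g => a g + b g) xi y = cc_act a xi y + cc_act b xi y.
Proof.
move=> fa fb; rewrite /cc_act; under eq_fsbigr do rewrite mulrDl.
apply: fsumD; [move: fa|move: fb] => /(_ y); apply: sub_finite_set;
  by move=> p /= [pg]; rewrite mulf_eq0 negb_or => /andP[].
Qed.

Lemma cc_actDr a xi eta y : range_finite a ->
  cc_act a (fun x => xi x + eta x) y = cc_act a xi y + cc_act a eta y.
Proof.
move=> fa; rewrite /cc_act; under eq_fsbigr do rewrite mulrDr.
apply: fsumD; move: fa => /(_ y); apply: sub_finite_set;
  by move=> p /= [pg]; rewrite mulf_eq0 negb_or => /andP[].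
Qed.

Lemma cc_act0 xi y : cc_act (fun=> 0) xi y = 0.
Proof. by rewrite /cc_act fsbig1 // => g _; rewrite mul0r. Qed.

Lemma cc_actZ z a xi y : cc_act (fun g => z * a g) xi y = z * cc_act a xi y.
Proof.
by rewrite /cc_act mulr_fsumr; apply: eq_fsbigr => g _; rewrite mulrA.
Qed.

End convolution.

Section monomials.
Variables (R : realType) (Y : ptopologicalType) (S : pseudogroup Y).
Hypothesis Y_hausdorff : hausdorff_space Y.
Hypothesis Y_locally_compact : locally_compact [set: Y].
Local Notation C := R[i].
Local Notation G := (germ_groupoid S Y_hausdorff Y_locally_compact).
Implicit Types (s t : Y -> option Y) (c d : Y -> C) (x y z : Y) (g h : germ S).

Definition theta s : set (germ S) := germ_base s [set x | s x].

(** In the convolution algebra this is the indicator of [theta s] times multiplication by [c] on the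
    source side; as an operator it multiplies by [c] and then transports along [s]. *)
Definition monomial s c : germ S -> C := fun g =>
  if `[< theta s g >] then c (germ_src g) else 0.

Lemma theta_of s x (Ss : S s) (sx : s x) : theta s (germ_of Ss sx).
Proof. exact/germ_base_of. Qed.

Lemma germ_of_irr s x (Ss Ss' : S s) (sx sx' : s x) :
  germ_of Ss sx = germ_of Ss' sx'.
Proof. by apply/germ_of_eq; split=> //; near=> w. Unshelve. all: by end_near. Qed.

Lemma thetaP s g : theta s g -> exists x (Ss : S s) (sx : s x), g = germ_of Ss sx.
Proof. by move=> [x [Ss [sx [_ ->]]]]; exists x, Ss, sx. Qed.

Lemma monomial_of s c x (Ss : S s) (sx : s x) : monomial s c (germ_of Ss sx) = c x.
Proof. by rewrite /monomial asboolT ?germ_src_of //; exact: theta_of. Qed.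

Lemma monomial_out s c g : ~ theta s g -> monomial s c g = 0.
Proof. by move=> ng; rewrite /monomial asboolF. Qed.

Lemma psg_inj s x y z : S s -> s x = Some z -> s y = Some z -> x = y.
Proof. by move=> /psg_homeo[sI _ _]; exact: sI. Qed.

(** As [s] is injective, at most one germ of [s] has a given range. *)
Lemma monomial_range_finite s c : range_finite (monomial s c : garr G -> C).
Proof.
move=> y; case: (pselect (exists g, theta s g /\ germ_rng g = y)); last first.
  move=> H; apply: (@sub_finite_set _ _ set0) => // g [gy /eqP ng]; apply: H.
  by exists g; split=> //; apply: contrapT => /(monomial_out c); exact: ng.
move=> [g0 [/thetaP[x [Ss [sx ->]]] xy]].
apply: (@sub_finite_set _ _ [set germ_of Ss sx]); last exact: finite_set1.
move=> g /= [gy /eqP ng].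
have /thetaP[x' [Ss' [sx' gE]]] : theta s g.
  by apply: contrapT => /(monomial_out c); exact: ng.
subst g; apply/germ_of_eq.
have [z sxz] : exists z, s x = Some z by case: (s x) (sx) => // z _; exists z.
have [z' sxz'] : exists z, s x' = Some z by case: (s x') (sx') => // w _; exists w.
have zy : germ_rng (germ_of Ss' sx') = y := gy.
rewrite (germ_rng_of _ _ sxz') in zy.
move: xy; rewrite (germ_rng_of _ _ sxz) => xy; split; last by near=> w.
by apply: (psg_inj Ss sxz'); rewrite sxz xy zy.
Unshelve. all: by end_near. Qed.

(** By injectivity a germ of [t s] factors in exactly one way into a germ of [t] and a germ of [s].
    The default [x] of [odflt] is never seen: where [s] is undefined, so is [pcomp t s]. *)
Lemma conv_monomial s t c d : S s -> S t ->
  conv (monomial t c : garr G -> C) (monomial s d) =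
  monomial (pcomp t s) (fun x => c (odflt x (s x)) * d x).
Proof.
move=> Ss St; apply/funext => g; rewrite convE.
have [/thetaP[x [Sts [tsx gE]]]|ng] := pselect (theta (pcomp t s) g).
  have [y sxy ty] : exists2 y, s x = Some y & t y.
    by move: (tsx); rewrite /pcomp; case: (s x) => // y; exists y.
  have sx : s x by rewrite sxy.
  have gE' : g = germ_mul (germ_of St ty) (germ_of Ss sx).
    rewrite (germ_mul_of _ _ _ _ (pcomp_dom sxy ty) sxy) gE.
    by apply/germ_of_eq; split=> //; near=> w.
  have comp : germ_src (germ_of St ty) = germ_rng (germ_of Ss sx).
    by rewrite germ_src_of (germ_rng_of _ _ sxy).
  rewrite (fsum_single (i0 := germ_of St ty)).
  - have -> : gmul (ginv (germ_of St ty : garr G)) g = germ_of Ss sx.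
      by rewrite gE'; exact: (@gmulK G).
    by rewrite gE !monomial_of sxy.
  - by rewrite /= gE'; apply/esym/(@grng_mul G).
  move=> p /= pg np; case: (pselect (theta t p)) => [|/monomial_out ->]; last first.
    by rewrite mul0r.
  move=> /thetaP[y' [St' [ty' pE]]]; exfalso; apply: np; rewrite pE.
  apply/germ_of_eq; split; last by near=> w.
  have [z tyz] : exists z, t y = Some z by case: (t y) (ty) => // z _; exists z.
  have [z' tyz'] : exists z, t y' = Some z by case: (t y') (ty') => // w _; exists w.
  apply: (psg_inj St tyz'); rewrite tyz; congr Some.
  have : germ_rng p = germ_rng (germ_mul (germ_of St ty) (germ_of Ss sx)).
    by rewrite -gE'.
  rewrite [RHS](@grng_mul G (germ_of St ty) (germ_of Ss sx) comp).
  by rewrite pE (germ_rng_of _ _ tyz') => ->; apply/esym; exact: (germ_rng_of St ty tyz).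
rewrite (monomial_out _ ng) fsbig1 // => p pg.
case: (pselect (theta t p)) => [tp|/monomial_out ->]; last by rewrite mul0r.
set q := gmul _ _; case: (pselect (theta s q)) => [sq|/monomial_out ->]; last first.
  by rewrite mulr0.
exfalso; apply: ng; rewrite -(@gmulKV G p g pg) -/q.
have : gsrc (p : garr G) = grng q by rewrite grng_mul ?grng_inv ?gsrc_inv.
move/thetaP: tp => [y [St' [ty pE]]]; move/thetaP: sq => [x [Ss' [sx ->]]].
have [y' sxy] : exists z, s x = Some z by case: (s x) (sx) => // z _; exists z.
rewrite pE => yy; have {}yy : germ_src (germ_of St' ty) = germ_rng (germ_of Ss' sx) := yy.
rewrite germ_src_of (germ_rng_of _ _ sxy) in yy; subst y'.
change (theta (pcomp t s) (germ_mul (germ_of St' ty) (germ_of Ss' sx))).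
rewrite (germ_mul_of _ _ _ _ (pcomp_dom sxy ty) sxy).
exact: theta_of.
Unshelve. all: by end_near. Qed.

Lemma cc_act_monomial s c xi y : S s ->
  cc_act (monomial s c : garr G -> C) xi y =
  if pinv s y is Some x then c x * xi x else 0.
Proof.
move=> Ss; have [sI _ _] := psg_homeo Ss; case E : (pinv s y) => [x|].
  move/(pinvP sI): E => sxy.
  have sx : s x by rewrite sxy.
  rewrite /cc_act (fsum_single (i0 := germ_of Ss sx)).
  - by rewrite monomial_of; congr (_ * xi _); exact: germ_src_of.
  - exact: (germ_rng_of Ss sx sxy).
  move=> p /= py np; case: (pselect (theta s p)) => [|/monomial_out ->]; last first.
    by rewrite mul0r.
  move=> /thetaP[x' [Ss' [sx' pE]]]; exfalso; apply: np; rewrite pE.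
  apply/germ_of_eq; split; last by near=> w.
  have [z' tyz'] : exists z, s x' = Some z by case: (s x') (sx') => // w _; exists w.
  apply: (psg_inj Ss tyz'); rewrite sxy -py pE.
  congr Some; exact: (germ_rng_of Ss' sx' tyz').
rewrite /cc_act fsbig1 // => p /= py.
case: (pselect (theta s p)) => [|/monomial_out ->]; last by rewrite mul0r.
move=> /thetaP[x' [Ss' [sx' pE]]]; exfalso.
have [z' tyz'] : exists z, s x' = Some z by case: (s x') (sx') => // w _; exists w.
have zy : germ_rng p = y := py; rewrite pE (germ_rng_of _ _ tyz') in zy.
by move: tyz'; rewrite zy => /(pinvP sI); rewrite E.
Unshelve. all: by end_near. Qed.

Lemma cc_star_monomial s c : S s ->
  cc_star (monomial s c : garr G -> C) =
  monomial (pinv s) (fun y => conjc (c (odflt y (pinv s y)))).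
Proof.
move=> Ss; have [sI _ _] := psg_homeo Ss; apply/funext => g; rewrite /cc_star.
have inv g' : theta s g' -> theta (pinv s) (germ_inv g').
  move=> /thetaP[x [Ss' [sx ->]]].
  have [y sxy] : exists z, s x = Some z by case: (s x) (sx) => // z _; exists z.
  by rewrite (germ_inv_of _ _ (pinv_dom Ss sxy) sxy); exact: theta_of.
have invK g' : germ_inv (germ_inv g') = g'.
  have [s' [x [y [Ss' [sx [sy [-> sxy _ _ ->]]]]]]] := germ_rngP g'.
  have [sI' _ _] := psg_homeo Ss'.
  have syx : pinv s' y = Some x by apply/pinvP.
  have pK : pinv (pinv s') = s' by apply: pinv_eq => a b; exact: pinvP.
  have sx'' : pinv (pinv s') x by rewrite pK.
  rewrite (germ_inv_of _ _ sx'' syx); apply/germ_of_eq; split=> //.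
  by rewrite pK; near=> w.
have [/thetaP[y [Ss' [sy gE]]]|ng] := pselect (theta (pinv s) g).
  rewrite gE monomial_of.
  have [x syx] : exists x, pinv s y = Some x.
    by case: (pinv s y) (sy) => // z _; exists z.
  have pK : pinv (pinv s) = s by apply: pinv_eq => a b; exact: pinvP.
  have sx : pinv (pinv s) x by rewrite pK; move/(pinvP sI): syx => ->.
  rewrite syx /=; congr conjc; change (monomial s c (germ_inv (germ_of Ss' sy)) = c x).
  rewrite (germ_inv_of _ _ sx syx); move: sx (psg_inv Ss'); rewrite pK => sx Ss''.
  exact: monomial_of.
rewrite (monomial_out _ ng) monomial_out ?conjc0 // => H.
by apply: ng; rewrite -[g]invK; exact: inv.
Unshelve. all: by end_near. Qed.

End monomials.

(** * A C*-seminorm from the representation on functions of the unit space *)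

Section real_norm.
Variables (R : realType).
Local Notation C := R[i].
Local Open Scope complex_scope.

(** Norms over R[i] are themselves complex numbers; the real part allows estimates in the total
    order of [R]. *)
Definition rnorm (V : normedZmodType C) (v : V) : R := complex.Re `|v|.

Section normed.
Variable V : normedZmodType C.
Implicit Types v w : V.

Lemma rnormE v : (rnorm v)%:C = `|v|.
Proof. by rewrite /rnorm RRe_real // normr_real. Qed.

Lemma rnorm_ge0 v : 0 <= rnorm v.
Proof. by rewrite -lecR rnormE; exact: normr_ge0. Qed.

Lemma rnormD v w : rnorm (v + w) <= rnorm v + rnorm w.
Proof. by rewrite -lecR rmorphD /= !rnormE ler_normD. Qed.

Lemma rnormN v : rnorm (- v) = rnorm v.
Proof. by rewrite /rnorm normrN. Qed.

Lemma rnormB v w : rnorm (v - w) = rnorm (w - v).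
Proof. by rewrite -rnormN opprB. Qed.

Lemma rnorm0 : rnorm (0 : V) = 0.
Proof. by rewrite /rnorm normr0. Qed.

Lemma rnorm_sum I (r : seq I) (P : pred I) (F : I -> V) :
  rnorm (\sum_(i <- r | P i) F i) <= \sum_(i <- r | P i) rnorm (F i).
Proof.
elim/big_ind2: _ => [|x1 x2 y1 y2 h1 h2|//]; first by rewrite rnorm0.
by apply: le_trans (rnormD _ _) _; exact: lerD.
Qed.

Lemma rnorm0_eq0 v : rnorm v = 0 -> v = 0.
Proof. by move=> v0; apply/eqP; rewrite -normr_eq0 -rnormE v0. Qed.

End normed.

Lemma rnormM (z w : C) : rnorm (z * w) = rnorm z * rnorm w.
Proof. by apply: complexI; rewrite rmorphM /= !rnormE normrM. Qed.

Lemma rnormJ (z : C) : rnorm (conjc z) = rnorm z.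
Proof. by rewrite /rnorm normcJ. Qed.

Lemma rnorm_real (x : R) : rnorm x%:C = `|x|.
Proof. by rewrite /rnorm normc_def /= expr0n /= addr0 sqrtr_sqr. Qed.

Lemma rnorm_ger0 (z : C) : 0 <= z -> rnorm z = complex.Re z.
Proof. by move=> z0; rewrite /rnorm ger0_norm. Qed.

Lemma rnorm_sqr (z : C) : (rnorm z ^+ 2)%:C = z * conjc z.
Proof. by rewrite rmorphXn /= rnormE sqr_normc. Qed.

Lemma Re_le_rnorm (z : C) : `|complex.Re z| <= rnorm z.
Proof. by rewrite -lecR rnormE normc_ge_Re. Qed.

Lemma rnorm_i : rnorm ('i%C : C) = 1.
Proof. by rewrite /rnorm normc_def /= expr0n expr1n add0r sqrtr1. Qed.

Lemma Im_le_rnorm (z : C) : `|complex.Im z| <= rnorm z.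
Proof.
by have := Re_le_rnorm (z * 'i%C); rewrite ReiNIm normrN rnormM rnorm_i mulr1.
Qed.

(* The matrix [[al, be], [be', de]] is positive, hence hermitian with a
   nonnegative determinant. *)
Lemma positive_form_det (al be be' de : C) :
  (forall z : C, 0 <= z * conjc z * al + z * be + conjc z * be' + de) ->
  0 <= al -> 0 <= de -> be' = conjc be /\
  rnorm be ^+ 2 <= complex.Re al * complex.Re de.
Proof.
move=> H al0 de0; have alI := ger0_Im al0; have deI := ger0_Im de0.
case: al al0 alI H => a a' /=; rewrite lecE /= => /andP[_ a0] -> H.
case: de de0 deI H => d d' /=; rewrite lecE /= => /andP[_ d0] -> H.
case: be H => b1 b2; case: be' => c1 c2 H.
have H1 x y : 0 <= (x ^+ 2 + y ^+ 2) * a + x * b1 - y * b2 + x * c1 + y * c2 + d.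
  have := H (x +i* y); rewrite lecE /= => /andP[_]; congr (_ <= _); ring.
have H2 x y : x * b2 + y * b1 + x * c2 - y * c1 = 0.
  have := H (x +i* y); rewrite lecE /= => /andP[/eqP <- _]; ring.
have c2E : c2 = - b2 by have := H2 1 0; lra.
have c1E : c1 = b1 by have := H2 0 1; lra.
split; first by rewrite c1E c2E.
have -> : rnorm (b1 +i* b2) ^+ 2 = b1 ^+ 2 + b2 ^+ 2.
  apply: complexI; rewrite rnorm_sqr /=; apply/eqP; rewrite eq_complex /=.
  by apply/andP; split; apply/eqP; ring.
subst c1 c2; set N := b1 ^+ 2 + b2 ^+ 2.
(* This is z = - t conj(be), for which both cross terms are equal to - t |be|^2. *)
have H3 t : 0 <= (t ^+ 2 * a - 2 * t) * N + d.
  by have := H1 (- t * b1) (t * b2); congr (_ <= _); rewrite /N; ring.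
rewrite /=; have [a0'|a_gt0] := leP a 0.
  have {}a0 : a = 0 by apply/eqP; rewrite eq_le a0' a0.
  have [N0|N0] := eqVneq N 0; first by rewrite N0 a0 mul0r.
  (* With [a = 0] the form is d - 2 t N, and this [t] gives it the value -1. *)
  have := H3 ((d + 1) / (2 * N)); rewrite a0 mulr0 sub0r.
  have -> : - (2 * ((d + 1) / (2 * N))) * N + d = -1 by field.
  lra.
(* The quadratic in [t] has its minimum at 1/a. *)
have := H3 a^-1; have -> : (a^-1 ^+ 2 * a - 2 * a^-1) * N + d = d - N / a.
  by field; rewrite gt_eqF.
by rewrite subr_ge0 ler_pdivrMr // mulrC.
Qed.

End real_norm.

Section hilbert_space.
Variables (R : realType) (Y : choiceType).
Local Notation C := R[i].
Implicit Types (xi eta zeta : Y -> C).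

Definition fsupp xi := finite_set [set x | xi x != 0].

Definition inner xi eta : C := \sum_(x \in [set: Y]) (xi x * conjc (eta x)).

Lemma fsupp0 : fsupp (fun=> 0).
Proof. by apply: (@sub_finite_set _ _ set0) => // x /= /eqP. Qed.

Lemma fsuppD xi eta : fsupp xi -> fsupp eta -> fsupp (fun x => xi x + eta x).
Proof.
move=> fx fe; apply: (@sub_finite_set _ _
  ([set x | xi x != 0] `|` [set x | eta x != 0])); last by rewrite finite_setU.
move=> x /= h; case: (eqVneq (xi x) 0) => [x0|]; last by left.
by right; rewrite x0 add0r in h.
Qed.

Lemma fsuppZ z xi : fsupp xi -> fsupp (fun x => z * xi x).
Proof.
by apply: sub_finite_set => x /=; rewrite mulf_eq0 negb_or => /andP[].
Qed.

Lemma fsupp_delta (x : Y) : fsupp (fun y => (y == x)%:R).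
Proof.
apply: (@sub_finite_set _ _ [set x]); last exact: finite_set1.
by move=> y /=; case: (eqVneq y x) => [->//|_]; rewrite eqxx.
Qed.

Lemma innerDl xi xi' eta : fsupp xi -> fsupp xi' ->
  inner (fun x => xi x + xi' x) eta = inner xi eta + inner xi' eta.
Proof.
move=> f f'; rewrite /inner; under eq_fsbigr do rewrite mulrDl.
apply: fsumD; [move: f|move: f']; apply: sub_finite_set;
  by move=> x [_ /=]; rewrite mulf_eq0 negb_or => /andP[].
Qed.

Lemma innerZl z xi eta : inner (fun x => z * xi x) eta = z * inner xi eta.
Proof.
by rewrite /inner mulr_fsumr; apply: eq_fsbigr => x _; rewrite mulrA.
Qed.

Lemma conjc_fsum (A : set Y) (f : Y -> C) :
  conjc (\sum_(x \in A) f x) = \sum_(x \in A) conjc (f x).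
Proof.
have E : [set x | f x != 0] = [set x | conjc (f x) != 0].
  by apply/seteqP; split=> x /=; rewrite conjc_eq0.
have sE (g : Y -> C) : g @^-1` [set~ 0] = [set x | g x != 0].
  by apply/seteqP; split=> x /= /eqP.
case: (pselect (finite_set (A `&` [set x | f x != 0]))) => fin; last first.
  by rewrite !fsbig_dflt ?conjc0 // sE // -?E.
rewrite fsbig_supp [RHS]fsbig_supp !sE -E !fsbig_finite // rmorph_sum.
by [].
Qed.

Lemma innerC xi eta : inner eta xi = conjc (inner xi eta).
Proof.
rewrite /inner conjc_fsum; apply: eq_fsbigr => x _.
by rewrite rmorphM /= conjcK mulrC.
Qed.

Lemma innerDr xi eta eta' : fsupp eta -> fsupp eta' ->
  inner xi (fun x => eta x + eta' x) = inner xi eta + inner xi eta'.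
Proof.
by move=> f f'; rewrite innerC innerDl // rmorphD /= -!innerC.
Qed.

Lemma innerZr z xi eta : inner xi (fun x => z * eta x) = conjc z * inner xi eta.
Proof. by rewrite innerC innerZl rmorphM /= -innerC. Qed.

Lemma inner_ge0 xi : 0 <= inner xi xi.
Proof. by apply: fsumr_ge0 => x _; exact: mulcJ_ge0. Qed.

Lemma inner0l eta : inner (fun=> 0) eta = 0.
Proof. by rewrite /inner fsbig1 // => x _; rewrite mul0r. Qed.

Definition sqnorm xi : R := complex.Re (inner xi xi).

Lemma sqnorm_ge0 xi : 0 <= sqnorm xi.
Proof. by have := inner_ge0 xi; rewrite lecE => /andP[]. Qed.

Lemma sqnormE xi : (sqnorm xi)%:C%C = inner xi xi.
Proof. by rewrite /sqnorm RRe_real // ger0_real // inner_ge0. Qed.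

Lemma rnorm_inner xi : rnorm (inner xi xi) = sqnorm xi.
Proof. by rewrite rnorm_ger0 // inner_ge0. Qed.

Lemma sqnormZ z xi : sqnorm (fun x => z * xi x) = rnorm z ^+ 2 * sqnorm xi.
Proof.
apply: complexI; rewrite rmorphM /= rnorm_sqr !sqnormE innerZl innerZr.
by rewrite mulrA.
Qed.

(** Nonnegativity of the inner product at [z xi + eta], for all [z], is the hypothesis of
    [positive_form_det]. *)
Lemma cauchy_schwarz xi eta : fsupp xi -> fsupp eta ->
  rnorm (inner xi eta) ^+ 2 <= sqnorm xi * sqnorm eta.
Proof.
move=> fx fe; apply: (proj2 (@positive_form_det _ _ _ (inner eta xi) _ _ _ _));
  try exact: inner_ge0.
move=> z; have fz := fsuppZ z fx.
have := inner_ge0 (fun x => z * xi x + eta x); congr (_ <= _).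
rewrite innerDl // !innerDr // !innerZl !innerZr; ring.
Qed.

Lemma sqnorm_delta (x : Y) : sqnorm (fun y => (y == x)%:R) = 1.
Proof.
rewrite /sqnorm /inner (fsum_single (i0 := x)) // ?eqxx ?conjc_nat ?mulr1 //.
by move=> y _ /eqP/negbTE ->; rewrite mul0r.
Qed.

End hilbert_space.

Section monomial_span.
Variables (R : realType) (Y : ptopologicalType) (S : pseudogroup Y).
Hypothesis Y_hausdorff : hausdorff_space Y.
Hypothesis Y_locally_compact : locally_compact [set: Y].
Local Notation C := R[i].
Local Notation G := (germ_groupoid S Y_hausdorff Y_locally_compact).
Local Notation mono s c := (@monomial R Y S s c : garr G -> C).
Implicit Types (s t : Y -> option Y) (c d : Y -> C) (x y : Y)
  (Q : (Y -> C) -> Prop) (f a b : garr G -> C).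

(** The predicate [Q] lets one span serve for arbitrary, bounded, continuous and constant
    coefficients; scalars are absorbed into the coefficients. *)
Inductive monomial_span Q : (garr G -> C) -> Prop :=
| span0 : monomial_span Q (fun=> 0)
| spanDl s c f : S s -> Q c -> monomial_span Q f ->
    monomial_span Q (fun g => mono s c g + f g).

Lemma span1 Q s c : S s -> Q c -> monomial_span Q (mono s c).
Proof.
move=> Ss Qc; have := spanDl Ss Qc (span0 Q); congr monomial_span.
by apply/funext => g; rewrite addr0.
Qed.

Lemma spanD Q f f' : monomial_span Q f -> monomial_span Q f' ->
  monomial_span Q (fun g => f g + f' g).
Proof.
elim=> [|s c a Ss Qc _ IH] sf'.
  by congr monomial_span: (sf'); apply/funext => g; rewrite add0r.
have := spanDl Ss Qc (IH sf'); congr monomial_span.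
by apply/funext => g; rewrite addrA.
Qed.

Lemma span_sum Q I (r : seq I) (P : pred I) (F : I -> garr G -> C) :
  (forall i, P i -> monomial_span Q (F i)) ->
  monomial_span Q (fun g => \sum_(i <- r | P i) F i g).
Proof.
move=> QF; elim: r => [|i r IH].
  by have := span0 Q; congr monomial_span; apply/funext => g; rewrite big_nil.
case Pi : (P i); last first.
  by move: IH; congr monomial_span; apply/funext => g; rewrite big_cons Pi.
have := spanD (QF _ Pi) IH; congr monomial_span.
by apply/funext => g; rewrite big_cons Pi.
Qed.

Lemma sub_span Q Q' f : (forall c, Q c -> Q' c) ->
  monomial_span Q f -> monomial_span Q' f.
Proof.
move=> QQ'; elim=> [|s c a Ss Qc _ IH]; first exact: span0.
by apply: spanDl => //; exact: QQ'.
Qed.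

Lemma span_range_finite Q f : monomial_span Q f -> range_finite f.
Proof.
elim=> [|s c a Ss Qc _ IH].
  by move=> y; apply: (@sub_finite_set _ _ set0) => // g /= [_ /eqP].
by apply: range_finiteD => //; exact: monomial_range_finite.
Qed.

Lemma monomialZ z s c : (fun g => z * mono s c g) = mono s (fun x => z * c x).
Proof.
by apply/funext => g; rewrite /monomial; case: asboolP; rewrite ?mulr0.
Qed.

Lemma spanZ Q z f : (forall c, Q c -> Q (fun x => z * c x)) ->
  monomial_span Q f -> monomial_span Q (fun g => z * f g).
Proof.
move=> QZ; elim=> [|s c a Ss Qc _ IH].
  by have := span0 Q; congr monomial_span; apply/funext => g; rewrite mulr0.
have := spanDl Ss (QZ _ Qc) IH; congr monomial_span; apply/funext => g.
by rewrite mulrDr -monomialZ.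
Qed.

Lemma span_conv Q a b :
  (forall s c d, S s -> Q c -> Q d -> Q (fun x => c (odflt x (s x)) * d x)) ->
  monomial_span Q a -> monomial_span Q b -> monomial_span Q (conv a b).
Proof.
move=> QM sa sb; elim: sa => [|t c a' St Qc sa' IH].
  by rewrite conv0l; exact: span0.
rewrite convDl; [|exact: monomial_range_finite|exact: span_range_finite sa'].
apply: spanD IH; elim: sb => [|s d b' Ss Qd sb' IH].
  by rewrite conv0r; exact: span0.
rewrite convDr; last exact: monomial_range_finite.
apply: spanD IH; rewrite conv_monomial //.
by apply: span1; [exact: psg_comp|exact: QM].
Qed.

Lemma cc_starD a b :
  cc_star (fun g => a g + b g) = (fun g => cc_star a g + cc_star b g).
Proof. by apply/funext => g; rewrite /cc_star rmorphD. Qed.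

Lemma cc_star0 : cc_star (fun=> 0 : C) = (fun=> 0) :> (garr G -> C).
Proof. by apply/funext => g; rewrite /cc_star conjc0. Qed.

Lemma span_star Q Q' a :
  (forall s c, S s -> Q c -> Q' (fun y => conjc (c (odflt y (pinv s y))))) ->
  monomial_span Q a -> monomial_span Q' (cc_star a).
Proof.
move=> QJ; elim=> [|s c a' Ss Qc sa' IH]; first by rewrite cc_star0; exact: span0.
rewrite cc_starD; apply: spanD IH; rewrite cc_star_monomial //.
by apply: span1; [exact: psg_inv|exact: QJ].
Qed.

Lemma pinv_pcomp s t : S s -> S t ->
  pinv (pcomp t s) = (fun y => obind (pinv s) (pinv t y)).
Proof.
move=> Ss St; have [sI _ _] := psg_homeo Ss; have [tI _ _] := psg_homeo St.
apply: pinv_eq => x y; rewrite /pcomp; split.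
  case E : (s x) => [w|//] /= /(pinvP tI) -> /=; exact/pinvP.
case E : (pinv t y) => [w|//] /= /(pinvP sI) -> /=; exact/pinvP.
Qed.

Definition any_fun (c : Y -> C) := True.

Lemma span_any Q f : monomial_span Q f -> monomial_span any_fun f.
Proof. exact: sub_span. Qed.

Lemma span_any_star Q f : monomial_span Q f -> monomial_span any_fun (cc_star f).
Proof. exact: span_star. Qed.

(** Additivity in [a] and in [b] reduces the claim to two monomials, where both sides pull back
    along the inverse of [t], then that of [s]. *)
Lemma cc_act_conv Q Q' a b xi : monomial_span Q a -> monomial_span Q' b ->
  cc_act (conv a b) xi = cc_act a (cc_act b xi).
Proof.
move=> sa sb; have anyM := span_conv (Q := any_fun) (fun _ _ _ _ _ _ => I).
elim: sa => [|t c a' St Qc sa' IH].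
  by apply/funext => y; rewrite conv0l !cc_act0.
have ra' := span_range_finite sa'.
have mf : range_finite (mono t c) by exact: monomial_range_finite.
rewrite convDl //; apply/funext => y; rewrite !cc_actD //; last 2 first.
- apply: (span_range_finite (Q := any_fun)); apply: anyM; last exact: span_any sb.
  exact: span1.
- apply: (span_range_finite (Q := any_fun)); apply: anyM; last exact: span_any sb.
  exact: span_any sa'.
rewrite IH; congr (_ + _); elim: sb => [|s d b' Ss Qd sb' IHb].
  rewrite conv0r cc_act0 cc_act_monomial //; case: pinv => // x.
  by rewrite cc_act0 mulr0.
rewrite convDr // cc_actD; last 2 first.
- apply: (span_range_finite (Q := any_fun)); apply: anyM; exact: span1.
- apply: (span_range_finite (Q := any_fun)); apply: anyM; last exact: span_any sb'.
  exact: span1.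
have -> : cc_act (fun g => mono s d g + b' g) xi =
    (fun y => cc_act (mono s d) xi y + cc_act b' xi y).
  apply/funext => w; apply: cc_actD; first exact: monomial_range_finite.
  exact: span_range_finite sb'.
rewrite cc_actDr // IHb; congr (_ + _).
rewrite conv_monomial // !cc_act_monomial //; last exact: psg_comp.
rewrite pinv_pcomp //; case: (pinv t y) => [w|//] /=.
rewrite cc_act_monomial //; case E : (pinv s w) => [x|]; last by rewrite mulr0.
have [sI _ _] := psg_homeo Ss; move/(pinvP sI): E => -> /=.
by rewrite mulrA.
Qed.

Lemma fsupp_cc_act Q a xi : monomial_span Q a -> fsupp xi -> fsupp (cc_act a xi).
Proof.
move=> sa fx; elim: sa => [|s c a' Ss Qc sa' IH].
  apply: (@sub_finite_set _ _ set0) => // y /=.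
  by rewrite cc_act0 eqxx.
have -> : cc_act (fun g => mono s c g + a' g) xi =
    (fun y => cc_act (mono s c) xi y + cc_act a' xi y).
  apply/funext => w; apply: cc_actD; first exact: monomial_range_finite.
  exact: span_range_finite sa'.
apply: fsuppD IH.
apply: (@sub_finite_set _ _ ((fun x => odflt x (s x)) @` [set x | xi x != 0])).
  move=> y /=; rewrite cc_act_monomial //; have [sI _ _] := psg_homeo Ss.
  case E : (pinv s y) => [x|]; last by rewrite eqxx.
  rewrite mulf_eq0 negb_or => /andP[_ xi0]; exists x => //.
  by move/(pinvP sI): E => ->.
exact: finite_image.
Qed.

(** The change of variables y = s(x) between the range and the domain of [s]. *)
Lemma fsum_pinv s (k : Y -> Y -> C) : S s ->
  \sum_(y \in [set: Y]) (if pinv s y is Some x then k x y else 0) =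
  \sum_(x \in [set: Y]) (if s x is Some y then k x y else 0).
Proof.
move=> Ss; have [sI _ _] := psg_homeo Ss.
rewrite -(fsbig_widen [set y | pinv s y] setT) //; last first.
  by move=> y [_ /=]; case: (pinv s y) => // x [].
rewrite -[RHS](fsbig_widen [set x | s x] setT) //; last first.
  by move=> y [_ /=]; case: (s y) => // x [].
rewrite [LHS](reindex_fsbig (fun x => odflt x (s x)) [set x | s x]).
  apply: eq_fsbigr => x /set_mem /=; case E : (s x) => [y|//] _ /=.
  by move/(pinvP sI): E => ->.
split.
- by move=> x /=; case E : (s x) => [y|//] _ /=; move/(pinvP sI): E => ->.
- move=> x x' /set_mem /= sx /set_mem /= sx'.
  case E : (s x) sx => [y|//] _; case E' : (s x') sx' => [y'|//] _ /= yy.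
  by apply: (sI _ _ y); rewrite // E' -yy.
- move=> y /=; case E : (pinv s y) => [x|//] _; move/(pinvP sI): E => E.
  by exists x; rewrite /= E.
Qed.

Lemma inner_cc_act Q a xi eta : monomial_span Q a -> fsupp xi -> fsupp eta ->
  inner (cc_act a xi) eta = inner xi (cc_act (cc_star a) eta).
Proof.
move=> sa fx fe; elim: sa => [|s c a' Ss Qc sa' IH].
  rewrite cc_star0 /inner !fsbig1 // => x _; rewrite cc_act0 ?mul0r //.
  by rewrite conjc0 mulr0.
have mf t d : range_finite (mono t d) by exact: monomial_range_finite.
have E1 : cc_act (fun g => mono s c g + a' g) xi =
    (fun y => cc_act (mono s c) xi y + cc_act a' xi y).
  by apply/funext => w; apply: cc_actD; [exact: mf|exact: span_range_finite sa'].
have sS : monomial_span any_fun (cc_star (mono s c)).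
  by apply: (@span_any_star any_fun); exact: span1.
have E2 : cc_act (cc_star (fun g => mono s c g + a' g)) eta =
    (fun y => cc_act (cc_star (mono s c)) eta y + cc_act (cc_star a') eta y).
  apply/funext => w; rewrite cc_starD; apply: cc_actD.
    exact: span_range_finite sS.
  exact: span_range_finite (span_any_star sa').
rewrite E1 E2 innerDl; last 2 first.
- by apply: (@fsupp_cc_act any_fun) => //; exact: span1.
- exact: fsupp_cc_act sa' fx.
rewrite innerDr; last 2 first.
- exact: fsupp_cc_act sS fe.
- exact: fsupp_cc_act (span_any_star sa') fe.
rewrite IH; congr (_ + _); rewrite /inner cc_star_monomial //.
under eq_fsbigr do rewrite cc_act_monomial //.
under [RHS]eq_fsbigr do rewrite (cc_act_monomial _ _ _ (psg_inv Ss)).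
have [sI _ _] := psg_homeo Ss.
have pK : pinv (pinv s) = s by apply: pinv_eq => x y; exact: pinvP.
rewrite pK; transitivity (\sum_(y \in [set: Y])
    if pinv s y is Some x then c x * xi x * conjc (eta y) else 0).
  by apply: eq_fsbigr => y _; case: (pinv s y) => // *; rewrite mul0r.
rewrite (fsum_pinv (fun x y => c x * xi x * conjc (eta y)) Ss) //.
apply: eq_fsbigr => x _; case E : (s x) => [y|]; last by rewrite conjc0 mulr0.
move/(pinvP sI): E => -> /=; rewrite rmorphM /= conjcK; ring.
Qed.

Definition bounded_fun (c : Y -> C) := exists K : R, forall x, rnorm (c x) <= K.

(** Transport along the injective map [s] does not increase norms, and multiplication by [c] scales
    them by at most [K]. *)
Lemma sqnorm_cc_act_monomial s c xi (K : R) : S s -> fsupp xi ->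
  (forall x, rnorm (c x) <= K) ->
  sqnorm (cc_act (mono s c) xi) <= K ^+ 2 * sqnorm xi.
Proof.
move=> Ss fx cK; have [sI _ _] := psg_homeo Ss.
rewrite -lecR rmorphM /= !sqnormE /inner.
under eq_fsbigr do rewrite cc_act_monomial //.
pose k x : C := if s x is Some _ then (c x * xi x) * conjc (c x * xi x) else 0.
have -> : \sum_(y \in [set: Y]) (if pinv s y is Some x then c x * xi x else 0) *
    conjc (if pinv s y is Some x then c x * xi x else 0) = \sum_(x \in [set: Y]) k x.
  rewrite -(fsum_pinv (fun x _ => (c x * xi x) * conjc (c x * xi x)) Ss).
  by apply: eq_fsbigr => y _; case: (pinv s y) => // *; rewrite mul0r.
(* The sums are compared by writing the larger one as the sum of [k] and a nonnegative rest [r],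
   both finitely supported. *)
pose r x : C := ((K ^+ 2)%:C)%C * (xi x * conjc (xi x)) - k x.
have r0 x : 0 <= r x.
  rewrite subr_ge0 /k; case: (s x) => [_|].
    rewrite -!rnorm_sqr -rmorphM lecR rnormM exprMn ler_wpM2r ?sqr_ge0 //.
    by rewrite ler_sqr ?nnegrE ?rnorm_ge0 // (le_trans (rnorm_ge0 (c x))).
  by rewrite -rnorm_sqr -rmorphM lecR mulr_ge0 ?sqr_ge0.
rewrite mulr_fsumr; have -> : \sum_(x \in [set: Y])
    ((K ^+ 2)%:C)%C * (xi x * conjc (xi x)) = \sum_(x \in [set: Y]) (k x + r x).
  by apply: eq_fsbigr => x _; rewrite /r addrC subrK.
have k0 x : xi x = 0 -> k x = 0.
  by move=> x0; rewrite /k x0 mulr0 mul0r; case: (s x).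
rewrite fsumD.
- by rewrite lerDl; exact: fsumr_ge0.
- by apply: sub_finite_set fx => x [_ /=]; apply: contra_neq; exact: k0.
- apply: sub_finite_set fx => x [_ /=]; apply: contra_neq => x0.
  by rewrite /r k0 // x0 mul0r mulr0 subr0.
Qed.

(** This makes the supremum in [opnorm] that of a bounded set. *)
Lemma cc_act_bounded a : monomial_span bounded_fun a -> exists2 K : R, 0 <= K &
  forall xi eta, fsupp xi -> fsupp eta -> sqnorm xi <= 1 -> sqnorm eta <= 1 ->
    rnorm (inner (cc_act a xi) eta) <= K.
Proof.
elim=> [|s c a' Ss [K cK] sa' [K' K'0 IH]].
  exists 0 => // xi eta _ _ _ _; rewrite (_ : cc_act _ _ = fun=> 0).
    by rewrite inner0l rnorm0.
  by apply/funext => y; rewrite cc_act0.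
have sc : monomial_span bounded_fun (mono s c) by apply: span1 => //; exists K.
have K0 : 0 <= `|K| + K' by rewrite addr_ge0.
exists (`|K| + K') => // xi eta fx fe x1 e1.
have -> : cc_act (fun g => mono s c g + a' g) xi =
    (fun y => cc_act (mono s c) xi y + cc_act a' xi y).
  apply/funext => w; apply: cc_actD; first exact: monomial_range_finite.
  exact: span_range_finite sa'.
have fs := fsupp_cc_act sc fx; have fa' := fsupp_cc_act sa' fx.
rewrite innerDl //; apply: le_trans (rnormD _ _) _; apply: lerD; last exact: IH.
rewrite -ler_sqr ?nnegrE ?rnorm_ge0 //; apply: le_trans (cauchy_schwarz fs fe) _.
apply: le_trans (_ : sqnorm (cc_act (mono s c) xi) <= _).
  by rewrite ler_piMr // sqnorm_ge0.
apply: le_trans (sqnorm_cc_act_monomial Ss fx cK) _.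
by rewrite -[`|K| ^+ 2]mulr1 real_normK ?num_real // ler_wpM2l // sqr_ge0.
Qed.

Definition matrix_coefs a : set R := [set r | exists xi eta,
  [/\ fsupp xi, fsupp eta, sqnorm xi <= 1, sqnorm eta <= 1 &
      r = rnorm (inner (cc_act a xi) eta)]].

(** The operator norm is taken through matrix coefficients of finitely supported vectors: this form
    is visibly invariant under adjoints and requires no completed Hilbert space. *)
Definition opnorm a : R := sup (matrix_coefs a).

Lemma sqnorm0 : sqnorm ((fun=> 0) : Y -> C) = 0.
Proof. by rewrite /sqnorm inner0l. Qed.

Lemma matrix_coefs0 a : matrix_coefs a !=set0.
Proof.
exists (rnorm (inner (cc_act a (fun=> 0)) (fun=> 0))), (fun=> 0), (fun=> 0).
by rewrite !sqnorm0; split=> //; exact: fsupp0.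
Qed.

Lemma opnorm_ub a xi eta : monomial_span bounded_fun a ->
  fsupp xi -> fsupp eta -> sqnorm xi <= 1 -> sqnorm eta <= 1 ->
  rnorm (inner (cc_act a xi) eta) <= opnorm a.
Proof.
move=> sa fx fe x1 e1; apply: ub_le_sup; last by exists xi, eta.
have [K _ HK] := cc_act_bounded sa.
by exists K => _ [xi' [eta' [? ? ? ? ->]]]; exact: HK.
Qed.

Lemma opnorm_le a (K : R) :
  (forall xi eta, fsupp xi -> fsupp eta -> sqnorm xi <= 1 -> sqnorm eta <= 1 ->
    rnorm (inner (cc_act a xi) eta) <= K) -> opnorm a <= K.
Proof.
move=> HK; apply: ge_sup; first exact: matrix_coefs0.
by move=> _ [xi' [eta' [? ? ? ? ->]]]; exact: HK.
Qed.

Lemma opnorm_ge0 a : monomial_span bounded_fun a -> 0 <= opnorm a.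
Proof.
move=> sa; apply: le_trans (opnorm_ub sa (fsupp0 _ _) (fsupp0 _ _) _ _).
- exact: rnorm_ge0.
- by rewrite sqnorm0.
- by rewrite sqnorm0.
Qed.

(** Pairing [cc_act a xi] with its own normalization turns the bound on matrix coefficients into a
    bound on vectors. *)
Lemma sqnorm_cc_act a xi : monomial_span bounded_fun a -> fsupp xi ->
  sqnorm xi <= 1 -> sqnorm (cc_act a xi) <= opnorm a ^+ 2.
Proof.
move=> sa fx x1; set N := sqnorm _; have N0 : 0 <= N := sqnorm_ge0 _.
have [N00|Nn0] := eqVneq N 0; first by rewrite N00 sqr_ge0.
have Np : 0 < N by rewrite lt_def Nn0.
have fa := fsupp_cc_act sa fx.
pose z : C := (((Num.sqrt N)^-1)%:C)%C.
have zN : rnorm z ^+ 2 = N^-1.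
  by rewrite rnorm_real real_normK ?num_real // exprVn sqr_sqrtr.
have := opnorm_ub sa fx (fsuppZ z fa) x1.
rewrite sqnormZ zN mulVf // lexx => /(_ isT).
rewrite innerZr rnormM rnormJ rnorm_inner -/N => H.
have : (rnorm z * N) ^+ 2 <= opnorm a ^+ 2.
  by rewrite ler_sqr ?nnegrE ?opnorm_ge0 // mulr_ge0 // rnorm_ge0.
by rewrite exprMn zN expr2 mulrA mulVf // mul1r.
Qed.

Lemma opnorm_star a : monomial_span bounded_fun a ->
  opnorm (cc_star a) = opnorm a.
Proof.
move=> sa; rewrite /opnorm; congr sup; apply/seteqP.
split=> _ [xi [eta [fx fe x1 e1 ->]]]; exists eta, xi; split=> //.
  by rewrite [in RHS](inner_cc_act sa) // [in RHS]innerC rnormJ.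
by rewrite (inner_cc_act sa) // innerC rnormJ.
Qed.

Lemma bounded_funJ s c : bounded_fun c ->
  bounded_fun (fun y => conjc (c (odflt y (pinv s y)))).
Proof. by move=> [K cK]; exists K => y; rewrite rnormJ. Qed.

Lemma bounded_funM s c d : bounded_fun c -> bounded_fun d ->
  bounded_fun (fun x => c (odflt x (s x)) * d x).
Proof.
move=> [K cK] [L dL]; exists (K * L) => x; rewrite rnormM.
by apply: ler_pM => //; exact: rnorm_ge0.
Qed.

(** The coefficient of a b at (xi, eta) is the inner product of b xi and a^* eta, and Cauchy-Schwarz
    applies. *)
Lemma opnormM a b : monomial_span bounded_fun a -> monomial_span bounded_fun b ->
  opnorm (conv a b) <= opnorm a * opnorm b.
Proof.
move=> sa sb; apply: opnorm_le => xi eta fx fe x1 e1.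
have sas : monomial_span bounded_fun (cc_star a).
  by apply: span_star sa => s c _; exact: bounded_funJ.
have fb := fsupp_cc_act sb fx; have fae := fsupp_cc_act sas fe.
rewrite (cc_act_conv _ sa sb) (inner_cc_act sa) //.
rewrite -ler_sqr ?nnegrE ?rnorm_ge0 //; last by rewrite mulr_ge0 ?opnorm_ge0.
apply: le_trans (cauchy_schwarz fb fae) _; rewrite mulrC exprMn.
apply: ler_pM; rewrite ?sqnorm_ge0 //; last exact: sqnorm_cc_act.
by rewrite -(opnorm_star sa); exact: sqnorm_cc_act.
Qed.

(** The inequality from below holds because the squared norm of a xi is the matrix coefficient of
    a^* a at (xi, xi). *)
Lemma opnormVM a : monomial_span bounded_fun a ->
  opnorm (conv (cc_star a) a) = opnorm a ^+ 2.
Proof.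
move=> sa; have sas : monomial_span bounded_fun (cc_star a).
  by apply: span_star sa => s c _; exact: bounded_funJ.
have saa : monomial_span bounded_fun (conv (cc_star a) a).
  by apply: span_conv => // s c d _; exact: bounded_funM.
apply/eqP; rewrite eq_le; apply/andP; split.
  by apply: le_trans (opnormM sas sa) _; rewrite opnorm_star.
rewrite -[leRHS]sqr_sqrtr ?opnorm_ge0 //.
rewrite ler_sqr ?nnegrE ?opnorm_ge0 ?sqrtr_ge0 //.
apply: opnorm_le => xi eta fx fe x1 e1.
have fa := fsupp_cc_act sa fx.
rewrite -ler_sqr ?nnegrE ?rnorm_ge0 ?sqrtr_ge0 // sqr_sqrtr ?opnorm_ge0 //.
apply: le_trans (cauchy_schwarz fa fe) _.
apply: le_trans (_ : sqnorm (cc_act a xi) <= _).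
  by rewrite ler_piMr // sqnorm_ge0.
rewrite -rnorm_inner (inner_cc_act sa) // -(cc_act_conv _ sas sa).
by rewrite innerC rnormJ; exact: opnorm_ub.
Qed.

Lemma opnormZ z a : monomial_span bounded_fun a ->
  opnorm (fun g => z * a g) = rnorm z * opnorm a.
Proof.
move=> sa.
have actZ w b xi : cc_act (fun g => w * b g : C) xi = (fun y => w * cc_act b xi y).
  by apply/funext => y; exact: cc_actZ.
have le w b : monomial_span bounded_fun b ->
    opnorm (fun g => w * b g) <= rnorm w * opnorm b.
  move=> sb; apply: opnorm_le => xi eta fx fe x1 e1.
  rewrite actZ innerZl rnormM ler_wpM2l ?rnorm_ge0 //; exact: opnorm_ub.
apply/eqP; rewrite eq_le le //=.
have [->|z0] := eqVneq z 0.
  rewrite rnorm0 mul0r; apply: opnorm_ge0; apply: spanZ sa => c [K cK].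
  by exists 0 => x; rewrite mul0r rnorm0.
have sza : monomial_span bounded_fun (fun g => z * a g).
  by apply: spanZ sa => c [K cK]; exists (rnorm z * K) => x; rewrite rnormM
    ler_wpM2l // rnorm_ge0.
(* The reverse inequality is [le] for the scalar z^-1 and the function z a. *)
have := le z^-1 _ sza; rewrite (_ : (fun g => z^-1 * (z * a g)) = a); last first.
  by apply/funext => g; rewrite mulrA mulVf // mul1r.
have zp : 0 < rnorm z.
  by rewrite lt_def rnorm_ge0 andbT; apply: contra_neq z0 => /rnorm0_eq0.
have -> : rnorm z^-1 = (rnorm z)^-1.
  by apply: (mulfI (lt0r_neq0 zp)); rewrite -rnormM divff // divff ?lt0r_neq0 //
    /rnorm normr1.
by rewrite mulrC ler_pdivlMr // mulrC.
Qed.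

Lemma opnormD a b : monomial_span bounded_fun a -> monomial_span bounded_fun b ->
  opnorm (fun g => a g + b g) <= opnorm a + opnorm b.
Proof.
move=> sa sb; apply: opnorm_le => xi eta fx fe x1 e1.
have -> : cc_act (fun g => a g + b g) xi =
    (fun y => cc_act a xi y + cc_act b xi y).
  by apply/funext => w; apply: cc_actD;
    [exact: span_range_finite sa|exact: span_range_finite sb].
have fa := fsupp_cc_act sa fx; have fb := fsupp_cc_act sb fx.
by rewrite innerDl //; apply: le_trans (rnormD _ _) _; apply: lerD;
  exact: opnorm_ub.
Qed.

(** It places [opnorm] among the seminorms whose supremum is the full norm. The inclusion assumed
    here is obtained from [span_cc] for the groupoid K. *)
Lemma opnorm_cstar_seminorm :
  (forall f, cc f -> monomial_span bounded_fun f) -> @cstar_seminorm R G opnorm.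
Proof.
move=> ccS; split.
- by move=> a /ccS; exact: opnorm_ge0.
- by move=> z a /ccS sa; rewrite opnormZ.
- by move=> a b /ccS sa /ccS sb; exact: opnormD.
- by move=> a b /ccS sa /ccS sb; exact: opnormM.
- by move=> a /ccS sa; exact: opnormVM.
Qed.

End monomial_span.

(** * Functions in C_c as sums of monomials *)

(** The near-covering form of compactness is used with the filter of finite lists under inclusion:
    near a point, every list containing a suitable index covers. A list is produced because
    [span_of_cover] recurses on it. *)
Lemma compact_seq_cover (T : topologicalType) (K : set T) (I : choiceType)
    (D : set I) (V : I -> set T) : compact K -> (forall i, D i -> open (V i)) ->
  (forall x, K x -> exists2 i, D i & V i x) ->
  exists l : seq I, (forall i, i \in l -> D i) /\
    forall x, K x -> exists2 i, i \in l & V i x.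
Proof.
move=> /compact_near_coveringP cK Vo KV.
pose F := filter_from [set l : seq I | forall i, i \in l -> D i]
  (fun l => [set l' : seq I | {subset l <= l'} /\ forall i, i \in l' -> D i]).
have FF : Filter F.
  apply: filter_from_filter; first by exists [::].
  move=> l l' lD l'D; exists (l ++ l').
    by move=> i; rewrite mem_cat => /orP[/lD|/l'D].
  by move=> k [kl kD]; split; split=> // i il; apply: kl; rewrite mem_cat il ?orbT.
have [x Kx|l lD Hl] := cK _ F (fun l x => exists2 i, i \in l & V i x) FF.
  have [i Di Vix] := KV x Kx.
  exists (V i, [set l' : seq I | {subset [:: i] <= l'} /\ forall j, j \in l' -> D j]).
    split=> /=; first by apply: open_nbhs_nbhs; split=> //; exact: Vo.
    by exists [:: i] => // j; rewrite inE => /eqP ->.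
  by move=> [y l] [/= Viy [il _]]; exists i => //; apply: il; rewrite inE.
by exists l; split=> //; apply: (Hl l); split.
Qed.

Section cc_of_ssg.
Variables (R : realType) (X : alphabet) (Gam : self_similar_group X).
Local Notation C := R[i].
Local Notation Y := (iword X).
Local Notation S := (ssg_pseudogroup Gam).
Local Notation G := (ssg_groupoid Gam).
Local Notation mono s c := (@monomial R Y S s c : garr G -> C).
Local Notation theta := (@theta Y S).
Implicit Types (s t : Y -> option Y) (c d : Y -> C) (x y : Y) (f a b : garr G -> C)
  (g h : Gam) (u v w : seq X).

Definition contf c := continuous (c : Y -> C^o).

Lemma contfP c : contf c <-> forall x (e : R), 0 < e ->
  exists n, forall y, cylinder (prefix_of x n) y -> rnorm (c x - c y) <= e.
Proof.
split=> [cc x e e0|H x].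
  have /cvgrPdist_le := cc x => /(_ (e%:C)%C); rewrite ltcR => /(_ e0).
  move=> /nbhs_iword[n Hn]; exists n => y /Hn /=.
  by rewrite -rnormE lecR.
suff : forall e : C, 0 < e -> \forall y \near nbhs x, `|(c x : C^o) - c y| <= e.
  by move=> /(@cvgrPdist_le C C^o _ (nbhs x) _ c (c x)).
move=> e e0.
have eE : e = ((complex.Re e)%:C)%C by rewrite RRe_real // ger0_real // ltW.
have [n Hn] : exists n, forall y, cylinder (prefix_of x n) y ->
    rnorm (c x - c y) <= complex.Re e.
  by apply: H; move: e0; rewrite eE ltcR.
have : nbhs x (cylinder (prefix_of x n)).
  apply: open_nbhs_nbhs; split; first exact: cylinder_open.
  by apply/cylinderE; rewrite size_prefix_of.
by apply: filterS => y /Hn; rewrite eE -rnormE lecR.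
Qed.

Lemma contf_const (z : C) : contf (fun=> z).
Proof.
by apply/contfP => x e e0; exists 0%N => y _; rewrite subrr rnorm0 ltW.
Qed.

Lemma contfZ z c : contf c -> contf (fun x => z * c x).
Proof.
move=> /contfP cc; apply/contfP => x e e0.
have z0 : 0 < rnorm z + 1 by rewrite ltr_wpDl // rnorm_ge0.
have [n Hn] := cc x _ (divr_gt0 e0 z0); exists n => y /Hn H.
rewrite -mulrBr rnormM -[e](divfK (lt0r_neq0 z0)) mulrC.
by apply: ler_pM; rewrite ?rnorm_ge0 // lerDl.
Qed.

Lemma cylinder_closed v : closed (cylinder v).
Proof.
rewrite -[cylinder v]setCK; apply: open_closedC; rewrite openE => x nx.
have : nbhs x (cylinder (prefix_of x (size v))).
  apply: open_nbhs_nbhs; split; first exact: cylinder_open.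
  by apply/cylinderE; rewrite size_prefix_of.
apply: filterS => y /cylinderE; rewrite size_prefix_of => yx /cylinderE yv.
by apply: nx; apply/cylinderE; rewrite -yx yv.
Qed.

(** Compactness of X^N turns local thresholds into a global one; boundedness and uniform continuity
    of continuous functions are both instances. *)
Lemma contf_near (P : nat -> Y -> Prop) :
  (forall x, exists n0, forall n y, (n0 <= n)%N ->
     cylinder (prefix_of x n0) y -> P n y) ->
  exists n0, forall n y, (n0 <= n)%N -> P n y.
Proof.
move=> H; have := (compact_near_coveringP _).1 (@iword_compact X) _ \oo P _.
case=> [x _|n0 _ Hn0]; last by exists n0 => n y /Hn0; exact.
have [n0 Hn0] := H x; exists (cylinder (prefix_of x n0), [set n | (n0 <= n)%N]).
  split; last by exists n0.
  apply: open_nbhs_nbhs; split; first exact: cylinder_open.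
  by apply/cylinderE; rewrite size_prefix_of.
by move=> [y n] [/= yx n0n]; exact: Hn0.
Qed.

Lemma contf_bounded c : contf c -> bounded_fun c.
Proof.
move=> /contfP cc; have [|N HN] := @contf_near (fun n y => rnorm (c y) <= n%:R); last first.
  by exists N%:R => x; exact: HN.
move=> x; have [n Hn] := cc x 1 ltr01.
have [m Hm] : exists m : nat, rnorm (c x) + 1 <= m%:R.
  exists (Num.bound (rnorm (c x) + 1)).
  by apply/ltW/archi_boundP; rewrite addr_ge0 ?rnorm_ge0.
exists (n + m)%N => k y nk yx; apply: le_trans (_ : rnorm (c x) + 1 <= _).
  rewrite -[c y](subrKC (c x)); apply: le_trans (rnormD _ _) _.
  rewrite lerD2l rnormB; apply: Hn.
  move/cylinderE: yx; rewrite size_prefix_of => yx; apply/cylinderE.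
  move/(congr1 (take n)): yx; rewrite size_prefix_of !prefix_of_add.
  by rewrite !take_size_cat ?size_prefix_of.
apply: le_trans Hm _; rewrite ler_nat; apply: leq_trans nk; exact: leq_addl.
Qed.

Lemma contf_uniform c x0 (e : R) : contf c -> 0 < e -> exists n0, forall n x,
  (n0 <= n)%N -> rnorm (c x - c (icat (prefix_of x n) x0)) <= e.
Proof.
move=> /contfP cc e0; apply: contf_near => x.
have [n0 Hn0] := cc x (e / 2) (divr_gt0 e0 (ltr0Sn _ 1)).
exists n0 => n y n0n yx; rewrite (splitr e).
have -> : c y - c (icat (prefix_of y n) x0) =
    (c y - c x) + (c x - c (icat (prefix_of y n) x0)) by rewrite addrA subrK.
apply: le_trans (rnormD _ _) _; apply: lerD; first by rewrite rnormB; exact: Hn0.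
apply: Hn0; move/cylinderE: yx => <-; rewrite size_prefix_of -(subnKC n0n).
by rewrite prefix_of_add; apply: (@cylinder_cat X); exists x0.
Qed.

(** A basic set Theta(s,U) is shrunk to a cylinder inside U, on which [s] is again some g_{u,v} by
    [ssg_map_restrict]. Thus the sets of all germs of single maps g_{u,v} already form a basis. *)
Lemma germ_nbhs_basis (ga : garr G) (A : set (garr G)) : nbhs ga A ->
  exists g u v, [/\ size u = size v, theta (ssg_map g u v) ga &
    theta (ssg_map g u v) `<=` A].
Proof.
have [s [x [Ss [sx gaE]]]] := germP ga; rewrite gaE.
move=> /nbhs_germ[W [Wo Wx Wd WA]].
have := Ss; case=> [s0|[g [u [v [uv sE]]]]]; first by exfalso; move: (sx); rewrite s0.
subst s; have [y _ yx] := (ssg_map_dom _ _ _ _).1 sx.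
have [n Hn] := nbhs_iword (open_nbhs_nbhs (conj Wo Wx)).
pose w := prefix_of y n.
have vwx : cylinder (v ++ w) x.
  by exists (idrop n y) => //; rewrite icat_cat icat_drop.
have vwW : cylinder (v ++ w) `<=` W.
  move=> z /cylinderE zE; apply: Hn; apply/cylinderE.
  have xE := (cylinderE _ _).1 vwx; move: zE; rewrite -{2}xE.
  rewrite size_cat size_prefix_of addnC !prefix_of_add size_prefix_of.
  by move/(congr1 (take n)); rewrite !take_size_cat ?size_prefix_of.
have [h hE] := ssg_section g w.
have uvw : size (u ++ ssg_act g w) = size (v ++ w).
  by rewrite !size_cat uv (size_tree_aut _ (ssg_aut g)).
exists h, (u ++ ssg_act g w), (v ++ w); split=> //.
  exists x, (ssg_map_psg h uvw), ((ssg_map_dom _ _ _ _).2 vwx); split=> /=.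
    exact/ssg_map_dom.
  apply/germ_of_eq; split=> //.
  apply: filterS (open_nbhs_nbhs (conj (cylinder_open (v ++ w)) vwx)) => z zvw.
  by rewrite (ssg_map_restrict _ hE).
move=> _ [z [Sz [sz [/ssg_map_dom zvw ->]]]]; apply: WA.
exists z, Ss, ((ssg_map_dom g u v z).2 (cylinder_cat zvw)); split; first exact: vwW.
apply/germ_of_eq; split=> //.
apply: filterS (open_nbhs_nbhs (conj (cylinder_open (v ++ w)) zvw)) => z' z'vw.
exact: ssg_map_restrict.
Qed.

Lemma theta_open s : S s -> open (theta s).
Proof. by move=> Ss; apply: germ_base_open; [|exact: (psg_open_dom Ss)|]. Qed.

Lemma dom_closed s : S s -> closed [set x | s x].
Proof.
case=> [->|[g [u [v [_ ->]]]]].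
  by rewrite (_ : [set _ | _] = set0); [exact: closed0|apply/seteqP; split=> // x].
rewrite (_ : [set _ | _] = cylinder v); first exact: cylinder_closed.
by apply/seteqP; split=> x; case: (ssg_map_dom g u v x).
Qed.

(* Two germs over the same point cannot be separated if one is in the closure of
   a set of germs of a single map that contains the other. *)
Lemma theta_clopen U s (ga : garr G) : open U -> hausdorff_space (subspace U) ->
  S s -> theta s `<=` U -> U ga -> ~ theta s ga -> nbhs ga (~` theta s).
Proof.
move=> Uo Uh Ss sU Uga nga.
have [t [x [St [tx gaE]]]] := germP ga.
have [sx|nsx] := pselect (s x); last first.
  have := closed_openC (dom_closed Ss); rewrite openE => /(_ x nsx) nx.
  rewrite gaE; have : nbhs (germ_of St tx) (@germ_src _ S @^-1` (~` [set x | s x])).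
    by apply: germ_src_continuous; rewrite germ_src_of.
  apply: filterS => g; apply: contra_not => /thetaP[y [Ss' [sy ->]]].
  by rewrite germ_src_of.
apply: contrapT => H; apply: nga.
have <- : (germ_of Ss sx : subspace U) = ga; last exact: theta_of.
have Us : U (germ_of Ss sx) by apply: sU; exact: theta_of.
apply: Uh => A B.
rewrite -(nbhs_subspace_interior (x := germ_of Ss sx)); last by move: Uo; rewrite openE; exact.
rewrite -(nbhs_subspace_interior (x := ga)); last by move: Uo; rewrite openE; exact.
move=> /nbhs_germ[W [Wo Wx Ws WA]]; rewrite {1}gaE => /nbhs_germ[W' [Wo' Wx' Wt WB]].
apply: contrapT => AB; apply: H; rewrite gaE; apply/nbhs_germ.
exists (W `&` W'); split=> //; first exact: openI.
  by move=> z [_ /Wt].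
move=> _ [z [St' [tz [[Wz Wz'] ->]]]] ts; apply: AB.
exists (germ_of St' tz); split; last by apply: WB; exists z, St', tz.
apply: WA; have [z' [Ss' [sz gE]]] := thetaP ts.
exists z', Ss', sz; split=> //.
by move/germ_of_eq: gE => [<- _].
Qed.

(** The source map identifies [theta s] with the domain of [s], which is empty or a cylinder. So
    [theta s] is open, Hausdorff and compact, and continuity on it is continuity of [c]. *)
Lemma cc_monomial s c : S s -> contf c -> cc (mono s c).
Proof.
move=> Ss cc; exists 1%N, (fun=> 1), (fun=> mono s c); split; last first.
  by apply/funext => g; rewrite big_ord1 mul1r.
move=> _; exists (theta s); have so := theta_open Ss.
have inside x (Ss' : S s) (sx : s x) (A : set (garr G)) :
    nbhs (germ_of Ss' sx) A <-> nbhs x [set z | forall sz : s z, A (germ_of Ss' sz)].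
  split=> [/nbhs_germ[W [Wo Wx Ws WA]]|/near_openP[W [Wo Wx WA]]].
    apply: filterS (open_nbhs_nbhs (conj Wo Wx)) => z Wz sz.
    by apply: WA; exact/germ_base_of.
  apply/nbhs_germ; exists (W `&` [set z | s z]); split=> //.
  - by apply: openI => //; exact: (psg_open_dom Ss).
  - move=> _ [z [Sz [sz [[/WA Wz _] ->]]]].
    have := Wz sz; congr A; exact: germ_of_irr.
split=> //.
(* In [subspace (theta s)] the points outside [theta s] are isolated, and pairs involving them have
   to be separated too. Two germs of [s] are separated by their sources. *)
- move=> p q clpq.
  have inU r : theta s r -> nbhs (r : subspace (theta s)) (theta s).
    move=> tr; rewrite -nbhs_subspace_interior; first exact: open_nbhs_nbhs.
    by move: so; rewrite openE; exact.
  have outU r : ~ theta s r -> nbhs (r : subspace (theta s)) [set r].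
    by move=> /nbhs_subspace_out rE; rewrite /nbhs /= -rE => z ->.
  have [Up|nUp] := pselect (theta s p); have [Uq|nUq] := pselect (theta s q); last 3 first.
  - by have [r [tr rq]] := clpq _ _ (inU _ Up) (outU _ nUq); case: nUq; rewrite -rq.
  - by have [r [rp tr]] := clpq _ _ (outU _ nUp) (inU _ Uq); case: nUp; rewrite -rp.
  - by have [r [<- <-]] := clpq _ _ (outU _ nUp) (outU _ nUq).
  have [x [Sx [sx pE]]] := thetaP Up; have [y [Sy [sy qE]]] := thetaP Uq.
  have xy : x = y.
    apply: (@iword_hausdorff X) => A B xA yB.
    have [r [/= rA rB]] : (@germ_src _ S @^-1` A) `&` (@germ_src _ S @^-1` B) !=set0.
      apply: clpq; rewrite -nbhs_subspace_interior.
      - by rewrite pE; apply: germ_src_continuous; rewrite germ_src_of.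
      - by move: so; rewrite openE; exact.
      - by rewrite qE; apply: germ_src_continuous; rewrite germ_src_of.
      - by move: so; rewrite openE; exact.
    by exists (germ_src r).
  by subst y; rewrite pE qE; exact: germ_of_irr.
split.
- rewrite continuous_open_subspace // => g /set_mem /thetaP[x [Sx [sx ->]]] A.
  have E : mono s c (germ_of Sx sx) = c x := monomial_of c Sx sx.
  move=> HA; have {}HA : nbhs (c x : C^o) A by rewrite -E.
  change (nbhs (germ_of Sx sx : garr G) (mono s c @^-1` A)).
  apply: (proj2 (inside x Sx sx (mono s c @^-1` A))).
  have H1 : nbhs x (c @^-1` A) by exact: (cc x A HA).
  apply: (filterS _ H1) => z Az sz.
  have E' : mono s c (germ_of Sx sz) = c z := monomial_of c Sx sz.
  by rewrite /preimage /= E'.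
- by move=> g /monomial_out.
- apply: compact_closedI; last exact: closed_closure.
  pose sec x : garr G := if pselect (s x) is left sx then germ_of Ss sx
    else germ_unit S x.
  have -> : theta s = sec @` [set x | s x].
    apply/seteqP; split=> [g /thetaP[x [Sx [sx ->]]]|_ [x sx <-]].
      exists x => //; rewrite /sec; case: pselect => // sx'.
      by exact: germ_of_irr.
    by rewrite /sec; case: pselect => // sx'; exact: theta_of.
  apply: continuous_compact; last first.
    rewrite -[X in compact X]setTI; apply: compact_closedI (dom_closed Ss).
    exact: iword_compact.
  rewrite continuous_open_subspace; last exact: (psg_open_dom Ss).
  move=> x /set_mem /= sx A; rewrite {1}/sec; case: pselect => // sx'.
  move=> /inside H; move: (psg_near_dom Ss sx); apply: filterS2 H => z Az sz.
  by rewrite /= /sec; case: pselect => // sz'; exact: Az.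
Qed.

Lemma ccD a b : cc a -> cc b -> cc (fun ga => a ga + b ga).
Proof.
move=> [n [z [k [kg ->]]]] [n' [z' [k' [kg' ->]]]].
exists (n + n')%N,
  (fun i => match fintype.split i with inl j => z j | inr j => z' j end),
  (fun i => match fintype.split i with inl j => k j | inr j => k' j end); split.
  by move=> i; case: fintype.split.
apply/funext => ga; rewrite big_split_ord /=; congr (_ + _); apply: eq_bigr => i _.
  by rewrite (unsplitK (inl i)).
by rewrite (unsplitK (inr i)).
Qed.

Lemma cc_span f : @monomial_span R Y S (@iword_hausdorff X)
  (@iword_locally_compact X) contf f -> cc f.
Proof.
elim=> [|s c a Ss cc_c _ IH]; last by apply: ccD IH; exact: cc_monomial.
exists 0%N, (fun=> 0), (fun=> fun=> 0); split; first by case.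
by apply/funext => g; rewrite big_ord0.
Qed.

Local Notation span := (@monomial_span R Y S (@iword_hausdorff X)
  (@iword_locally_compact X)).

(** On the first [theta s] of the list, [f] is a monomial, whose coefficient at [x] is the value of
    [f] at the germ of [s] at [x]. What remains is still continuous on [U], since [theta s] is
    clopen there by [theta_clopen]; this is where [U] has to be Hausdorff. *)
Lemma span_of_cover U (l : seq (Gam * seq X * seq X)) f : open U ->
  hausdorff_space (subspace U) ->
  (forall p, p \in l -> size p.1.2 = size p.2 /\
     theta (ssg_map p.1.1 p.1.2 p.2) `<=` U) ->
  {in U, continuous (f : garr G -> C^o)} ->
  (forall ga, (forall p, p \in l -> ~ theta (ssg_map p.1.1 p.1.2 p.2) ga) ->
     f ga = 0) ->
  span contf f.
Proof.
move=> Uo Uh; elim: l f => [|[[g u] v] l IH] f lU fc f0.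
  rewrite (_ : f = fun=> 0); first exact: span0.
  by apply/funext => ga; apply: f0.
have [/= uv sU] := lU _ (mem_head _ _).
have Ss := ssg_map_psg g uv; set s := ssg_map g u v in sU Ss *.
have fC p : U p -> {for p, continuous (f : garr G -> C^o)}.
  by move=> Up; apply: fc; exact/mem_set.
pose c x := if pselect (s x) is left sx then f (germ_of Ss sx) else 0.
pose f1 ga := if `[< theta s ga >] then 0 else f ga.
have fE : f = (fun ga => mono s c ga + f1 ga).
  apply/funext => ga; rewrite /f1.
  have [/thetaP[x [Sx [sx ->]]]|nga] := pselect (theta s ga).
    rewrite asboolT; last exact: theta_of.
    rewrite monomial_of addr0 /c; case: pselect => // sx'.
    by congr f; exact: germ_of_irr.
  by rewrite asboolF // monomial_out // add0r.
rewrite fE; apply: spanDl => //.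
  (* Off the domain of [s], whose complement is open, the coefficient is locally 0. *)
  move=> x; have [sx|nsx] := pselect (s x); last first.
    have := closed_openC (dom_closed Ss); rewrite openE => /(_ x nsx) nx.
    move=> A; rewrite {1}/c; case: pselect => // _ A0.
    apply: filterS nx => z nz; rewrite /= /c; case: pselect => // _.
    exact: (nbhs_singleton A0).
  move=> A; rewrite {1}/c; case: pselect => // sx' fA.
  have := fC _ (sU _ (theta_of Ss sx')) _ fA.
  move=> /nbhs_germ[W [Wo Wx Ws WA]].
  apply: filterS (open_nbhs_nbhs (conj Wo Wx)) => z Wz.
  rewrite /= /c; case: pselect => // sz; last by have := Ws _ Wz.
  by apply: WA; exact/germ_base_of.
apply: IH.
- by move=> p pl; apply: lU; rewrite inE pl orbT.
- move=> ga /set_mem Uga A; rewrite {1}/f1.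
  have [tga|nga] := pselect (theta s ga).
    rewrite asboolT // => A0.
    have : nbhs ga (theta s) by apply: open_nbhs_nbhs; split=> //; exact: theta_open.
    apply: filterS => ga' th; rewrite /= /f1 asboolT //.
    exact: (nbhs_singleton A0).
  rewrite asboolF // => fA.
  apply: filterS2 (theta_clopen Uo Uh Ss sU Uga nga) (fC _ Uga _ fA) => ga' nga' Aga'.
  by rewrite /= /f1 asboolF.
- move=> ga H; rewrite /f1; case: asboolP => // nga; apply: f0 => p.
  by rewrite inE => /orP[/eqP -> //|/H].
Qed.

(** The support of a generator relative to [U] is compact, hence covered by finitely many sets
    [theta s] inside [U]. *)
Lemma span_cc f : cc f -> span contf f.
Proof.
move=> [n [z [k [kg ->]]]]; apply: span_sum => i _; apply: spanZ => [c|].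
  exact: contfZ.
have [U [Uo Uh [hc h0 hK]]] := kg i.
rewrite continuous_open_subspace // in hc.
have := compact_seq_cover (D := [set p : Gam * seq X * seq X |
  size p.1.2 = size p.2 /\ theta (ssg_map p.1.1 p.1.2 p.2) `<=` U])
  (V := fun p => theta (ssg_map p.1.1 p.1.2 p.2)) hK.
case=> [[[g u] v] [/= uv _]|ga [Uga _]|D [DU KD]].
- by apply: theta_open; exact: ssg_map_psg.
- have [g [u [v [uv tga tU]]]] := germ_nbhs_basis (open_nbhs_nbhs (conj Uo Uga)).
  by exists (g, u, v).
apply: (@span_of_cover U D) => //.
move=> ga H; apply: contrapT => hga.
have Uga : U ga by apply: contrapT => /h0.
have [|p /= pD tp] := KD ga; last exact: (H p).
by split=> //; apply: subset_closure; apply/eqP.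
Qed.

End cc_of_ssg.

(** * Essential freeness *)

Section essential_freeness.
Variables (R : realType) (X : alphabet) (Gam : self_similar_group X).
Hypothesis Gam_fs : finite_state Gam.
Variable mu : probability (borel (iword X)) R.
Hypothesis mu_bernoulli : bernoulli mu.

Lemma negligible_small d (T : measurableType d) (nu : {measure set T -> \bar R})
    (N : set T) :
  (forall e : R, 0 < e -> exists M, [/\ measurable M, N `<=` M & (nu M <= e%:E)%E]) ->
  nu.-negligible N.
Proof.
move=> H; have /choice[M HM] : forall k : nat, exists M,
    [/\ measurable M, N `<=` M & (nu M <= (k.+1%:R^-1)%:E)%E].
  by move=> k; apply: H; rewrite invr_gt0 ltr0n.
exists (\bigcap_k M k); split.
- by apply: bigcap_measurable => // k _; have [] := HM k.
- apply/eqP; rewrite eq_le measure_ge0 andbT.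
  apply/lee_addgt0Pr => e e0; rewrite add0e.
  have [k ke] : exists k : nat, k.+1%:R^-1 <= e.
    have /cvgrPdist_lt /(_ e e0) [k _ Hk] := @cvg_harmonic R.
    exists k; apply/ltW; have := Hk k (leqnn k).
    by rewrite /= sub0r normrN ger0_norm // invr_ge0 ler0n.
  have [Mm NM Mk] := HM k.
  apply: le_trans (le_trans Mk _); last by rewrite lee_fin.
  apply: le_measure; rewrite ?inE //; last exact: bigcap_inf.
  by apply: bigcap_measurable => // j _; have [] := HM j.
- by move=> x Nx k _; have [_ NM _] := HM k; exact: NM.
Qed.

Lemma measure_bigsetU_le d (T : measurableType d) (nu : {measure set T -> \bar R})
    I (r : seq I) (P : pred I) (F : I -> set T) : (forall i, measurable (F i)) ->
  (nu (\big[setU/set0]_(i <- r | P i) F i) <= \sum_(i <- r | P i) nu (F i))%E.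
Proof.
move=> Fm; elim: r => [|i r IH]; first by rewrite !big_nil measure0.
rewrite !big_cons; case: ifP => // _.
have mr : measurable (\big[setU/set0]_(j <- r | P j) F j).
  exact: bigsetU_measurable.
apply: le_trans (leeD2l _ IH).
by apply: measureU2.
Qed.

Lemma cylinder_measurable w : measurable (cylinder w : set (borel (iword X))).
Proof. by apply: sub_sigma_algebra; exact: cylinder_open. Qed.

(** At each level the set is covered by the cylinders of [v ++ w] with [w] bad, whose total measure
    is at most the proportion of bad words. *)
Lemma nontrivial_fix_negligible (g : Gam) v :
  mu.-negligible (icat v @` nontrivial_fix g).
Proof.
apply: negligible_small => e e0.
have [n0 /(_ n0 (leqnn _)) Hn] := nbad_small (ssg_aut g) (Gam_fs g) e0.
pose n := n0.
exists (\big[setU/set0]_(w : n.-tuple X | `[< bad_word (ssg_act g) w >])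
          cylinder (v ++ w)); split.
- by apply: bigsetU_measurable => w _; exact: cylinder_measurable.
- move=> _ [y gy <-]; rewrite -bigcup_seq_cond /=.
  exists (Tuple (introT eqP (size_prefix_of y n))) => /=.
    rewrite mem_index_enum; apply/asboolP; exact: nontrivial_fix_bad.
  rewrite -[X in icat v X](icat_drop y n) -icat_cat.
  by exists (idrop n y).
- apply: (@le_trans _ _ (\sum_(w : n.-tuple X | `[< bad_word (ssg_act g) w >])
      mu (cylinder (v ++ w)))%E).
    apply: measure_bigsetU_le => w; exact: cylinder_measurable.
  rewrite (eq_bigr (fun=> ((#|X|%:R ^- (size v + n))%:E)%E)); last first.
    by move=> w _; rewrite mu_bernoulli size_cat size_tuple.
  rewrite sumEFin lee_fin sumr_const -[_ *+ _]mulr_natl.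
  rewrite ler_pdivrMr; last by rewrite exprn_gt0 // ltr0n (ltnW (alphabet_gt1 X)).
  apply: le_trans Hn _; rewrite ler_pM2l //.
  by apply: ler_weXn2l; [rewrite ler1n (ltnW (alphabet_gt1 X))|exact: leq_addl].
Qed.

Definition nontrivial_germ_fix (s : iword X -> option (iword X)) : set (iword X) :=
  [set x | s x = Some x /\ ~ \forall z \near x, s z = Some z].

(** A fixed point lies in the cylinders of both [u] and [v], which forces u = v; then the tail of
    the point is a nontrivial fixed point of [g]. *)
Lemma nontrivial_germ_fix_negligible (g : Gam) u v : size u = size v ->
  mu.-negligible (nontrivial_germ_fix (ssg_map g u v)).
Proof.
move=> uv; apply: negligibleS (nontrivial_fix_negligible g v).
move=> x [/ssg_mapP[y [xv xu]] nx]; subst x.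
have uv' : u = v.
  have := congr1 (fun z => prefix_of z (size v)) xu.
  by rewrite prefix_of_icat0 -uv prefix_of_icat0.
subst u; move/(congr1 (idrop (size v))): xu; rewrite !idrop_icat => gy.
exists y => //; split=> // H; apply: nx.
have [n Hn] := nbhs_iword H.
have : nbhs (icat v y) (cylinder (v ++ prefix_of y n)).
  apply: open_nbhs_nbhs; split; first exact: cylinder_open.
  by exists (idrop n y) => //; rewrite icat_cat icat_drop.
apply: filterS => _ [z _ <-]; rewrite icat_cat ssg_map_icat.
by rewrite Hn //; exists z.
Qed.

(** The null sets are indexed by words alone: for each [v] one map on the cylinder of [v] with all
    its germs in [U] is chosen. Nothing is lost, because a bisection contains at most one germ at
    each point. *)
Lemma bernoulli_essentially_free : @essentially_free (ssg_groupoid Gam) R mu.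
Proof.
move=> U [Uo _ [_ [sec _ secK]]].
have srcI g h : U g -> U h -> germ_src g = germ_src h -> g = h.
  by move=> Ug Uh e; rewrite -(secK g Ug) -(secK h Uh); congr sec.
pose P (v : seq X) (p : Gam * seq X) := size p.2 = size v /\
  @theta _ (ssg_pseudogroup Gam) (ssg_map p.1 p.2 v) `<=` U.
pose N (v : seq X) : set (iword X) := if pselect (exists p, P v p) is left h then
  nontrivial_germ_fix (ssg_map (projT1 (cid h)).1 (projT1 (cid h)).2 v) else set0.
have Nn v : mu.-negligible (N v).
  rewrite /N; case: pselect => [h|_]; last exact: negligible_set0.
  by case: (cid h) => -[g u] [/= uv _]; exact: nontrivial_germ_fix_negligible.
(* Words are countable, so the union is taken over their codes; numbers that code no word give the
   empty set. *)
pose M (k : nat) : set (iword X) := if unpickle k is Some v then N v else set0.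
have Mn : mu.-negligible (\bigcup_k M k).
  apply: negligible_bigcup => k; rewrite /M; case: unpickle => [v|] //.
  exact: negligible_set0.
suff sub : @gsrc (ssg_groupoid Gam) @` ((U `&` isotropy (G := ssg_groupoid Gam))
    `\` units (G := ssg_groupoid Gam)) `<=` \bigcup_k M k.
  apply/eqP; rewrite eq_le; apply/andP; split.
    apply: ub_ereal_sup => _ [B [mB BS _] <-].
    by rewrite (measure_negligible mB (negligibleS (subset_trans BS sub) Mn)).
  apply: ereal_sup_ubound; exists set0; rewrite ?measure0 //.
  by split; [exact: measurable0|exact: sub0set|rewrite measure0 ltry].
move=> _ [ga [[Uga iso] nu] <-].
have [g [u [v [uv tga tU]]]] := germ_nbhs_basis (open_nbhs_nbhs (conj Uo Uga)).
have [x [Ss [sx gaE]]] := thetaP tga; have vx := (ssg_map_dom _ _ _ _).1 sx.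
have Pv : exists p, P v p by exists (g, u).
exists (pickle v) => //; rewrite /M pickleK /N; case: pselect => // H.
case: (cid H) => -[g' u'] [/= uv' HU].
have sx' := (ssg_map_dom g' u' v x).2 vx.
have Ss' := ssg_map_psg g' uv'.
(* The chosen map for [v] may differ from the one found around [ga], but both have a germ in [U] at
   the same source. *)
have gaE' : ga = germ_of Ss' sx'.
  apply: srcI => //; first by apply: HU; exact: theta_of.
  by rewrite gaE !germ_src_of.
have iso' : germ_rng ga = germ_src ga := iso.
change (nontrivial_germ_fix (ssg_map g' u' v) (germ_src ga)).
rewrite {1}gaE' germ_src_of.
have [z sxz] : exists z, ssg_map g' u' v x = Some z.
  by move: (sx'); case: ssg_map => // z _; exists z.
split.
  by move: iso'; rewrite gaE' (germ_rng_of _ _ sxz) germ_src_of sxz => ->.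
by move=> H1; apply: nu; exists x => //; rewrite gaE'; apply/germ_unit_of.
Qed.

End essential_freeness.

(** * Norm estimates and a dense subspace *)

Section span_contf.
Variables (R : realType) (X : alphabet).
Local Notation C := R[i].
Local Notation Y := (iword X).
Implicit Types (c d : Y -> C) (x y : Y).

Lemma contfD c d : contf c -> contf d -> contf (fun x => c x + d x).
Proof.
move=> /contfP cc /contfP cd; apply/contfP => x e e0.
have [n Hn] := cc x _ (divr_gt0 e0 (ltr0Sn _ 1)).
have [m Hm] := cd x _ (divr_gt0 e0 (ltr0Sn _ 1)).
have pre k l y : cylinder (prefix_of x (k + l)) y -> cylinder (prefix_of x k) y.
  by rewrite prefix_of_add; exact: cylinder_cat.
exists (n + m)%N => y xy; rewrite opprD addrACA (splitr e).
apply: le_trans (rnormD _ _) _; apply: lerD; first by apply: Hn; exact: pre xy.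
by apply: Hm; move: xy; rewrite addnC; exact: pre.
Qed.

Lemma contf_comp (f : R -> R) (r : Y -> R) : continuous f ->
  contf (fun x => ((r x)%:C)%C) -> contf (fun x => ((f (r x))%:C)%C).
Proof.
move=> cf /contfP cr; apply/contfP => x e e0.
have /cvgrPdist_le/(_ e e0)/nbhs_ballP[d d0 Hd] := cf (r x).
have [n Hn] := cr x _ (divr_gt0 d0 (ltr0Sn _ 1)); exists n => y /Hn.
rewrite -!rmorphB /= !rnorm_real => H; apply: Hd; rewrite /ball /=.
by apply: le_lt_trans H _; rewrite ltr_pdivrMr // mulr_natr mulr2n ltrDl.
Qed.

Lemma contf_sqr_rnorm c : contf c -> contf (fun x => ((rnorm (c x) ^+ 2)%:C)%C).
Proof.
move=> /contfP cc; apply: (@contf_comp (fun t => t ^+ 2)).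
  exact: exprn_continuous.
apply/contfP => x e e0; have [n Hn] := cc x e e0; exists n => y /Hn H.
rewrite -rmorphB /= rnorm_real ler_norml; apply/andP; split.
  rewrite lerNl opprB lerBlDl; apply: le_trans (_ : _ <= rnorm (c x) + rnorm (c x - c y)) _.
    by rewrite rnormB -{1}[c y](subrKC (c x)) rnormD.
  by rewrite lerD2l.
rewrite lerBlDl; apply: le_trans (_ : _ <= rnorm (c y) + rnorm (c x - c y)) _.
  by rewrite -{1}[c x](subrKC (c y)) rnormD.
by rewrite lerD2l.
Qed.

Lemma contf_step c (x0 : Y) n : contf (fun x => c (icat (prefix_of x n) x0)).
Proof.
apply/contfP => x e e0; exists n => y /cylinderE; rewrite size_prefix_of => ->.
by rewrite subrr rnorm0 ltW.
Qed.

End span_contf.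

Section cstar_algebra_theory.
Variables (R : realType) (A : cstar_algebra R).
Implicit Types a b : A.
Local Notation C := R[i].

Lemma rnorm_cmul a b : rnorm (cmul a b) <= rnorm a * rnorm b.
Proof. by rewrite -lecR rmorphM /= !rnormE cnormM. Qed.

Lemma rnorm_cstarV a : rnorm (cmul (cstar a) a) = rnorm a ^+ 2.
Proof. by apply: complexI; rewrite rmorphXn /= !rnormE cnormVM. Qed.

Lemma rnormZ (V : normedModType C) (z : C) (v : V) : rnorm (z *: v) = rnorm z * rnorm v.
Proof. by apply: complexI; rewrite rmorphM /= !rnormE normrZ. Qed.

(** From |b|^2 = |b^* b| <= |b^*| |b| follows |b| <= |b^*|; the involution gives the converse. *)
Lemma rnorm_cstar a : rnorm (cstar a) = rnorm a.
Proof.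
have le b : rnorm b <= rnorm (cstar b).
  have := rnorm_cmul (cstar b) b; rewrite rnorm_cstarV expr2.
  have [b0|b0] := eqVneq (rnorm b) 0; first by rewrite b0 rnorm_ge0.
  by rewrite ler_pM2r // lt_def b0 rnorm_ge0.
by apply/eqP; rewrite eq_le le -{2}[a]cstarK le.
Qed.

Lemma cmulDl a a' b : cmul (a + a') b = cmul a b + cmul a' b.
Proof. by have := cmul_linearl b 1 a a'; rewrite !scale1r. Qed.

Lemma cmulDr a b b' : cmul a (b + b') = cmul a b + cmul a b'.
Proof. by have := cmul_linearr a 1 b b'; rewrite !scale1r. Qed.

Lemma cmul0l b : cmul 0 b = 0.
Proof. by apply: (addrI (cmul 0 b)); rewrite -cmulDl !addr0. Qed.

Lemma cmul0r a : cmul a 0 = 0.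
Proof. by apply: (addrI (cmul a 0)); rewrite -cmulDr !addr0. Qed.

Lemma cmulZl z a b : cmul (z *: a) b = z *: cmul a b.
Proof. by have := cmul_linearl b z a 0; rewrite !addr0 cmul0l addr0. Qed.

Lemma cmulZr z a b : cmul a (z *: b) = z *: cmul a b.
Proof. by have := cmul_linearr a z b 0; rewrite !addr0 cmul0r addr0. Qed.

Lemma cmulNl a b : cmul (- a) b = - cmul a b.
Proof. by rewrite -scaleN1r cmulZl scaleN1r. Qed.

Lemma cmulNr a b : cmul a (- b) = - cmul a b.
Proof. by rewrite -scaleN1r cmulZr scaleN1r. Qed.

Lemma cmulBl a a' b : cmul (a - a') b = cmul a b - cmul a' b.
Proof. by rewrite cmulDl cmulNl. Qed.

Lemma cmulBr a b b' : cmul a (b - b') = cmul a b - cmul a b'.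
Proof. by rewrite cmulDr cmulNr. Qed.

Lemma cstarD a b : cstar (a + b) = cstar a + cstar b.
Proof. by have := cstar_linear 1 a b; rewrite conjc1 !scale1r. Qed.

Lemma cstar0 : cstar (0 : A) = 0.
Proof. by apply: (addrI (cstar 0)); rewrite -cstarD !addr0. Qed.

Lemma cstarZ z a : cstar (z *: a) = conjc z *: cstar a.
Proof. by have := cstar_linear z a 0; rewrite cstar0 !addr0. Qed.

Lemma cstarB a b : cstar (a - b) = cstar a - cstar b.
Proof.
by rewrite -[- b]scaleN1r cstarD cstarZ rmorphN1 scaleN1r.
Qed.

End cstar_algebra_theory.

Section full_cstar_algebra.
Variables (R : realType) (X : alphabet) (Gam : self_similar_group X).
Local Notation C := R[i].
Local Notation Y := (iword X).
Local Notation S := (ssg_pseudogroup Gam).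
Local Notation G := (ssg_groupoid Gam).
Local Notation mono s c := (@monomial R Y S s c : garr G -> C).
Local Notation span := (@monomial_span R Y S (@iword_hausdorff X)
  (@iword_locally_compact X)).
Variables (A : cstar_algebra R) (iota : (garr G -> C) -> A).
Hypothesis iotaP : is_full_cstar_algebra iota.
Implicit Types (s t : Y -> option Y) (c d : Y -> C) (x y : Y) (f : garr G -> C)
  (g h : Gam) (u v w : seq X).

Lemma cc0 : cc ((fun=> 0) : garr G -> C).
Proof. by apply: cc_span; exact: span0. Qed.

Lemma iotaD f f' : cc f -> cc f' ->
  iota (fun ga => f ga + f' ga) = iota f + iota f'.
Proof.
move=> cf cf'; have := full_linear iotaP 1 cf cf'; rewrite scale1r => <-.
by congr iota; apply/funext => ga; rewrite mul1r.
Qed.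

Lemma iota0 : iota (fun=> 0) = 0.
Proof.
apply: (addrI (iota (fun=> 0))); rewrite addr0 -iotaD; [|exact: cc0|exact: cc0].
by congr iota; apply/funext => ga; rewrite addr0.
Qed.

Lemma iotaZ z f : cc f -> iota (fun ga => z * f ga) = z *: iota f.
Proof.
move=> cf; have := full_linear iotaP z cf cc0; rewrite iota0 addr0 => <-.
by congr iota; apply/funext => ga; rewrite addr0.
Qed.

Lemma iota_sum I (r : seq I) (F : I -> garr G -> C) : (forall i, cc (F i)) ->
  iota (fun ga => \sum_(i <- r) F i ga) = \sum_(i <- r) iota (F i).
Proof.
move=> ccF; elim: r => [|i r IH].
  by rewrite big_nil -iota0; congr iota; apply/funext => ga; rewrite big_nil.
rewrite big_cons -IH -iotaD //.
  by congr iota; apply/funext => ga; rewrite big_cons.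
by apply: cc_span; apply: span_sum => j _; exact: span_cc.
Qed.

Lemma cc_monomial1 s : S s -> cc (mono s (fun=> 1)).
Proof. by move=> Ss; apply: cc_monomial => //; exact: contf_const. Qed.

Lemma conv_monomial1 s t : S s -> S t ->
  conv (mono t (fun=> 1)) (mono s (fun=> 1)) = mono (pcomp t s) (fun=> 1).
Proof.
move=> Ss St; rewrite conv_monomial //; congr (@monomial R Y S).
by apply/funext => x; rewrite mulr1.
Qed.

Lemma cc_star_monomial1 s : S s ->
  cc_star (mono s (fun=> 1)) = mono (pinv s) (fun=> 1).
Proof.
move=> Ss; rewrite cc_star_monomial //; congr (@monomial R Y S).
by apply/funext => x; rewrite conjc1.
Qed.

(** The partial isometry of C*(K) attached to [s]. *)
Definition germ_isometry s : A := iota (mono s (fun=> 1)).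

Lemma germ_isometryM s t : S s -> S t ->
  cmul (germ_isometry t) (germ_isometry s) = germ_isometry (pcomp t s).
Proof.
move=> Ss St; rewrite /germ_isometry -(full_mul iotaP) ?conv_monomial1 //; exact: cc_monomial1.
Qed.

Lemma cstar_germ_isometry s : S s -> cstar (germ_isometry s) = germ_isometry (pinv s).
Proof.
move=> Ss; rewrite /germ_isometry -(full_star iotaP) ?cc_star_monomial1 //; exact: cc_monomial1.
Qed.

Lemma pcomp_pinv s : S s ->
  pcomp (pinv s) s = (fun x => if s x is Some _ then Some x else None).
Proof.
move=> /psg_homeo[sI _ _]; apply/funext => x; rewrite /pcomp.
by case E : (s x) => [y|//] /=; apply/pinvP.
Qed.

(** The element s^* s is a projection p, and |p|^2 = |p^* p| = |p| forces |p| <= 1. *)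
Lemma rnorm_germ_isometry s : S s -> rnorm (germ_isometry s) <= 1.
Proof.
move=> Ss; pose p := pcomp (pinv s) s; have Sp : S p.
  by apply: psg_comp => //; exact: psg_inv.
have pp : pcomp p p = p.
  by rewrite /p pcomp_pinv //; apply/funext => x; rewrite /pcomp; case E : (s x) => //=;
    rewrite E.
have pV : pinv p = p.
  by apply: pinv_eq => x y; rewrite /p pcomp_pinv //; split;
    [case E : (s x) => //= -[<-]|case E : (s y) => //= -[<-]]; rewrite E.
have sp : rnorm (germ_isometry s) ^+ 2 = rnorm (germ_isometry p).
  by rewrite -rnorm_cstarV cstar_germ_isometry // germ_isometryM //; exact: psg_inv.
have : rnorm (germ_isometry p) ^+ 2 = rnorm (germ_isometry p).
  by rewrite -rnorm_cstarV cstar_germ_isometry // pV germ_isometryM // pp.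
have := rnorm_ge0 (germ_isometry p); have := rnorm_ge0 (germ_isometry s); rewrite -sp.
move: (rnorm _) => r r0 _ H; have [//|r1] := leP r 1.
have : r ^+ 2 < (r ^+ 2) ^+ 2 by rewrite ltr_eXnr // exprn_egt1.
by rewrite H ltxx.
Qed.

Lemma psg_some : S Some.
Proof.
right; exists 1%g, [::], [::]; split=> //; apply/funext => x.
have := ssg_map_icat (1%g : Gam) [::] [::] x; rewrite iaut1.
have -> : icat [::] x = x by apply/funext => n; rewrite /icat /= subn0.
by [].
Qed.

Lemma conv_mult c d : conv (mono Some c) (mono Some d) = mono Some (fun x => c x * d x).
Proof. by rewrite conv_monomial //; exact: psg_some. Qed.

Lemma cc_star_mult c : cc_star (mono Some c) = mono Some (fun x => conjc (c x)).
Proof.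
rewrite cc_star_monomial; last exact: psg_some.
have -> : pinv Some = Some :> (Y -> option Y).
  by apply: pinv_eq => x y; split=> -[->].
by [].
Qed.

(* [r] is the real part of the unitary function [r + i sqrt (1 - r ^ 2)]. *)
Lemma rnorm_mult_real (r : Y -> R) : contf (fun x => ((r x)%:C)%C) ->
  (forall x, `|r x| <= 1) -> rnorm (iota (mono Some (fun x => ((r x)%:C)%C))) <= 1.
Proof.
move=> cr r1; pose f (t : R) := Num.sqrt (1 - t ^+ 2).
have cf : continuous f.
  move=> t; apply: (@continuous_comp _ _ _ (fun t : R => 1 - t ^+ 2) Num.sqrt).
    apply: cvgB; first exact: cvg_cst.
    exact: exprn_continuous.
  exact: sqrt_continuous.
have cfr := contf_comp cf cr.
(* With [z] equal to i or -i the function [q z] is unitary, and [r] is the mean of these two. *)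
pose q (z : C) x : C := ((r x)%:C)%C + z * ((f (r x))%:C)%C.
have cq z : contf (q z) := contfD cr (contfZ (z := z) cfr).
have ccq z : cc (mono Some (q z)) := cc_monomial psg_some (cq z).
have qC z x : conjc (q z x) = q (conjc z) x.
  by rewrite /q rmorphD rmorphM; congr (_ + _ * _); exact: conjc_real.
have qJ z x : conjc z = - z -> z ^+ 2 = -1 -> conjc (q z x) * q z x = 1.
  move=> zJ z2; rewrite qC zJ /q.
  have -> : forall a b : C, (a + - z * b) * (a + z * b) = a ^+ 2 - z ^+ 2 * b ^+ 2.
    by move=> a b; ring.
  rewrite z2 mulN1r opprK -!rmorphXn -rmorphD /= sqr_sqrtr ?subrKC //.
  rewrite subr_ge0 -[leRHS](expr1n _ 2) -(real_normK (num_real (r x))).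
  by rewrite ler_sqr ?nnegrE.
have Nq z : conjc z = - z -> z ^+ 2 = -1 -> rnorm (iota (mono Some (q z))) <= 1.
  move=> zJ z2; rewrite -(@ler_sqr _ _ 1) ?nnegrE ?rnorm_ge0 // expr1n.
  have cqJ : cc (cc_star (mono Some (q z))).
    rewrite cc_star_mult; have := ccq (- z); congr (cc (mono Some _)).
    by apply/funext => x; rewrite qC zJ.
  rewrite -rnorm_cstarV -(full_star iotaP) // -(full_mul iotaP) //.
  rewrite cc_star_mult conv_mult; apply: le_trans (rnorm_germ_isometry psg_some).
  by rewrite /germ_isometry; under eq_fun do rewrite qJ //.
have iJ : conjc ('i%C : C) = - 'i%C.
  by apply/eqP; rewrite eq_complex /= oppr0 !eqxx.
have i2 : ('i%C : C) ^+ 2 = -1 := sqr_i R.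
pose z2 : C := 2^-1.
have -> : (fun x => ((r x)%:C)%C) = (fun x => z2 * q 'i%C x + z2 * q (- 'i%C) x).
  by apply/funext => x; rewrite -mulrDr /q mulNr addrACA subrr addr0 -mulr2n
    -mulr_natl mulrA mulVf ?mul1r // pnatr_eq0.
have -> : mono Some (fun x => z2 * q 'i%C x + z2 * q (- 'i%C) x) =
   (fun ga => z2 * mono Some (q 'i%C) ga + z2 * mono Some (q (- 'i%C)) ga).
  by apply/funext => ga; rewrite /monomial; case: asboolP; rewrite // !mulr0 addr0.
have ccZ z : cc (fun ga => z2 * mono Some (q z) ga).
  rewrite monomialZ; apply: cc_monomial; first exact: psg_some.
  exact: (contfZ (z := z2) (cq z)).
rewrite iotaD // !iotaZ //; apply: le_trans (rnormD _ _) _; rewrite !rnormZ -mulrDr.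
have z20 : rnorm z2 = 2^-1.
  by rewrite /z2 rnorm_ger0 ?invr_ge0 ?ler0n // -(rmorph_nat (real_complex R)) -fmorphV.
rewrite z20 mulrC ler_pdivrMr // mul1r -[leRHS]/(1 + 1) lerD ?Nq //.
  by rewrite rmorphN; congr (- _); exact: iJ.
by rewrite sqrrN.
Qed.

(** The element is the partial isometry of [s] times multiplication by [c]. By the C*-identity the
    squared norm of the latter is the norm of multiplication by |c|^2, that is, by K^2 times a
    function with values in [0,1]. *)
Lemma rnorm_monomial s c (K : R) : S s -> contf c -> 0 < K ->
  (forall x, rnorm (c x) <= K) -> rnorm (iota (mono s c)) <= K.
Proof.
move=> Ss cc_c K0 cK.
have ccs : cc (mono Some c) := cc_monomial psg_some cc_c.
have -> : mono s c = conv (mono s (fun=> 1)) (mono Some c).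
  rewrite conv_monomial //; last exact: psg_some.
  by congr (@monomial R Y S); apply/funext => x /=; rewrite mul1r.
rewrite (full_mul iotaP) //; last exact: cc_monomial1.
apply: le_trans (rnorm_cmul _ _) _; rewrite -[leRHS]mul1r.
apply: ler_pM; rewrite ?rnorm_ge0 //; first exact: rnorm_germ_isometry.
rewrite -(@ler_sqr _ _ K) ?nnegrE ?rnorm_ge0 ?(ltW K0) //.
have cJ : contf (fun x => conjc (c x)).
  apply/contfP => x e e0; have [n Hn] := (contfP _).1 cc_c x e e0.
  by exists n => y /Hn; rewrite -rmorphB rnormJ.
have ccJ : cc (cc_star (mono Some c)).
  by rewrite cc_star_mult; exact: (cc_monomial psg_some cJ).
rewrite -rnorm_cstarV -(full_star iotaP) // -(full_mul iotaP) //.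
rewrite cc_star_mult conv_mult.
pose r x : R := (K ^+ 2)^-1 * rnorm (c x) ^+ 2.
have K20 : 0 < K ^+ 2 by rewrite exprn_gt0.
have -> : (fun x => conjc (c x) * c x) = (fun x => ((K ^+ 2)%:C)%C * ((r x)%:C)%C).
  apply/funext => x; rewrite -rmorphM /= /r mulrA divff ?mul1r ?lt0r_neq0 //.
  by rewrite rnorm_sqr mulrC.
have cr : contf (fun x => ((r x)%:C)%C).
  have := contfZ (z := (((K ^+ 2)^-1)%:C)%C) (contf_sqr_rnorm cc_c).
  by congr contf; apply/funext => x; rewrite -rmorphM.
rewrite -monomialZ iotaZ; last exact: (cc_monomial psg_some cr).
have K2 := ltW K20; rewrite rnormZ rnorm_real ger0_norm // ler_piMr //.
apply: rnorm_mult_real => // x; rewrite /r ger0_norm ?mulr_ge0 ?invr_ge0 ?rnorm_ge0 //.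
rewrite mulrC ler_pdivrMr // mul1r ler_sqr ?nnegrE ?rnorm_ge0 //; exact: ltW.
Qed.

Definition section_of g w : Gam := projT1 (cid (ssg_section g w)).

Lemma section_ofE g w : ssg_act (section_of g w) = section (ssg_act g) w.
Proof. exact: (projT2 (cid (ssg_section g w))). Qed.

(** The restriction of g_{u,v} to the cylinder of [v ++ w], again in the form of a generator of the
    pseudogroup. *)
Definition restricted_map g u v w : Y -> option Y :=
  ssg_map (section_of g w) (u ++ ssg_act g w) (v ++ w).

Lemma restricted_map_psg g u v w : size u = size v -> S (restricted_map g u v w).
Proof.
by move=> uv; apply: ssg_map_psg; rewrite !size_cat uv (size_tree_aut _ (ssg_aut g)).
Qed.

(** The cylinders of [v ++ w], with [w] of length [m], partition the cylinder of [v], so each germ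
    of g_{u,v} is a germ of exactly one piece. *)
Lemma monomial_restrict g u v c (m : nat) : size u = size v ->
  mono (ssg_map g u v) c =
  (fun ga => \sum_(w : m.-tuple X) mono (restricted_map g u v w) c ga).
Proof.
move=> uv; apply/funext => ga; have Ss := ssg_map_psg g uv.
have E x (sx : ssg_map g u v x) w (sw : restricted_map g u v w x) :
    germ_of (restricted_map_psg g w uv) sw = germ_of Ss sx.
  apply/germ_of_eq; split=> //; have xw := (ssg_map_dom _ _ _ _).1 sw.
  apply: filterS (open_nbhs_nbhs (conj (cylinder_open (v ++ w)) xw)) => z zw.
  exact: (ssg_map_restrict u (section_ofE g w) zw).
have [/thetaP[x [Sx [sx gaE]]]|nga] := pselect (@theta _ S (ssg_map g u v) ga); last first.
  rewrite monomial_out // big1 // => w _; rewrite monomial_out //.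
  apply: contra_not nga => /thetaP[x [Sx [sw ->]]].
  have xw := (ssg_map_dom _ _ _ _).1 sw.
  have sx := (ssg_map_dom g u v x).2 (cylinder_cat xw).
  rewrite (germ_of_irr Sx (restricted_map_psg g w uv) sw sw) (E x sx w sw).
  exact: theta_of.
have [y _ yx] := (ssg_map_dom _ _ _ _).1 sx.
have wm : size (prefix_of y m) == m by rewrite size_prefix_of.
have xw w : size w = m -> cylinder (v ++ w) x -> w = prefix_of y m.
  move=> wm' /cylinderE; rewrite -yx size_cat prefix_of_icat wm' => /eqP.
  by rewrite eqseq_cat // eqxx => /eqP.
have sw : restricted_map g u v (prefix_of y m) x.
  apply/ssg_map_dom; exists (idrop m y) => //.
  by rewrite icat_cat icat_drop.
rewrite (bigD1 (Tuple wm)) //= big1 ?addr0 => [|w nw].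
  rewrite gaE monomial_of (germ_of_irr Sx Ss sx sx) -(E x sx _ sw).
  by rewrite monomial_of.
rewrite monomial_out // => /thetaP[x' [Sx' [sx' gaE']]].
have xx : x = x' by have := gaE; rewrite gaE' => /germ_of_eq[->].
subst x'; case/eqP: nw; apply: val_inj => /=.
by apply: xw; [exact: size_tuple|exact: (ssg_map_dom _ _ _ _).1 sx'].
Qed.

Definition constf c := exists z, c = fun=> z.

Lemma constf_contf c : constf c -> contf c.
Proof. by move=> [z ->]; exact: contf_const. Qed.

Lemma cc_constf f : span constf f -> cc f.
Proof. by move=> sf; apply: cc_span; apply: sub_span sf; exact: constf_contf. Qed.

(** By uniform continuity [c] is close to a function [d] of the first |v| + n0 letters, and [d] is
    constant on each piece of level [n0] of g_{u,v}. *)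
Lemma monomial_approx s c (e : R) : S s -> contf c -> 0 < e ->
  exists2 d, span constf d & rnorm (iota (mono s c) - iota d) <= e.
Proof.
case=> [->|[g [u [v [uv ->]]]]] cc_c e0.
  exists (fun=> 0); first exact: span0.
  rewrite (_ : mono (fun=> None) c = fun=> 0) ?subrr ?rnorm0 ?ltW //.
  by apply/funext => ga; apply: monomial_out => /thetaP[x [? []]].
pose x0 : Y := point; have Ss := ssg_map_psg g uv.
have [n0 Hn0] := contf_uniform x0 cc_c e0.
pose d x := c (icat (prefix_of x (size v + n0)) x0).
have cd : contf d := @contf_step R X c x0 _.
exists (mono (ssg_map g u v) d).
  rewrite (monomial_restrict g d n0 uv); apply: span_sum => w _.
  have -> : mono (restricted_map g u v w) d =
      mono (restricted_map g u v w) (fun=> c (icat (v ++ w) x0)).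
    apply/funext => ga.
    have [/thetaP[x [Sx [sx ->]]]|nga] := pselect (@theta _ S (restricted_map g u v w) ga);
      last by rewrite !monomial_out.
    rewrite !monomial_of /d; congr (c (icat _ _)).
    have /cylinderE := (ssg_map_dom _ _ _ _).1 sx.
    by rewrite size_cat size_tuple.
  apply: span1; first exact: restricted_map_psg.
  by eexists.
have cdN : contf (fun x => (-1) * d x) := contfZ (z := -1) cd.
have cB : contf (fun x => c x + (-1) * d x) := contfD cc_c cdN.
have cms := cc_monomial Ss cc_c; have cmd := cc_monomial Ss cd.
rewrite -scaleN1r -iotaZ // -iotaD //; last by rewrite monomialZ; exact: cc_monomial Ss cdN.
have -> : (fun ga => mono (ssg_map g u v) c ga + -1 * mono (ssg_map g u v) d ga) =
    mono (ssg_map g u v) (fun x => c x + (-1) * d x).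
  by apply/funext => ga; rewrite /monomial; case: asboolP; rewrite // mulr0 addr0.
apply: rnorm_monomial => // x; rewrite mulN1r; apply: Hn0; exact: leq_addl.
Qed.

Lemma cc_approx f (e : R) : cc f -> 0 < e ->
  exists2 d, span constf d & rnorm (iota f - iota d) <= e.
Proof.
move=> /span_cc sf; elim: sf e => [|s c f' Ss cc_c sf' IH] e e0.
  exists (fun=> 0); first exact: span0.
  by rewrite subrr rnorm0 ltW.
have e20 : 0 < e / 2 by rewrite divr_gt0.
have [d sd Hd] := IH _ e20; have [d' sd' Hd'] := monomial_approx Ss cc_c e20.
exists (fun ga => d' ga + d ga); first exact: spanD.
rewrite !iotaD; [|exact: cc_constf|exact: cc_constf|exact: cc_monomial|exact: cc_span].
rewrite opprD addrACA (splitr e); apply: le_trans (rnormD _ _) _.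
exact: lerD.
Qed.

Lemma dense_constf (a : A) (e : R) : 0 < e ->
  exists2 d, span constf d & rnorm (a - iota d) <= e.
Proof.
move=> e0; have e20 : 0 < e / 2 by rewrite divr_gt0.
have e2C : 0 < ((e / 2)%:C)%C :> C by rewrite ltcR.
have [b [+ [f cf fb]]] : (interior (ball a ((e / 2)%:C)%C) `&` (iota @` @cc R G)) !=set0.
  apply: (full_dense iotaP); last exact: open_interior.
  exists a; exact: nbhsx_ballx.
rewrite -{}fb => /interior_subset; rewrite -ball_normE /= -rnormE ltcR => Hf.
have [d sd Hd] := cc_approx cf e20; exists d => //.
rewrite -(subrK (iota f) a) -addrA (splitr e).
by apply: le_trans (rnormD _ _) _; apply: lerD => //; exact: ltW.
Qed.

(** [opnorm] is one of the C*-seminorms whose supremum is the norm of [iota f]. *)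
Lemma inner_le_rnorm f xi eta : cc f -> fsupp xi -> fsupp eta ->
  sqnorm xi <= 1 -> sqnorm eta <= 1 ->
  rnorm (inner (cc_act f xi) eta) <= rnorm (iota f).
Proof.
move=> cf fx fe x1 e1.
have ccB f' : cc f' -> span (@bounded_fun R Y) f'.
  by move=> /span_cc; apply: sub_span => c; exact: contf_bounded.
apply: le_trans (opnorm_ub (ccB _ cf) fx fe x1 e1) _.
have isoE : (rnorm (iota f))%:E = full_norm f := full_isometry iotaP cf.
rewrite -lee_fin isoE.
apply: ereal_sup_ubound; exists (@opnorm R Y S (@iword_hausdorff X)
  (@iword_locally_compact X)) => //.
exact: opnorm_cstar_seminorm.
Qed.

End full_cstar_algebra.

(** * Uniqueness of the trace *)

Section tracial_states.
Variables (R : realType) (A : cstar_algebra R) (tau : A -> R[i]).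
Hypothesis tauP : tracial_state tau.
Local Notation C := R[i].
Implicit Types a b : A.

Lemma trD a b : tau (a + b) = tau a + tau b.
Proof. by case: tauP => H _ _ _; have := H 1 a b; rewrite scale1r mul1r. Qed.

Lemma tr0 : tau 0 = 0.
Proof. by apply: (addrI (tau 0)); rewrite -trD !addr0. Qed.

Lemma trZ z a : tau (z *: a) = z * tau a.
Proof. by case: tauP => H _ _ _; have := H z a 0; rewrite tr0 !addr0. Qed.

Lemma trB a b : tau (a - b) = tau a - tau b.
Proof. by rewrite trD -scaleN1r trZ mulN1r. Qed.

Lemma tr_sum I (r : seq I) (F : I -> A) :
  tau (\sum_(i <- r) F i) = \sum_(i <- r) tau (F i).
Proof. by elim/big_rec2: _ => [|i x y _ <-]; rewrite ?tr0 ?trD. Qed.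

Lemma tr_mulC a b : tau (cmul a b) = tau (cmul b a).
Proof. by case: tauP. Qed.

Lemma tr_ge0 a : 0 <= tau (cmul (cstar a) a).
Proof. by case: tauP. Qed.

Lemma rnorm_le1 a : (`|a| <= 1) = (rnorm a <= 1).
Proof. by rewrite -lecR rnormE. Qed.

Lemma tr_bound a : rnorm (tau a) <= rnorm a.
Proof.
have le1 b : rnorm b <= 1 -> rnorm (tau b) <= 1.
  move=> b1; case: tauP => _ _ H _; rewrite -lee_fin -H.
  by apply: ereal_sup_ubound; exists b => //=; rewrite rnorm_le1.
have [a0|an0] := eqVneq (rnorm a) 0.
  by rewrite (rnorm0_eq0 a0) tr0 !rnorm0.
have ap : 0 < rnorm a by rewrite lt_def an0 rnorm_ge0.
pose z : C := (((rnorm a)^-1)%:C)%C.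
have z0 : rnorm z = (rnorm a)^-1 by rewrite rnorm_real ger0_norm // invr_ge0 ltW.
have := le1 (z *: a); rewrite rnormZ z0 mulVf // lexx => /(_ isT).
by rewrite trZ rnormM z0 mulrC ler_pdivrMr // mul1r.
Qed.

Lemma tr_cauchy_schwarz a b : rnorm (tau (cmul (cstar b) a)) ^+ 2 <=
  complex.Re (tau (cmul (cstar a) a)) * complex.Re (tau (cmul (cstar b) b)).
Proof.
apply: (proj2 (@positive_form_det _ _ _ (tau (cmul (cstar a) b)) _ _ _ _));
  try exact: tr_ge0.
move=> z; have := tr_ge0 (z *: a + b); congr (_ <= _).
by rewrite cstarD cstarZ !cmulDl !cmulDr !cmulZl !cmulZr !trD !trZ; ring.
Qed.

(** States are normalized by their norm, not by the value at a unit. Cauchy-Schwarz against [e]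
    gives |tau(a)|^2 <= tau(e) on the unit ball, so norm 1 forces tau(e) >= 1. *)
Lemma tr_unit e : (forall a, cmul e a = a) -> cstar e = e -> rnorm e <= 1 ->
  tau e = 1.
Proof.
move=> e1 eJ eN; have te0 : 0 <= tau e by have := tr_ge0 e; rewrite eJ e1.
set t := complex.Re (tau e).
have tE : tau e = (t%:C)%C by rewrite RRe_real // ger0_real.
have t0 : 0 <= t by move: te0; rewrite tE ler0c.
have t1 : t <= 1.
  by have := le_trans (tr_bound e) eN; rewrite tE rnorm_real ger0_norm.
have [t1'|t1'] := leP 1 t; first by rewrite tE (@le_anti _ _ t 1) // t1 t1'.
suff : (1 <= (Num.sqrt t)%:E :> \bar R)%E.
  rewrite lee_fin => h; have : 1 ^+ 2 <= Num.sqrt t ^+ 2.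
    by rewrite ler_sqr ?nnegrE ?sqrtr_ge0.
  by rewrite sqr_sqrtr // expr1n leNgt t1'.
case: tauP => _ _ <- _; apply: ub_ereal_sup => _ [a a1 <-].
have {}a1 : rnorm a <= 1 by rewrite -rnorm_le1.
change ((rnorm (tau a))%:E <= (Num.sqrt t)%:E)%E; rewrite lee_fin.
rewrite -ler_sqr ?nnegrE ?rnorm_ge0 ?sqrtr_ge0 // sqr_sqrtr //.
have := tr_cauchy_schwarz a e; rewrite eJ !e1 -/t => h; apply: le_trans h _.
rewrite ler_piMl //; apply: le_trans (ler_norm _) _.
apply: le_trans (Re_le_rnorm _) _; apply: le_trans (tr_bound _) _.
by rewrite rnorm_cstarV expr_le1 // rnorm_ge0.
Qed.

End tracial_states.

Section uniqueness.
Variables (R : realType) (X : alphabet) (Gam : self_similar_group X).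
Hypothesis Gam_fs : finite_state Gam.
Local Notation C := R[i].
Local Notation Y := (iword X).
Local Notation S := (ssg_pseudogroup Gam).
Local Notation G := (ssg_groupoid Gam).
Local Notation mono s c := (@monomial R Y S s c : garr G -> C).
Local Notation span := (@monomial_span R Y S (@iword_hausdorff X)
  (@iword_locally_compact X)).
Variables (A : cstar_algebra R) (iota : (garr G -> C) -> A).
Hypothesis iotaP : is_full_cstar_algebra iota.
Local Notation U s := (@germ_isometry R X Gam A iota s).
Local Notation q := (#|X|%:R : R).
Implicit Types (s t : Y -> option Y) (c d : Y -> C) (x y : Y) (f : garr G -> C)
  (g h : Gam) (u v w : seq X) (a b : A) (tau : A -> C).

Lemma ssg_map_comp_eq g h u v w :
  pcomp (ssg_map g u v) (ssg_map h v w) = ssg_map (g * h)%g u w.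
Proof.
apply/funext => z; rewrite /pcomp.
have [[x _ <-]|nz] := pselect (cylinder w z); last by rewrite !ssg_map_None.
by rewrite !ssg_map_icat /= ssg_map_icat iautM.
Qed.

Lemma ssg_map_comp_neq g h u v v' w : size v = size v' -> v <> v' ->
  pcomp (ssg_map g u v) (ssg_map h v' w) = fun=> None.
Proof.
move=> vv' nv; apply/funext => z; rewrite /pcomp.
have [[x _ <-]|nz] := pselect (cylinder w z); last by rewrite ssg_map_None.
rewrite ssg_map_icat /= ssg_map_None // => /cylinderE.
by rewrite vv' prefix_of_icat0 => v'v; apply: nv.
Qed.

Lemma germ_isometry_none : U (fun=> None) = 0.
Proof.
rewrite /germ_isometry -(iota0 iotaP); congr iota; apply/funext => ga.
by apply: monomial_out => /thetaP[x [? []]].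
Qed.

Lemma ssg_map1 : ssg_map (1%g : Gam) [::] [::] = Some.
Proof.
apply/funext => x; have := ssg_map_icat (1%g : Gam) [::] [::] x; rewrite iaut1.
by have -> : icat [::] x = x by apply/funext => n; rewrite /icat /= subn0.
Qed.

Lemma section_of1 g w : ssg_act g w = w -> ~ bad_word (ssg_act g) w ->
  section_of g w = 1%g.
Proof.
move=> gw nb; apply: ssg_faithful => v; rewrite section_ofE /section.
have -> : ssg_act g (w ++ v) = w ++ v.
  by apply: contrapT => h; apply: nb; split=> //; exists v.
by rewrite drop_size_cat.
Qed.

Lemma unitary_restrict g u v (m : nat) : size u = size v ->
  U (ssg_map g u v) = \sum_(w : m.-tuple X) U (restricted_map g u v w).
Proof.
move=> uv; rewrite /germ_isometry (monomial_restrict g (fun=> 1) m uv).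
apply: iota_sum => // w; apply: cc_monomial1; exact: restricted_map_psg.
Qed.

Lemma unitary_cylinder_sum n :
  \sum_(w : n.-tuple X) U (ssg_map (1%g : Gam) w w) = U Some.
Proof.
rewrite -ssg_map1 (unitary_restrict 1%g n) //; apply: eq_bigr => w _.
rewrite /restricted_map /= ssg_act1 section_of1 ?ssg_act1 //.
by case=> _ [v]; rewrite ssg_act1.
Qed.

Lemma cmul_one a : cmul (U Some) a = a.
Proof.
have Some1 f : span (@constf R X) f -> cmul (U Some) (iota f) = iota f.
  move=> sd; rewrite /germ_isometry -(full_mul iotaP); last 2 first.
  - apply: cc_monomial1; exact: psg_some.
  - exact: cc_constf.
  congr iota; elim: sd => [|s c f' Ss Qc sf IH]; first by rewrite conv0r.
  rewrite convDr; last exact: monomial_range_finite.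
  rewrite IH; suff -> : conv (mono Some (fun=> 1)) (mono s c) = mono s c by [].
  rewrite conv_monomial //; last exact: psg_some.
  have -> : pcomp Some s = s by apply/funext => x; rewrite /pcomp; case: (s x).
  by congr (@monomial R Y S s); apply/funext => x; rewrite mul1r.
apply/eqP; rewrite -subr_eq0; apply/eqP/rnorm0_eq0/eqP.
rewrite eq_le rnorm_ge0 andbT; apply/ler_addgt0Pr => e e0; rewrite add0r.
have [d sd Hd] := dense_constf iotaP a (divr_gt0 e0 (ltr0Sn _ 1)).
have -> : cmul (U Some) a - a = cmul (U Some) (a - iota d) - (a - iota d).
  by rewrite cmulBr Some1 // opprB addrA subrK.
apply: le_trans (rnormD _ _) _; rewrite rnormN (splitr e); apply: lerD => //.
apply: le_trans (rnorm_cmul _ _) _; apply: le_trans Hd.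
by rewrite ler_piMl ?rnorm_ge0 // rnorm_germ_isometry //; exact: psg_some.
Qed.

Section one_trace.
Variable tau : A -> C.
Hypothesis tauP : tracial_state tau.

Lemma tr_one : tau (U Some) = 1.
Proof.
apply: (tr_unit tauP); first exact: cmul_one.
- rewrite cstar_germ_isometry //; last exact: psg_some.
  by congr (U _); apply: pinv_eq => x y; split=> -[->].
- by apply: rnorm_germ_isometry => //; exact: psg_some.
Qed.

(** The product g_{u,v} 1_{v,v} is g_{u,v}, while the product in the opposite order is 0. *)
Lemma tr_off_diagonal g u v : size u = size v -> u <> v ->
  tau (U (ssg_map g u v)) = 0.
Proof.
move=> uv nuv; rewrite -[g]mulg1 -(ssg_map_comp_eq g 1 u v v).
have Sg := ssg_map_psg g uv; have S1 := ssg_map_psg (1%g : Gam) (erefl (size v)).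
rewrite -(germ_isometryM iotaP S1 Sg) (tr_mulC tauP) (germ_isometryM iotaP Sg S1).
rewrite ssg_map_comp_neq ?germ_isometry_none ?(tr0 tauP) //.
by move=> vu; apply: nuv.
Qed.

(** The element g_{u,u} is 1_{u,v} g_{v,u}, and the opposite product is g_{v,v}. *)
Lemma tr_diagonal g u v : size u = size v ->
  tau (U (ssg_map g u u)) = tau (U (ssg_map g v v)).
Proof.
move=> uv; rewrite -{1}[g]mul1g -(ssg_map_comp_eq 1 g u v u).
have Sg := ssg_map_psg g (esym uv); have S1 := ssg_map_psg (1%g : Gam) uv.
rewrite -(germ_isometryM iotaP Sg S1) (tr_mulC tauP) (germ_isometryM iotaP S1 Sg).
by rewrite ssg_map_comp_eq mulg1.
Qed.

(** The |X|^n elements 1_{w,w} of level n have equal traces and their sum is the unit. *)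
Lemma tr_cylinder u : tau (U (ssg_map (1%g : Gam) u u)) = ((q ^- size u)%:C)%C.
Proof.
have := tr_one; rewrite -(unitary_cylinder_sum (size u)) (tr_sum tauP).
rewrite (eq_bigr (fun=> tau (U (ssg_map (1%g : Gam) u u)))); last first.
  by move=> w _; apply: tr_diagonal; rewrite size_tuple.
rewrite sumr_const card_tuple -(mulr_natl (tau _)) natrX => h.
have q0 : (#|X|%:R : C) ^+ size u != 0.
  by rewrite expf_neq0 // pnatr_eq0 -lt0n (ltnW (alphabet_gt1 X)).
apply: (mulfI q0); rewrite h fmorphV rmorphXn /= -(rmorph_nat (real_complex R)).
by rewrite divff // rmorph_nat.
Qed.

(** Cauchy-Schwarz against 1_{u,u}: the two squares on the right are both traces of 1_{u,u}. *)
Lemma tr_germ_bound g u : rnorm (tau (U (ssg_map g u u))) <= q ^- size u.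
Proof.
have q0 : 0 <= q ^- size u by rewrite invr_ge0 exprn_ge0.
have Sg := ssg_map_psg g (erefl (size u)).
have S1 := ssg_map_psg (1%g : Gam) (erefl (size u)).
have := tr_cauchy_schwarz tauP (U (ssg_map g u u)) (U (ssg_map (1%g : Gam) u u)).
have SV := ssg_map_psg g^-1%g (erefl (size u)).
have S1V := ssg_map_psg (1^-1%g : Gam) (erefl (size u)).
rewrite (cstar_germ_isometry iotaP Sg) (cstar_germ_isometry iotaP S1) !ssg_map_inv.
rewrite (germ_isometryM iotaP Sg S1V) (germ_isometryM iotaP Sg SV) (germ_isometryM iotaP S1 S1V).
rewrite !ssg_map_comp_eq invg1 mul1g mulg1 mulVg tr_cylinder /= -expr2.
by rewrite ler_sqr ?nnegrE ?rnorm_ge0.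
Qed.

End one_trace.

Lemma tr_germ_eq tau tau' g u v : tracial_state tau -> tracial_state tau' ->
  size u = size v -> tau (U (ssg_map g u v)) = tau' (U (ssg_map g u v)).
Proof.
move=> tP tP' uv; have [<-|nuv] := pselect (u = v); last first.
  by rewrite !tr_off_diagonal.
apply/eqP; rewrite -subr_eq0; apply/eqP/rnorm0_eq0/eqP.
rewrite eq_le rnorm_ge0 andbT; apply/ler_addgt0Pr => e e0; rewrite add0r.
have [m /(_ m (leqnn _)) Hm] :=
  nbad_small (ssg_aut g) (Gam_fs g) (divr_gt0 e0 (ltr0Sn _ 1)).
rewrite (unitary_restrict g m (erefl _)) (tr_sum tP) (tr_sum tP') -sumrB.
have q1 : 1 <= q by rewrite ler1n (ltnW (alphabet_gt1 X)).
have q0 : 0 < q by apply: lt_le_trans q1.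
apply: le_trans (rnorm_sum _ _ _) _.
(* A word that is not bad is either moved, and both traces vanish, or fixed with trivial section,
   and both are the trace of 1_{uw,uw}. *)
rewrite (bigID (fun w : m.-tuple X => `[< bad_word (ssg_act g) w >])) /=.
rewrite [X in _ + X]big1 ?addr0 => [|w nb]; last first.
  have {}nb : ~ bad_word (ssg_act g) w by move/asboolP: nb.
  have [gw|ngw] := pselect (ssg_act g w = val w).
    rewrite /restricted_map gw section_of1 // !tr_cylinder // subrr rnorm0 //.
  have sz : size (u ++ ssg_act g w) = size (u ++ w).
    by rewrite !size_cat (size_tree_aut _ (ssg_aut g)).
  have ne : u ++ ssg_act g w <> u ++ w.
    by move/eqP; rewrite eqseq_cat // eqxx => /eqP.
  rewrite /restricted_map (tr_off_diagonal tP _ sz ne) (tr_off_diagonal tP' _ sz ne).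
  by rewrite subrr rnorm0.
(* A bad piece costs at most [q ^- m] for each of the two traces; hence the choice of [m] for
   [e / 2]. *)
apply: (@le_trans _ _ (\sum_(w : m.-tuple X | `[< bad_word (ssg_act g) w >])
    (q ^- m + q ^- m))).
  apply: ler_sum => w /asboolP[gw _]; rewrite /restricted_map gw.
  apply: le_trans (rnormD _ _) _; rewrite rnormN.
  have le : q ^- size (u ++ w) <= q ^- m.
    rewrite size_cat size_tuple lef_pV2 ?posrE ?exprn_gt0 //.
    by apply: ler_weXn2l => //; exact: leq_addl.
  by apply: lerD; apply: le_trans le; exact: tr_germ_bound.
rewrite sumr_const -[_ *+ _]mulr_natl -/(nbad (ssg_act g) m) -mulr2n -[_ *+ 2]mulr_natr.
rewrite mulrA -ler_pdivlMr // ler_pdivrMr ?exprn_gt0 //.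
Qed.

Lemma tr_unique tau tau' : tracial_state tau -> tracial_state tau' -> tau = tau'.
Proof.
move=> tP tP'; have eqd f : span (@constf R X) f -> tau (iota f) = tau' (iota f).
  elim=> [|s c f' Ss Qc sf IH]; first by rewrite (iota0 iotaP) (tr0 tP) (tr0 tP').
  have cs : cc (mono s c) by apply: cc_monomial => //; exact: constf_contf.
  rewrite (iotaD iotaP) //; last exact: cc_constf.
  rewrite (trD tP) (trD tP') IH; congr (_ + _); case: Qc => z cE.
  have -> : mono s c = (fun ga => z * mono s (fun=> 1) ga).
    by rewrite monomialZ cE; congr (@monomial R Y S s); apply/funext => x; rewrite mulr1.
  rewrite (iotaZ iotaP); last exact: cc_monomial1.
  rewrite (trZ tP) (trZ tP'); congr (_ * _); rewrite -/(U s).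
  case: Ss => [->|[g [u [v [uv ->]]]]]; last exact: tr_germ_eq.
  by rewrite germ_isometry_none (tr0 tP) (tr0 tP').
apply/funext => a; apply/eqP; rewrite -subr_eq0; apply/eqP/rnorm0_eq0/eqP.
rewrite eq_le rnorm_ge0 andbT; apply/ler_addgt0Pr => e e0; rewrite add0r.
have [d sd Hd] := dense_constf iotaP a (divr_gt0 e0 (ltr0Sn _ 1)).
have -> : tau a - tau' a = tau (a - iota d) - tau' (a - iota d).
  by rewrite (trB tP) (trB tP') eqd // opprB addrA subrK.
apply: le_trans (rnormD _ _) _; rewrite rnormN (splitr e); apply: lerD.
  exact: le_trans (tr_bound tP _) Hd.
exact: le_trans (tr_bound tP' _) Hd.
Qed.

End uniqueness.

(** * Existence of the trace *)

Section fixed_cylinders.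
Variables (R : realType) (X : alphabet) (Gam : self_similar_group X).
Hypothesis Gam_fs : finite_state Gam.
Local Notation Y := (iword X).
Local Notation S := (ssg_pseudogroup Gam).
Local Notation q := (#|X|%:R : R).
Implicit Types (s t : Y -> option Y) (x y z : Y) (g h : Gam) (u v w : seq X).

Definition fixes_cylinder s w := forall z, cylinder w z -> s z = Some z.

Definition nfix n s : nat :=
  #|[pred w : n.-tuple X | `[< fixes_cylinder s w >]]|.

Definition nfix_at x0 n s : nat :=
  #|[pred w : n.-tuple X | s (icat w x0) == Some (icat w x0)]|.

Lemma nfix_le n s : (nfix n s <= #|X| ^ n)%N.
Proof. by rewrite -card_tuple; exact: max_card. Qed.

(** Cylinders inside a fixed cylinder are fixed. Hence the proportion of fixed cylinders is
    nondecreasing in the level, and it converges. *)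
Lemma nfix_mono m n s : (nfix m s * #|X| ^ n <= nfix (m + n) s)%N.
Proof.
rewrite /nfix -card_prefix.
pose F (p : m.-tuple X * n.-tuple X) := [tuple of p.1 ++ p.2].
have FI : injective F.
  move=> [w v] [w' v'] /(congr1 val) /= /eqP.
  rewrite eqseq_cat ?size_tuple // => /andP[/eqP ww' /eqP vv'].
  by congr pair; exact: val_inj.
rewrite -(card_imset _ FI); apply: subset_leq_card.
apply/fintype.subsetP => _ /imsetP[[w v] + ->].
rewrite inE => /asboolP H; rewrite unfold_in; apply/asboolP => z /=.
by move=> /cylinder_cat /H.
Qed.

Lemma nfix_le_at x0 n s : (nfix n s <= nfix_at x0 n s)%N.
Proof.
apply: subset_leq_card; apply/fintype.subsetP => w; rewrite unfold_in => /asboolP H.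
by rewrite unfold_in /= H //; exists x0.
Qed.

(** If the point [w x0] is fixed but its cylinder is not, then u = v and w = v w1, where w1 is a bad
    word of length [m] that determines [w]. *)
Lemma nfix_at_le x0 g u v m : size u = size v ->
  (nfix_at x0 (size v + m) (ssg_map g u v) <=
   nfix (size v + m) (ssg_map g u v) + nbad (ssg_act g) m)%N.
Proof.
move=> uv; set s := ssg_map g u v; set n := (size v + m)%N.
rewrite /nfix_at -(cardID [pred w : n.-tuple X | `[< fixes_cylinder s w >]]).
apply: leq_add.
  by apply: subset_leq_card; apply/fintype.subsetP => w; rewrite inE => /andP[].
have sz (w : n.-tuple X) : size (drop (size v) w) == m.
  by rewrite size_drop size_tuple addKn.
pose W (w : n.-tuple X) := Tuple (sz w).
have fixE (w : n.-tuple X) : s (icat w x0) = Some (icat w x0) -> [/\ u = v,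
    val w = v ++ drop (size v) w &
    ssg_act g (drop (size v) w) = drop (size v) w].
  set w1 := drop _ _; have wE : val w = take (size v) w ++ w1 by rewrite cat_take_drop.
  have st : size (take (size v) w) = size v by rewrite size_takel // size_tuple leq_addr.
  have iE : icat w x0 = icat (take (size v) w) (icat w1 x0) by rewrite -icat_cat -wE.
  move=> fx; have /ssg_map_dom/cylinderE : s (icat w x0) by rewrite fx.
  rewrite iE -{2}st prefix_of_icat0 => vE; rewrite vE in wE iE.
  move: fx; rewrite iE /s ssg_map_icat => -[fx].
  have uvE : u = v.
    have := congr1 (fun z => prefix_of z (size v)) fx.
    by rewrite prefix_of_icat0 -uv prefix_of_icat0.
  split=> //; move: fx; rewrite uvE => /(congr1 (idrop (size v))).
  rewrite !idrop_icat => /(congr1 (fun z => prefix_of z (size w1))).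
  by rewrite prefix_of_iaut ?prefix_of_icat0 //; exact: ssg_aut.
rewrite /nbad -(card_in_imset (f := W)); last first.
  move=> w w'; rewrite !inE => /andP[_ /eqP/fixE[_ wE _]] /andP[_ /eqP/fixE[_ wE' _]].
  by move=> /(congr1 val) /= ww; apply: val_inj; rewrite wE wE' ww.
apply: subset_leq_card; apply/fintype.subsetP => _ /imsetP[w + ->].
rewrite inE => /andP[nw /eqP/fixE[uvE wE gw]]; rewrite unfold_in; apply/asboolP.
split=> //; apply: contrapT => nb; move/negP: nw; apply; rewrite unfold_in; apply/asboolP.
move=> _ [y _ <-]; have -> : icat w y = icat v (icat (drop (size v) w) y).
  by rewrite -icat_cat -wE.
rewrite /s ssg_map_icat uvE iaut_fix_cylinder //.
by move=> w'; apply: contrapT => h; apply: nb; exists w'.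
Qed.

(** Suppose that [s t] fixes the cylinder of [w] pointwise. At levels n >= |v| the word [w] extends
    [v], so [t] maps this cylinder onto that of another word of length [n], and [t s] fixes the
    image since t s t z = t z. Distinct [w] have distinct images. *)
Lemma nfix_comp_le s t : S s -> S t -> exists n0, forall n, (n0 <= n)%N ->
  (nfix n (pcomp s t) <= nfix n (pcomp t s))%N.
Proof.
move=> _; pose x0 : Y := point.
case=> [->|[g [u [v [uv ->]]]]].
  exists 0%N => n _; rewrite /nfix eq_card0 // => w; rewrite unfold_in.
  by apply/asboolP => /(_ (icat w x0)) H; have := H (ex_intro2 _ _ x0 I erefl).
exists (size v) => n vn; have [t' tE] : exists t', t' = ssg_map g u v by eexists.
rewrite -tE.
have sz (w : n.-tuple X) : size (u ++ ssg_act g (drop (size v) w)) == n.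
  by rewrite size_cat (size_tree_aut _ (ssg_aut g)) size_drop size_tuple uv subnKC.
pose W (w : n.-tuple X) := Tuple (sz w).
have pre (w : n.-tuple X) : fixes_cylinder (pcomp s t') w ->
    val w = v ++ drop (size v) w.
  move=> /(_ (icat w x0) (ex_intro2 _ _ x0 I erefl)); rewrite /pcomp tE.
  case E : (ssg_map g u v (icat w x0)) => [y|//] _.
  have /ssg_map_dom/cylinderE : ssg_map g u v (icat w x0) by rewrite E.
  have st : size (take (size v) w) = size v by rewrite size_takel // size_tuple.
  have -> : icat w x0 = icat (take (size v) w) (icat (drop (size v) w) x0).
    by rewrite -icat_cat cat_take_drop.
  by rewrite -{3}st prefix_of_icat0 => vE; rewrite -{1}vE cat_take_drop.
rewrite /nfix -(card_in_imset (f := W)); last first.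
  move=> w w'; rewrite !unfold_in => /asboolP/pre wE /asboolP/pre wE'.
  move=> /(congr1 val) /= /eqP; rewrite eqseq_cat // eqxx /= => /eqP.
  have [gb _ _] := ssg_aut g; move/(bij_inj gb) => ww.
  by apply: val_inj; rewrite wE wE' ww.
apply: subset_leq_card; apply/fintype.subsetP => _ /imsetP[w + ->].
rewrite !unfold_in => /asboolP wg; apply/asboolP => z' [y _ <-] /=.
have wE := pre w wg; set w1 := drop (size v) w in wE *.
have kE := section_ofE g w1; set k := section_of g w1 in kE.
(* The preimage under [t] of the given point of the image cylinder. *)
pose z := icat v (icat w1 (iaut (ssg_act k^-1%g) y)).
have tz : t' z = Some (icat (u ++ ssg_act g w1) y).
  by rewrite tE /z ssg_map_icat (iaut_section _ kE) -iautM mulgV iaut1 icat_cat.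
have := wg z; rewrite /pcomp tz /= => -> //.
by exists (iaut (ssg_act k^-1%g) y) => //; rewrite wE icat_cat.
Qed.

Lemma nfix_comp s t : S s -> S t -> exists n0, forall n, (n0 <= n)%N ->
  nfix n (pcomp s t) = nfix n (pcomp t s).
Proof.
move=> Ss St; have [n H] := nfix_comp_le Ss St; have [m H'] := nfix_comp_le St Ss.
exists (n + m)%N => k nk; apply/eqP; rewrite eqn_leq H ?H' //.
  exact: leq_trans (leq_addl _ _) nk.
exact: leq_trans (leq_addr _ _) nk.
Qed.

Lemma q_gt0 : 0 < q.
Proof. by rewrite ltr0n (ltnW (alphabet_gt1 X)). Qed.

Lemma nfix_cvg s : exists l : R, forall e, 0 < e -> exists n0, forall n,
  (n0 <= n)%N -> `|(nfix n s)%:R / q ^+ n - l| <= e.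
Proof.
pose a n := (nfix n s)%:R / q ^+ n; have q0 := q_gt0.
have a_nd : nondecreasing_seq a.
  apply/nondecreasing_seqP => n; rewrite /a ler_pdivrMr ?exprn_gt0 //.
  have -> : (nfix n.+1 s)%:R / q ^+ n.+1 * q ^+ n = (nfix n.+1 s)%:R / q.
    by rewrite exprS; field; rewrite expf_neq0 ?lt0r_neq0.
  rewrite ler_pdivlMr // -natrM ler_nat -[n.+1]addn1 -[X in (_ * X)%N]expn1.
  exact: nfix_mono.
have a_ub : has_ubound (range a).
  exists 1 => _ [n _ <-]; rewrite /a ler_pdivrMr ?exprn_gt0 // mul1r -natrX.
  by rewrite ler_nat nfix_le.
exists (sup (range a)) => e e0.
have /cvgrPdist_le/(_ e e0)[n0 _ H] := nondecreasing_cvgn a_nd a_ub.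
by exists n0 => n n0n; rewrite distrC; exact: H.
Qed.

(** By [nfix_le_at] and [nfix_at_le] the two counts differ by at most a number of bad words; this is
    where existence uses that [Gam] is finite-state. *)
Lemma nfix_at_nfix x0 s (e : R) : S s -> 0 < e -> exists n0, forall n, (n0 <= n)%N ->
  `|(nfix_at x0 n s)%:R / q ^+ n - (nfix n s)%:R / q ^+ n| <= e.
Proof.
move=> Ss e0; have q0 := q_gt0; case: Ss => [->|[g [u [v [uv ->]]]]].
  exists 0%N => n _; have -> : nfix_at x0 n (fun=> None) = 0%N by apply: eq_card0.
  have := nfix_le_at x0 n (fun=> None).
  have -> : nfix_at x0 n (fun=> None) = 0%N by apply: eq_card0.
  by rewrite leqn0 => /eqP ->; rewrite subrr normr0 ltW.
have [m0 Hm0] := nbad_small (ssg_aut g) (Gam_fs g) e0.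
exists (size v + m0)%N => n vn.
have [m nE] : exists m, n = (size v + m)%N.
  by exists (n - size v)%N; rewrite subnKC // (leq_trans (leq_addr _ _) vn).
subst n; rewrite leq_add2l in vn; rewrite -mulrBl ger0_norm; last first.
  apply: divr_ge0; first by rewrite subr_ge0 ler_nat nfix_le_at.
  by rewrite exprn_ge0 // ltW.
rewrite ler_pdivrMr ?exprn_gt0 //; apply: le_trans (_ : (nbad (ssg_act g) m)%:R <= _).
  by rewrite lerBlDl -natrD ler_nat nfix_at_le.
apply: le_trans (Hm0 _ vn) _; rewrite ler_pM2l // ler_weXn2l ?leq_addl //.
by rewrite ler1n (ltnW (alphabet_gt1 X)).
Qed.

End fixed_cylinders.

Section complex_limits.
Variable R : realType.
Local Notation C := R[i].
Implicit Types (z l : C) (u : nat -> C).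

Definition ctends u l := forall e : R, 0 < e -> exists n0, forall n, (n0 <= n)%N ->
  rnorm (u n - l) <= e.

Lemma ctendsD u u' l l' : ctends u l -> ctends u' l' ->
  ctends (fun n => u n + u' n) (l + l').
Proof.
move=> H H' e e0; have [n Hn] := H _ (divr_gt0 e0 (ltr0Sn _ 1)).
have [m Hm] := H' _ (divr_gt0 e0 (ltr0Sn _ 1)); exists (n + m)%N => k nk.
rewrite opprD addrACA (splitr e); apply: le_trans (rnormD _ _) _; apply: lerD.
  by apply: Hn; exact: leq_trans (leq_addr _ _) nk.
by apply: Hm; exact: leq_trans (leq_addl _ _) nk.
Qed.

Lemma ctendsZ z u l : ctends u l -> ctends (fun n => z * u n) (z * l).
Proof.
move=> H e e0; have z0 : 0 < rnorm z + 1 by rewrite ltr_wpDl // rnorm_ge0.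
have [n Hn] := H _ (divr_gt0 e0 z0); exists n => k /Hn h.
rewrite -mulrBr rnormM -[e](divfK (lt0r_neq0 z0)) mulrC.
by apply: ler_pM; rewrite ?rnorm_ge0 // lerDl.
Qed.

Lemma ctends_cst l : ctends (fun=> l) l.
Proof. by move=> e e0; exists 0%N => n _; rewrite subrr rnorm0 ltW. Qed.

Lemma rnorm_small (V : normedZmodType C) (v : V) :
  (forall e : R, 0 < e -> rnorm v <= e) -> v = 0.
Proof.
move=> H; apply/rnorm0_eq0/eqP; rewrite eq_le rnorm_ge0 andbT.
by apply/ler_addgt0Pr => e e0; rewrite add0r; exact: H.
Qed.

Lemma ctends_unique u l l' : ctends u l -> ctends u l' -> l = l'.
Proof.
move=> H H'; apply/eqP; rewrite -subr_eq0; apply/eqP/rnorm_small => e e0.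
have [n Hn] := H _ (divr_gt0 e0 (ltr0Sn _ 1)).
have [m Hm] := H' _ (divr_gt0 e0 (ltr0Sn _ 1)); pose k := (n + m)%N.
have -> : l - l' = (l - u k) + (u k - l') by rewrite addrA subrK.
rewrite (splitr e); apply: le_trans (rnormD _ _) _; apply: lerD.
  by rewrite rnormB; apply: Hn; exact: leq_addr.
by apply: Hm; exact: leq_addl.
Qed.

Lemma ctends_bound u l (K : R) : ctends u l -> (forall n, rnorm (u n) <= K) ->
  rnorm l <= K.
Proof.
move=> H uK; apply/ler_addgt0Pr => e e0; have [n Hn] := H _ e0.
rewrite -[l](subrKC (u n)); apply: le_trans (rnormD _ _) _; apply: lerD => //.
by rewrite rnormB; exact: Hn.
Qed.

Lemma ge0_closed z : (forall e : R, 0 < e -> exists2 p : C, 0 <= p & rnorm (z - p) <= e) ->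
  0 <= z.
Proof.
move=> H; rewrite lecE /=; apply/andP; split.
  rewrite -normr_eq0 eq_le normr_ge0 andbT; apply/ler_addgt0Pr => e /H[p p0 zp].
  rewrite add0r; apply: le_trans zp; apply: le_trans (Im_le_rnorm _).
  by rewrite raddfB /= (ger0_Im p0) subr0.
apply/ler_addgt0Pr => e /H[p p0 zp].
have pr : 0 <= complex.Re p by move: p0; rewrite lecE => /andP[].
have := le_trans (Re_le_rnorm _) zp; rewrite raddfB /= ler_norml => /andP[h _].
by rewrite -lerBlDr sub0r; apply: le_trans h _; rewrite lerBlDr lerDl.
Qed.

Lemma ctends_ge0 u l : ctends u l -> (forall n, 0 <= u n) -> 0 <= l.
Proof.
move=> H u0; apply: ge0_closed => e /H[n Hn]; exists (u n) => //.
by rewrite rnormB; exact: Hn.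
Qed.

End complex_limits.

Section existence.
Variables (R : realType) (X : alphabet) (Gam : self_similar_group X).
Hypothesis Gam_fs : finite_state Gam.
Local Notation C := R[i].
Local Notation Y := (iword X).
Local Notation S := (ssg_pseudogroup Gam).
Local Notation G := (ssg_groupoid Gam).
Local Notation mono s c := (@monomial R Y S s c : garr G -> C).
Local Notation span := (@monomial_span R Y S (@iword_hausdorff X)
  (@iword_locally_compact X) (@constf R X)).
Variables (A : cstar_algebra R) (iota : (garr G -> C) -> A).
Hypothesis iotaP : is_full_cstar_algebra iota.
Local Notation q := (#|X|%:R : R).
Implicit Types (s t : Y -> option Y) (c d : Y -> C) (x y : Y) (f : garr G -> C)
  (g h : Gam) (u v w : seq X) (a b : A) (tau : A -> C).

Definition delta x : Y -> C := fun y => (y == x)%:R.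

Definition vector_state x f : C := inner (cc_act f (delta x)) (delta x).

Lemma inner_delta (xi : Y -> C) x : inner xi (delta x) = xi x.
Proof.
rewrite /inner (fsum_single (i0 := x)) // /delta ?eqxx ?conjc_nat ?mulr1 //.
by move=> y _ /eqP/negbTE ->; rewrite conjc_nat mulr0.
Qed.

(** A diagonal matrix coefficient tests whether [s] fixes [x], so averaging over words yields the
    count [nfix_at]. *)
Lemma vector_state_monomial x s : S s ->
  vector_state x (mono s (fun=> 1)) = (s x == Some x)%:R.
Proof.
move=> Ss; rewrite /vector_state inner_delta cc_act_monomial //.
have [sI _ _] := psg_homeo Ss; case E : (pinv s x) => [y|].
  rewrite mul1r /delta; move/(pinvP sI): E => syx; congr (nat_of_bool _)%:R.
  apply/idP/idP => [/eqP yx|/eqP sx]; apply/eqP; last exact: sI syx sx.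
  by rewrite -{1}yx.
case: eqP => // sx; have /(pinvP sI) : s x = Some x by [].
by rewrite E.
Qed.

Lemma vector_stateD x f f' : span f -> span f' ->
  vector_state x (fun ga => f ga + f' ga) = vector_state x f + vector_state x f'.
Proof.
move=> sf sf'; rewrite /vector_state !inner_delta cc_actD //.
  exact: span_range_finite sf.
exact: span_range_finite sf'.
Qed.

Lemma vector_stateZ x z f :
  vector_state x (fun ga => z * f ga) = z * vector_state x f.
Proof. by rewrite /vector_state !inner_delta cc_actZ. Qed.

Lemma vector_state_bound x f : cc f -> rnorm (vector_state x f) <= rnorm (iota f).
Proof.
move=> cf; apply: inner_le_rnorm => //; rewrite ?sqnorm_delta //; exact: fsupp_delta.
Qed.

Lemma constfM s c d : constf c -> constf d ->
  constf (fun x => c (odflt x (s x)) * d x).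
Proof. by move=> [z ->] [z' ->]; exists (z * z'). Qed.

Lemma constfJ s c : constf c -> constf (fun y => conjc (c (odflt y (pinv s y)))).
Proof. by move=> [z ->]; exists (conjc z). Qed.

Lemma span_constf_conv f f' : span f -> span f' -> span (conv f f').
Proof. by apply: span_conv => s c d _; exact: constfM. Qed.

Lemma span_constf_star f : span f -> span (cc_star f).
Proof. by apply: span_star => s c _; exact: constfJ. Qed.

Lemma span_constfZ z f : span f -> span (fun ga => z * f ga).
Proof. by apply: spanZ => c [z' ->]; exists (z * z'). Qed.

(** The value is the squared norm of [cc_act f (delta x)]. *)
Lemma vector_state_ge0 x f : span f -> 0 <= vector_state x (conv (cc_star f) f).
Proof.
move=> sf; have sfs := span_constf_star sf; have fd := fsupp_delta R x.
have fa := fsupp_cc_act sf fd.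
have : 0 <= inner (cc_act f (delta x)) (cc_act f (delta x)) := inner_ge0 _.
rewrite (inner_cc_act sf fd fa) -(cc_act_conv _ sfs sf) innerC.
by rewrite conj_ge0.
Qed.

Definition level_mean n f : C :=
  ((q ^- n)%:C)%C * \sum_(w : n.-tuple X) vector_state (icat w point) f.

Lemma level_meanD n f f' : span f -> span f' ->
  level_mean n (fun ga => f ga + f' ga) = level_mean n f + level_mean n f'.
Proof.
move=> sf sf'; rewrite /level_mean -mulrDr -big_split; congr (_ * _).
by apply: eq_bigr => w _; exact: vector_stateD.
Qed.

Lemma level_meanZ n z f : level_mean n (fun ga => z * f ga) = z * level_mean n f.
Proof.
rewrite /level_mean [RHS]mulrCA; congr (_ * _); rewrite mulr_sumr.
by apply: eq_bigr => w _; exact: vector_stateZ.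
Qed.

Lemma level_mean_ge0 n f : span f -> 0 <= level_mean n (conv (cc_star f) f).
Proof.
move=> sf; apply: mulr_ge0.
  by rewrite ler0c invr_ge0 exprn_ge0.
by apply: sumr_ge0 => w _; exact: vector_state_ge0.
Qed.

Lemma level_mean_bound n f : cc f -> rnorm (level_mean n f) <= rnorm (iota f).
Proof.
move=> cf; have q0 : 0 < q ^+ n by rewrite exprn_gt0 // q_gt0.
rewrite /level_mean rnormM rnorm_real ger0_norm ?invr_ge0 ?(ltW q0) //.
rewrite mulrC ler_pdivrMr //; apply: le_trans (rnorm_sum _ _ _) _.
apply: le_trans (_ : \sum_(w : n.-tuple X) rnorm (iota f) <= _).
  by apply: ler_sum => w _; exact: vector_state_bound.
by rewrite sumr_const card_tuple -(mulr_natr (rnorm (iota f))) natrX.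
Qed.

Lemma level_mean_monomial n s : S s -> level_mean n (mono s (fun=> 1)) =
  (((nfix_at point n s)%:R / q ^+ n)%:C)%C.
Proof.
move=> Ss; rewrite /level_mean; under eq_bigr do rewrite vector_state_monomial //.
rewrite -natr_sum mulrC rmorphM /= rmorph_nat; congr (_%:R * _).
rewrite /nfix_at -sum1_card [RHS]big_mkcond /=; apply: eq_bigr => w _.
by rewrite unfold_in /=; case: eqP.
Qed.

Lemma level_mean_cvg_monomial s : S s -> exists l : R,
  ctends (fun n => level_mean n (mono s (fun=> 1))) (l%:C)%C /\
  forall e, 0 < e -> exists n0, forall n, (n0 <= n)%N ->
    `|(nfix n s)%:R / q ^+ n - l| <= e.
Proof.
move=> Ss; have [l Hl] := nfix_cvg R s; exists l; split=> // e e0.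
have [n Hn] := Hl _ (divr_gt0 e0 (ltr0Sn _ 1)).
have [m Hm] := nfix_at_nfix Gam_fs point Ss (divr_gt0 e0 (ltr0Sn _ 1)).
exists (n + m)%N => k nk; rewrite level_mean_monomial // -rmorphB /= rnorm_real.
have -> : (nfix_at point k s)%:R / q ^+ k - l =
  ((nfix_at point k s)%:R / q ^+ k - (nfix k s)%:R / q ^+ k) +
  ((nfix k s)%:R / q ^+ k - l) by rewrite addrA subrK.
apply: le_trans (ler_normD _ _) _; rewrite [leRHS](splitr e); apply: lerD.
  by apply: Hm; exact: leq_trans (leq_addl _ _) nk.
by apply: Hn; exact: leq_trans (leq_addr _ _) nk.
Qed.

Lemma monomial_const s z : mono s (fun=> z) = (fun ga => z * mono s (fun=> 1) ga).
Proof.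
by rewrite monomialZ; congr (@monomial R Y S s); apply/funext => x; rewrite mulr1.
Qed.

Lemma level_mean_cvg f : span f -> exists l, ctends (fun n => level_mean n f) l.
Proof.
elim=> [|s c f' Ss [z ->] sf' [l' Hl']].
  exists 0; have := ctends_cst (0 : C); congr ctends.
  apply/funext => n; rewrite /level_mean big1 ?mulr0 // => w _.
  by rewrite /vector_state inner_delta cc_act0.
have [l [Hl _]] := level_mean_cvg_monomial Ss; exists (z * (l%:C)%C + l').
have := ctendsD (ctendsZ z Hl) Hl'; congr ctends; apply/funext => n.
rewrite level_meanD //; last by apply: span1 => //; exists z.
by rewrite (monomial_const s z) level_meanZ.
Qed.

(** The default 0 stands for divergent means; on the span with constant coefficients the means
    converge. *)
Definition limit_state f : C :=
  if pselect (exists l, ctends (fun n => level_mean n f) l) is left H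
  then projT1 (cid H) else 0.

Lemma limit_stateP f : span f -> ctends (fun n => level_mean n f) (limit_state f).
Proof.
move=> /level_mean_cvg H; rewrite /limit_state; case: pselect => // H'.
by case: (cid H').
Qed.

Lemma limit_stateD f f' : span f -> span f' ->
  limit_state (fun ga => f ga + f' ga) = limit_state f + limit_state f'.
Proof.
move=> sf sf'; apply: ctends_unique (limit_stateP (spanD sf sf')) _.
have := ctendsD (limit_stateP sf) (limit_stateP sf'); congr ctends.
by apply/funext => n; rewrite level_meanD.
Qed.

Lemma limit_stateZ z f : span f ->
  limit_state (fun ga => z * f ga) = z * limit_state f.
Proof.
move=> sf; apply: ctends_unique (limit_stateP (span_constfZ z sf)) _.
have := ctendsZ z (limit_stateP sf); congr ctends.
by apply/funext => n; rewrite level_meanZ.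
Qed.

Lemma limit_state_bound f : span f -> rnorm (limit_state f) <= rnorm (iota f).
Proof.
move=> sf; apply: ctends_bound (limit_stateP sf) _ => n.
by apply: level_mean_bound; exact: cc_constf.
Qed.

Lemma limit_state_ge0 f : span f -> 0 <= limit_state (conv (cc_star f) f).
Proof.
move=> sf; have sff := span_constf_conv (span_constf_star sf) sf.
by apply: ctends_ge0 (limit_stateP sff) _ => n; exact: level_mean_ge0.
Qed.

(** Each side is the limit of the proportion of fixed cylinders, and by [nfix_comp] the two
    proportions coincide at all large levels. *)
Lemma limit_state_monomialC s t : S s -> S t ->
  limit_state (mono (pcomp s t) (fun=> 1)) = limit_state (mono (pcomp t s) (fun=> 1)).
Proof.
move=> Ss St; have Sst := psg_comp St Ss; have Sts := psg_comp Ss St.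
have [l [Hl Fl]] := level_mean_cvg_monomial Sst.
have [l' [Hl' Fl']] := level_mean_cvg_monomial Sts.
have one r : S r -> span (mono r (fun=> 1)) by move=> Sr; apply: span1 => //; exists 1.
rewrite (ctends_unique (limit_stateP (one _ Sst)) Hl).
rewrite (ctends_unique (limit_stateP (one _ Sts)) Hl'); congr (_%:C)%C.
apply/eqP; rewrite -subr_eq0 -normr_eq0 eq_le normr_ge0 andbT.
apply/ler_addgt0Pr => e e0; rewrite add0r.
have [n Hn] := Fl _ (divr_gt0 e0 (ltr0Sn _ 1)).
have [m Hm] := Fl' _ (divr_gt0 e0 (ltr0Sn _ 1)).
have [k Hk] := nfix_comp Ss St; pose j := (n + m + k)%N.
have := Hm j _; have := Hn j _; rewrite Hk ?leq_addl //.
have nj : (n <= j)%N by rewrite /j -addnA leq_addr.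
have mj : (m <= j)%N by rewrite /j addnAC leq_addl.
move=> /(_ nj) h /(_ mj) h'; set r := _ / _ in h h'.
have -> : l - l' = (l - r) + (r - l') by rewrite addrA subrK.
by apply: le_trans (ler_normD _ _) _; rewrite (splitr e) lerD // distrC.
Qed.

Lemma limit_stateC f f' : span f -> span f' ->
  limit_state (conv f f') = limit_state (conv f' f).
Proof.
have rf k : span k -> range_finite k by exact: span_range_finite.
have L0 : limit_state (fun=> 0) = 0.
  have s0 : span (fun=> 0) by exact: span0.
  rewrite -[RHS](mul0r (limit_state (fun=> 0))) -limit_stateZ //.
  by congr limit_state; apply/funext => ga; rewrite mul0r.
move=> sf sf'; elim: sf => [|s c k Ss Qc sk IH]; first by rewrite conv0l conv0r.
have sm : span (mono s c) by exact: span1.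
rewrite convDl; [|exact: rf|exact: rf]; rewrite convDr; last exact: rf.
rewrite !limit_stateD; try exact: span_constf_conv.
rewrite IH; congr (_ + _); elim: sf' => [|t d k' St Qd sk' IH'].
  by rewrite conv0l conv0r.
have sm' : span (mono t d) by exact: span1.
rewrite convDl; [|exact: rf|exact: rf]; rewrite convDr; last exact: rf.
rewrite !limit_stateD; try exact: span_constf_conv.
rewrite IH'; congr (_ + _); rewrite !conv_monomial //.
case: Qc => z ->; case: Qd => z' ->.
have one r : S r -> span (mono r (fun=> 1)) by move=> Sr; apply: span1 => //; exists 1.
have Sst := psg_comp St Ss; have Sts := psg_comp Ss St.
change (limit_state (mono (pcomp s t) (fun=> z * z')) =
  limit_state (mono (pcomp t s) (fun=> z' * z))).
rewrite (monomial_const (pcomp s t)) (monomial_const (pcomp t s)).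
rewrite !limit_stateZ; [|exact: one|exact: one].
by rewrite limit_state_monomialC // [z * z']mulrC.
Qed.

End existence.

Section extension.
Variables (R : realType) (V : normedModType R[i]) (T : Type) (D : set T) (j : T -> V).
Local Notation C := R[i].

(* McShane's extension of a Lipschitz function. *)
Lemma lipschitz_extension (l : T -> R) : D !=set0 ->
  (forall d d', D d -> D d' -> l d - l d' <= rnorm (j d - j d')) ->
  exists r : V -> R, forall a d, D d -> `|r a - l d| <= rnorm (a - j d).
Proof.
move=> D0 lip; pose E a := [set l d + rnorm (a - j d) | d in D].
have lb a d : D d -> lbound (E a) (l d - rnorm (a - j d)).
  move=> Dd _ [d' Dd' <-]; rewrite lerBlDr -addrA -lerBlDl.
  apply: le_trans (lip _ _ Dd Dd') _.
  have -> : j d - j d' = (a - j d') - (a - j d).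
    by rewrite opprB [RHS]addrC addrA subrK.
  by apply: le_trans (rnormD _ _) _; rewrite rnormN.
exists (fun a => inf (E a)) => a d Dd; rewrite ler_distl; apply/andP; split.
  apply: lb_le_inf; last exact: lb.
  by have [d' Dd'] := D0; exists (l d' + rnorm (a - j d')), d'.
by apply: ge_inf; [exists (l d - rnorm (a - j d)); exact: lb|exists d].
Qed.

(** Real and imaginary parts are extended separately, whence the factor 2. It is harmless:
    [tau (j d) = L d] still follows, and the sharp bound is recovered by density. *)
Lemma complex_lipschitz_extension (L : T -> C) : D !=set0 ->
  (forall d d', D d -> D d' -> rnorm (L d - L d') <= rnorm (j d - j d')) ->
  exists tau : V -> C, forall a d, D d -> rnorm (tau a - L d) <= 2 * rnorm (a - j d).
Proof.
move=> D0 lip; have [d d' Dd Dd'|r1 H1] := @lipschitz_extension (fun d => complex.Re (L d)) D0.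
  rewrite -raddfB; apply: le_trans (ler_norm _) _.
  by apply: le_trans (Re_le_rnorm _) _; exact: lip.
have [d d' Dd Dd'|r2 H2] := @lipschitz_extension (fun d => complex.Im (L d)) D0.
  rewrite -raddfB; apply: le_trans (ler_norm _) _.
  by apply: le_trans (Im_le_rnorm _) _; exact: lip.
exists (fun a => ((r1 a)%:C + 'i * (r2 a)%:C)%C) => a d Dd.
have -> : ((r1 a)%:C + 'i * (r2 a)%:C - L d)%C =
    ((r1 a - complex.Re (L d))%:C + 'i * (r2 a - complex.Im (L d))%:C)%C.
  by rewrite {1}[L d]complexE 2!rmorphB mulrBr opprD addrACA.
apply: le_trans (rnormD _ _) _; rewrite rnormM !rnorm_real rnorm_i.
by rewrite mul1r mulr_natl mulr2n lerD ?H1 ?H2.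
Qed.

End extension.

Section trace.
Variables (R : realType) (X : alphabet) (Gam : self_similar_group X).
Hypothesis Gam_fs : finite_state Gam.
Local Notation C := R[i].
Local Notation Y := (iword X).
Local Notation S := (ssg_pseudogroup Gam).
Local Notation G := (ssg_groupoid Gam).
Local Notation mono s c := (@monomial R Y S s c : garr G -> C).
Local Notation span := (@monomial_span R Y S (@iword_hausdorff X)
  (@iword_locally_compact X) (@constf R X)).
Variables (A : cstar_algebra R) (iota : (garr G -> C) -> A).
Hypothesis iotaP : is_full_cstar_algebra iota.
Implicit Types (f : garr G -> C) (a b : A).

Lemma bounded_functional_eq0 (phi : A -> C) (K : R) :
  (forall a b, phi (a - b) = phi a - phi b) ->
  (forall a, rnorm (phi a) <= K * rnorm a) ->
  (forall f, span f -> phi (iota f) = 0) -> forall a, phi a = 0.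
Proof.
move=> phiB phiK phi0 a; apply: rnorm_small => e e0.
have K0 : 0 < `|K| + 1 by rewrite ltr_wpDl.
have [f sf Hf] := dense_constf iotaP a (divr_gt0 e0 K0).
rewrite -[phi a]subr0 -(phi0 _ sf) -phiB; apply: le_trans (phiK _) _.
rewrite -[e](divfK (lt0r_neq0 K0)) [leRHS]mulrC.
apply: le_trans (_ : (`|K| + 1) * rnorm (a - iota f) <= _); last by rewrite ler_pM2l.
apply: ler_wpM2r; first exact: rnorm_ge0.
by apply: le_trans (ler_norm K) _; rewrite lerDl.
Qed.

(** [limit_state] is Lipschitz for the norm of [A], hence extends to a mere function on [A];
    linearity, the norm bound, positivity and the trace identity are then carried over from the
    dense span. *)
Lemma tracial_state_exists : exists tau : A -> C, tracial_state tau.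
Proof.
pose L := @limit_state R X Gam.
have LD f f' : span f -> span f' -> L (fun ga => f ga + f' ga) = L f + L f'.
  exact: limit_stateD.
have LZ z f : span f -> L (fun ga => z * f ga) = z * L f by exact: limit_stateZ.
have sZ z f : span f -> span (fun ga => z * f ga) by exact: span_constfZ.
have lip f f' : span f -> span f' -> rnorm (L f - L f') <= rnorm (iota f - iota f').
  move=> sf sf'; rewrite -[- L f']mulN1r -LZ // -LD //; last exact: sZ.
  apply: le_trans (limit_state_bound Gam_fs iotaP (spanD sf (sZ (-1) _ sf'))) _.
  rewrite (iotaD iotaP); [|exact: cc_constf|exact: cc_constf (sZ _ _ sf')].
  by rewrite (iotaZ iotaP) ?scaleN1r //; exact: cc_constf.
have [|tau Htau] := @complex_lipschitz_extension R A _ [set f | span f] iota L _ lip.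
  by exists (fun=> 0); exact: span0.
have apx a (e : R) : 0 < e -> exists f, [/\ span f, rnorm (a - iota f) <= e &
    rnorm (tau a - L f) <= 2 * e].
  move=> e0; have [f sf Hf] := dense_constf iotaP a e0; exists f; split=> //.
  by apply: le_trans (Htau a f sf) _; rewrite ler_pM2l.
have tau_iota f : span f -> tau (iota f) = L f.
  move=> sf; apply/eqP; rewrite -subr_eq0; apply/eqP/rnorm0_eq0/eqP.
  rewrite eq_le rnorm_ge0 andbT; apply: le_trans (Htau _ _ sf) _.
  by rewrite subrr rnorm0 mulr0.
have tau_lin z a b : tau (z *: a + b) = z * tau a + tau b.
  apply/eqP; rewrite -subr_eq0; apply/eqP/rnorm_small => e e0.
  have K0 : 0 < 4 * (rnorm z + 1) by rewrite mulr_gt0 // ltr_wpDl // rnorm_ge0.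
  (* Both the approximation of [tau (z *: a + b)] and that of the right-hand side cost at most 2
     (|z| + 1) e'. *)
  pose e' := e / (4 * (rnorm z + 1)); have e'0 : 0 < e' by exact: divr_gt0.
  have [f [sf af tf]] := apx a _ e'0; have [f' [sf' bf' tf']] := apx b _ e'0.
  have sff := spanD (sZ z f sf) sf'.
  have -> : tau (z *: a + b) - (z * tau a + tau b) =
      (tau (z *: a + b) - L (fun ga => z * f ga + f' ga)) -
      (z * (tau a - L f) + (tau b - L f')).
    by rewrite LD // ?LZ //; [ring|exact: sZ].
  apply: le_trans (rnormD _ _) _; rewrite rnormN.
  have h1 := Htau (z *: a + b) _ sff; rewrite (iotaD iotaP) in h1; last 2 first.
  - by apply: cc_constf; exact: sZ.
  - exact: cc_constf.
  rewrite (iotaZ iotaP) in h1; last exact: cc_constf.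
  have h2 : rnorm (z *: a + b - (z *: iota f + iota f')) <= rnorm z * e' + e'.
    rewrite opprD addrACA -scalerBr; apply: le_trans (rnormD _ _) _.
    by rewrite rnormZ lerD // ler_wpM2l // rnorm_ge0.
  have h3 : rnorm (z * (tau a - L f) + (tau b - L f')) <= rnorm z * (2 * e') + 2 * e'.
    apply: le_trans (rnormD _ _) _.
    by rewrite rnormM lerD // ler_wpM2l // rnorm_ge0.
  have : e = 4 * (rnorm z + 1) * e' by rewrite /e' mulrC divfK // lt0r_neq0.
  have := rnorm_ge0 z; move: h1 h2 h3; set r1 := rnorm _; set r2 := rnorm _.
  set r3 := rnorm (_ + _); lra.
have tauD a b : tau (a + b) = tau a + tau b.
  by have := tau_lin 1 a b; rewrite scale1r mul1r.
have tau0 : tau 0 = 0 by apply: (addrI (tau 0)); rewrite -tauD !addr0.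
have tauB a b : tau (a - b) = tau a - tau b.
  by have := tau_lin (-1) b a; rewrite scaleN1r addrC => ->; rewrite mulN1r addrC.
have tau_bound a : rnorm (tau a) <= rnorm a.
  (* The extension costs 2 e/3 and the comparison of [iota f] with [a] a further e/3. *)
  apply/ler_addgt0Pr => e e0; have e3 : 0 < e / 3 by exact: divr_gt0.
  have [f [sf af tf]] := apx a _ e3.
  have h1 : rnorm (tau a) <= rnorm (L f) + rnorm (tau a - L f).
    by rewrite -{1}[tau a](subrKC (L f)) rnormD.
  have h2 : rnorm (iota f) <= rnorm a + rnorm (a - iota f).
    by rewrite [rnorm (a - _)]rnormB -{1}[iota f](subrKC a) rnormD.
  have := limit_state_bound Gam_fs iotaP sf.
  rewrite -/(L f); move: h1 h2 af tf.
  set r1 := rnorm (tau a); set r2 := rnorm (L f); set r3 := rnorm (tau a - _).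
  set r4 := rnorm (iota f); set r5 := rnorm a; set r6 := rnorm _; lra.
have tauM a f f' : span f -> span f' -> tau (cmul (iota f) (iota f')) = L (conv f f').
  move=> sf sf'; rewrite -(full_mul iotaP); [|exact: cc_constf|exact: cc_constf].
  by apply: tau_iota; exact: span_constf_conv.
exists tau; split=> //.
- move=> a; apply: ge0_closed => e e0.
  (* The error is at most e' (|a| + |iota f|) <= e' (2 |a| + e'), which is at most e' K as e' <=
     1. *)
  pose K := 2 * rnorm a + 1; have K0 : 0 < K by rewrite ltr_wpDl // mulr_ge0 // rnorm_ge0.
  pose e' := Num.min 1 (e / K); have e'0 : 0 < e' by rewrite lt_min ltr01 divr_gt0.
  have e'1 : e' <= 1 by rewrite ge_min lexx.
  have e'e : K * e' <= e by rewrite mulrC -ler_pdivlMr // ge_min lexx orbT.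
  have [f sf af] := dense_constf iotaP a e'0; exists (L (conv (cc_star f) f)).
    exact: limit_state_ge0.
  have cf := cc_constf sf; have sfs := span_constf_star sf.
  rewrite -(tauM a) // (full_star iotaP) // -tauB.
  have -> : cmul (cstar a) a - cmul (cstar (iota f)) (iota f) =
      cmul (cstar a) (a - iota f) + cmul (cstar (a - iota f)) (iota f).
    by rewrite cmulBr cstarB cmulBl addrA subrK.
  apply: le_trans (tau_bound _) _; apply: le_trans (rnormD _ _) _.
  have h1 := rnorm_cmul (cstar a) (a - iota f).
  have h2 := rnorm_cmul (cstar (a - iota f)) (iota f).
  rewrite !rnorm_cstar in h1 h2.
  have h3 : rnorm (iota f) <= rnorm a + rnorm (a - iota f).
    by rewrite [rnorm (a - _)]rnormB -{1}[iota f](subrKC a) rnormD.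
  have h4 := rnorm_ge0 a; have h5 := rnorm_ge0 (a - iota f).
  have h6 := rnorm_ge0 (iota f).
  apply: le_trans (lerD h1 h2) _; apply: le_trans e'e; rewrite /K.
  move: h3 h4 h5 h6 af; set ra := rnorm a; set rd := rnorm (a - _); set rf := rnorm _.
  by move=> *; nra.
- apply/eqP; rewrite eq_le; apply/andP; split.
    apply: ub_ereal_sup => _ [a a1 <-].
    change ((rnorm (tau a))%:E <= 1%:E)%E; rewrite lee_fin.
    apply: le_trans (tau_bound _) _; by rewrite -rnorm_le1.
  (* The norm 1 is attained at the unit, on which every level mean is 1. *)
  apply: ereal_sup_ubound; exists (germ_isometry iota Some).
    rewrite /= rnorm_le1; apply: rnorm_germ_isometry => //; exact: psg_some.
  have s1 : span (mono Some (fun=> 1)).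
    by apply: span1; [exact: psg_some|exists 1].
  change ((rnorm (tau (germ_isometry iota Some)))%:E = 1%E).
  rewrite /germ_isometry tau_iota //.
  suff -> : L (mono Some (fun=> 1)) = 1 by rewrite /rnorm normr1.
  apply: ctends_unique (limit_stateP Gam_fs s1) _.
  have := ctends_cst (1 : C); congr ctends; apply/funext => n.
  rewrite level_mean_monomial; last exact: psg_some.
  have -> : nfix_at point n (Some : Y -> option Y) = (#|X| ^ n)%N.
    by rewrite -card_tuple; apply: eq_card => w; rewrite unfold_in /= eqxx.
  by rewrite natrX divff // expf_neq0 // pnatr_eq0 -lt0n (ltnW (alphabet_gt1 X)).
- move=> a b; apply/eqP; rewrite -subr_eq0; apply/eqP.
  have bd c d : rnorm (tau (cmul c d) - tau (cmul d c)) <= 2 * (rnorm c * rnorm d).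
    apply: le_trans (rnormD _ _) _; rewrite rnormN mulr_natl mulr2n.
    apply: lerD; apply: le_trans (tau_bound _) _; apply: le_trans (rnorm_cmul _ _) _ => //.
    by rewrite mulrC.
  (* Density is used once in each variable: in [a] for fixed [b], then in [b] with the other factor
     already in the image of the span. *)
  apply: (@bounded_functional_eq0 (fun a => tau (cmul a b) - tau (cmul b a)) (2 * rnorm b)).
  + by move=> c d; rewrite cmulBl cmulBr !tauB; ring.
  + by move=> c; apply: le_trans (bd _ _) _; rewrite -mulrA [rnorm c * _]mulrC.
  move=> f sf.
  apply: (@bounded_functional_eq0 (fun b => tau (cmul (iota f) b) - tau (cmul b (iota f)))
    (2 * rnorm (iota f))).
  + by move=> c d; rewrite cmulBl cmulBr !tauB; ring.
  + by move=> c; apply: le_trans (bd _ _) _; rewrite mulrA.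
  by move=> f' sf'; rewrite !tauM // /L limit_stateC // subrr.
Qed.

End trace.

Theorem corollary6p2 (R : realType) (X : alphabet)
    (Gam : self_similar_group X) (Gam_fs : finite_state Gam) :
  (forall mu : probability (borel (iword X)) R, bernoulli mu ->
     @essentially_free (ssg_groupoid Gam) R mu) /\
  (forall (A : cstar_algebra R) (iota : (garr (ssg_groupoid Gam) -> R[i]) -> A),
     is_full_cstar_algebra iota ->
     exists! tau : A -> R[i], tracial_state tau).
Proof.
split=> [mu mu_bernoulli|A iota iotaP]; first exact: bernoulli_essentially_free.
have [tau tauP] := tracial_state_exists Gam_fs iotaP.
by exists tau; split=> // tau'; exact: (tr_unique Gam_fs iotaP).
Qed.
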